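(* Let $p,q\in(M,\tau)$ be Hermitian with $\mu_p=a\delta_\alpha+(1-a)\delta_{\alpha'}$ and $\mu_q=b\delta_\beta+(1-b)\delta_{\beta'}$, where $a,b\in(0,1)$, $\alpha,\alpha',\beta,\beta'\in\mathbb{R}$, $\alpha\ne\alpha'$, $\beta\neq\beta'$. Let $\mathscr{A}=\alpha'-\alpha$ and $\mathscr{B}=\beta'-\beta$, and let $$H=\left\{z=x+iy\in\mathbb{C}:\left(x-\tfrac{\alpha+\alpha'}{2}\right)^2-\left(y-\tfrac{\beta+\beta'}{2}\right)^2=\tfrac{\mathscr{A}^2-\mathscr{B}^2}{4}\right\},$$ $$R=\left\{z=x+iy\in\mathbb{C}: x\in[\alpha\wedge\alpha',\alpha\vee\alpha'],\ y\in[\beta\wedge\beta',\beta\vee\beta']\right\}.$$ Let $\lambda_1,\lambda_2:[0,\pi/2]\to\mathbb{C}$ be the continuous functions $$\lambda_{1}(\theta)=c-s(\theta),\qquad \lambda_2(\theta)=c+s(\theta),\qquad c=\tfrac{\alpha+\alpha'}{2}+i\tfrac{\beta+\beta'}{2},$$ $$s(\theta)=\begin{cases}\frac12\sqrt{\mathscr{A}^2-\mathscr{B}^2+2i\mathscr{A}\mathscr{B}\cos(2\theta)} & \text{if }|\mathscr{A}|\ge|\mathscr{B}|,\\[2pt] \frac{i}{2}\sqrt{\mathscr{B}^2-\mathscr{A}^2-2i\mathscr{A}\mathscr{B}\cos(2\theta)} & \text{if }|\mathscr{A}|<|\mathscr{B}|,\end{cases}$$ with $\sqrt{\cdot}$ the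 principal branch of the square root on $\mathbb{C}\setminus(-\infty,0)$. Then: (i) $\lambda_1,\lambda_2$ parameterize $H\cap R$ (i.e. $\lambda_1([0,\pi/2])\cup\lambda_2([0,\pi/2])=H\cap R$). (ii) When $|\mathscr{A}|\ge|\mathscr{B}|$, $\lambda_1$ parameterizes the left component of $H\cap R$ and $\lambda_2$ parameterizes the right component of $H\cap R$. When $|\mathscr{A}|<|\mathscr{B}|$, $\lambda_1$ parameterizes the bottom component of $H\cap R$ and $\lambda_2$ parameterizes the top component of $H\cap R$. (iii) The support of the Brown measure of $X=p+iq$ is contained in $H\cap R$.
   Context: $(M,\tau)$ is a von Neumann algebra with a faithful, normal, tracial state $\tau$. No freeness of $p$ and $q$ is assumed. For Hermitian $y\in M$, $\mu_y$ is the spectral measure of $y$ with respect to $\tau$. For real numbers, $s\wedge t=\min(s,t)$ and $s\vee t=\max(s,t)$. For $x\in M$, the Fuglede-Kadison determinant is $\Delta(x)=\exp\left[\int_0^\infty\log t\,d\mu_{|x|}(t)\right]$ with $|x|=(x^*x)^{1/2}$, and the Brown measure of $x$ is the Borel probability measure $\frac{1}{2\pi}\nabla^2\log\Delta(z-x)$ on $\mathbb{C}$ (distributional Laplacian in $z$). The left (resp. right) component of $H\cap R$ is its part with $\operatorname{Re} z\le\frac{\alpha+\alpha'}{2}$ (resp. $\ge$); the bottom (resp. top) component is its part with $\operatorname{Im} z\le\frac{\beta+\beta'}{2}$ (resp. $\ge$). When $|\mathscr{A}|\neq|\mathscr{B}|$ these are the actual connected components of $H\cap R$. *)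

(* Defs.v *)
From HB Require Import structures.
From mathcomp Require Import all_boot all_order all_algebra.
From mathcomp Require Import all_classical all_reals all_analysis.
From mathcomp Require Import complex sesquilinear.

Set Implicit Arguments.
Unset Strict Implicit.
Unset Printing Implicit Defensive.

Import Order.TTheory GRing.Theory Num.Theory.
Import numFieldNormedType.Exports.

Local Open Scope classical_set_scope.
Local Open Scope ring_scope.
Local Open Scope complex_scope.

Section VonNeumannAlgebra.
Context {R : realType} {H : completeNormedModType R[i]}.
(* The inner product is linear in its first argument. *)
Variable ip : {dot H for Num.conj}.

(* With completeness of H, this makes (H, ip) a complex Hilbert space. *)
Definition inner_product_norm : Prop := forall u : H, ip u u = `|u| ^+ 2.

Implicit Types S T : H -> H.

Definition bounded_operator T : Prop :=
  linear T /\ exists r : R, forall u, `|T u| <= r%:C * `|u|.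

Definition adjoint T S : Prop := forall u v, ip (T u) v = ip u (S v).

Definition self_adjoint T : Prop := adjoint T T.

Definition positive_operator T : Prop := forall u, 0 <= ip (T u) u.

Definition operator_le S T : Prop := positive_operator (T - S).

(* The closure in the weak operator topology, whose basic neighbourhoods of T
   are cut out by finitely many conditions |<(S - T)u, v>| < e. *)
Definition weak_operator_closure (M : set (H -> H)) : set (H -> H) :=
  [set T | bounded_operator T /\
     forall (s : seq (H * H)) (e : R), 0 < e ->
       exists2 S, M S &
         forall uv, uv \in s -> `|ip (S uv.1 - T uv.1) uv.2| < e%:C].

Definition von_neumann_algebra (M : set (H -> H)) : Prop :=
  [/\ forall T, M T -> bounded_operator T,
      M idfun,
      forall (c : R[i]) S T, M S -> M T -> M (c *: S + T),
      forall S T, M S -> M T -> M (S \o T) &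
      (forall T, M T -> exists2 S, M S & adjoint T S) /\
      weak_operator_closure M `<=` M].

Definition directed (D : set (H -> H)) : Prop :=
  D !=set0 /\ forall S T, D S -> D T ->
    exists U, [/\ D U, operator_le S U & operator_le T U].

Definition operator_lub (M D : set (H -> H)) T : Prop :=
  [/\ M T, self_adjoint T,
      forall S, D S -> operator_le S T &
      forall U, M U -> self_adjoint U ->
        (forall S, D S -> operator_le S U) -> operator_le T U].

(* The values of tau outside M are irrelevant. The order on R[i] is
   x <= y iff y - x is real and nonnegative, so the last clause says that
   tau T is the supremum of tau over D (it is an upper bound by positivity). *)
Definition faithful_normal_tracial_state
    (M : set (H -> H)) (tau : (H -> H) -> R[i]) : Prop :=
  [/\ forall (c : R[i]) S T, M S -> M T -> tau (c *: S + T) = c * tau S + tau T,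
      (forall T, M T -> positive_operator T -> 0 <= tau T) /\ tau idfun = 1,
      forall S T, M S -> M T -> tau (S \o T) = tau (T \o S),
      forall T, M T -> positive_operator T -> tau T = 0 -> T = 0 &
      forall D T, D `<=` M -> (forall S, D S -> positive_operator S) ->
        directed D -> operator_lub M D T ->
        forall c, (forall S, D S -> tau S <= c) -> tau T <= c].

(* E is the projection-valued measure of y: y is the integral of t dE(t).
   Countable additivity is that of the scalar measures <E(.)u, u>. *)
Definition spectral_resolution (y : H -> H) (E : set R -> (H -> H)) : Prop :=
  [/\ forall B, measurable B ->
        [/\ bounded_operator (E B), self_adjoint (E B) & E B \o E B = E B],
      E setT = idfun,
      forall A B, measurable A -> measurable B -> E (A `&` B) = E A \o E B,
      exists r : R, E [set` `[- r, r]] = idfun &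
      forall u, exists nu : {measure set R -> \bar R},
        (forall B, measurable B -> (complex.Re (ip (E B u) u))%:E = nu B) /\
        ip (y u) u = (\int[nu]_t t)%R%:C].

Variables (M : set (H -> H)) (tau : (H -> H) -> R[i]).

(* mu = tau o E on Borel sets, for the projection-valued measure E of y. *)
Definition spectral_measure (y : H -> H) (mu : set R -> \bar R) : Prop :=
  exists2 E, spectral_resolution y E &
    forall B, measurable B -> M (E B) /\ mu B = (complex.Re (tau (E B)))%:E.

(* d is Delta(x), with h = |x|. As lne 0 = -oo and expeR -oo = 0, the
   integral may be -oo, in particular when mu has an atom at 0. *)
Definition fuglede_kadison (x : H -> H) (d : \bar R) : Prop :=
  exists h xs (mu : {measure set R -> \bar R}),
    [/\ M h /\ positive_operator h,
        M xs /\ adjoint x xs,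
        h \o h = xs \o x,
        spectral_measure h mu &
        d = expeR (\int[mu]_(t in `[0%R, +oo[) lne t%:E)%E].

End VonNeumannAlgebra.

Section Distributions.
Context {R : realType}.
Implicit Types phi : R * R -> R.

Definition axis (b : bool) : R * R := if b then (0, 1) else (1, 0).

Definition partial (b : bool) phi : R * R -> R := fun z => 'D_(axis b) phi z.

Definition partials (s : seq bool) phi : R * R -> R := foldr partial phi s.

(* phi is C^oo (all iterated partial derivatives exist and are continuous) with
   compact support. *)
Definition test_function phi : Prop :=
  (forall s, continuous (partials s phi) /\
     forall b z, derivable (partials s phi) z (axis b)) /\
  compact (closure [set z | phi z != 0]).

Definition laplacian phi : R * R -> R :=
  fun z => partials [:: false; false] phi z + partials [:: true; true] phi z.

Definition measure_support (mu : set (R * R) -> \bar R) : set (R * R) :=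
  [set z | forall U : set (R * R), open U -> U z -> (0 < mu U)%E].

End Distributions.

(* Measures on the complex plane are measures on R * R. *)
Definition toC {R : realType} (z : R * R) : R[i] := z.1 +i* z.2.

(* mu is 1/(2 pi) times the distributional Laplacian of z |-> log Delta(z - x).
   That function is locally integrable, and 0 * -oo = 0, so the right-hand
   integral is the usual one; real test functions suffice by linearity. *)
Definition brown_measure {R : realType} {H : completeNormedModType R[i]}
    (ip : {dot H for Num.conj}) (M : set (H -> H)) (tau : (H -> H) -> R[i])
    (x : H -> H) (mu : probability (R * R)%type R) : Prop :=
  exists2 Delta : R * R -> \bar R,
    forall z, fuglede_kadison ip M tau (toC z *: idfun - x) (Delta z) &
    forall phi, test_function phi ->
      (\int[mu]_z (phi z)%:E =
       ((2 * pi)^-1)%:E *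
       \int[(@lebesgue_measure R \x @lebesgue_measure R)]_z
          ((laplacian phi z)%:E * lne (Delta z)))%E.

Definition two_atoms {R : realType} (a x y : R) : set R -> \bar R :=
  fun B => (a%:E * \d_x B + (1 - a)%:E * \d_y B)%E.

Section Hyperbola.
Context {R : realType}.
Variables alpha alpha' beta beta' : R.
Let A := alpha' - alpha.
Let B := beta' - beta.

Definition hyperbola : set R[i] :=
  [set z | (complex.Re z - (alpha + alpha') / 2) ^+ 2
           - (complex.Im z - (beta + beta') / 2) ^+ 2
           = (A ^+ 2 - B ^+ 2) / 4].

Definition rectangle : set R[i] :=
  [set z | Num.min alpha alpha' <= complex.Re z <= Num.max alpha alpha' /\
           Num.min beta beta' <= complex.Im z <= Num.max beta beta'].

Definition center : R[i] := ((alpha + alpha') / 2) +i* ((beta + beta') / 2).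

(* sqrtc is the principal square root (real part >= 0), unlike sqrtC, which
   takes values of nonnegative imaginary part. *)
Definition half_chord (theta : R) : R[i] :=
  if `|B| <= `|A| then
    2^-1 * sqrtc ((A ^+ 2 - B ^+ 2) +i* (2 * A * B * cos (2 * theta)))
  else
    'i / 2 * sqrtc ((B ^+ 2 - A ^+ 2) -i* (2 * A * B * cos (2 * theta))).

Definition lambda1 (theta : R) : R[i] := center - half_chord theta.
Definition lambda2 (theta : R) : R[i] := center + half_chord theta.

End Hyperbola.

(* Main.v *)
Require Import Defs.
From HB Require Import structures.
From mathcomp Require Import all_boot all_order all_algebra.
From mathcomp Require Import all_classical all_reals all_analysis.
From mathcomp Require Import complex sesquilinear polyrcf measurable_realfun.
From mathcomp Require Import ring lra.

Set Implicit Arguments.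
Unset Strict Implicit.
Unset Printing Implicit Defensive.

Import Order.TTheory GRing.Theory Num.Theory.
Import numFieldNormedType.Exports.

Local Open Scope classical_set_scope.
Local Open Scope ring_scope.
Local Open Scope complex_scope.

(** The curves are governed by the square of the half chord s(theta): its real
    part is (A^2 - B^2)/4 and its imaginary part runs over [-|AB|/2, |AB|/2].  For
    a point c + x + iy this says that x^2 - y^2 = (A^2 - B^2)/4 and |xy| <= |AB|/4,
    and on the hyperbola the second condition is the same as lying in the rectangle
    ([hyperbola_rectangleP]).  Taking the square root in a half-plane selects one
    of the two components ([lambda_image]).

    The same computation locates the spectrum of X = p + iq.  Since the trace is
    faithful, the spectral projection of p off its two atoms vanishes, so p is a
    root of the polynomial with these two roots ([two_point_spectrum]); the
    centred operators p0 and q0 thus satisfy p0^2 = A^2/4 and q0^2 = B^2/4.  Then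
    X0 = p0 + i q0 has X0^2 = (A^2 - B^2)/4 + i S with S = p0 q0 + q0 p0
    self-adjoint of norm at most |AB|/2.  For z off H and R the operator
    (z + X0)(z - X0) is therefore normal and bounded below, which bounds z - X0 and
    its adjoint below ([resolvent_bounded_below]).

    It remains to see that log Delta(z - X) is harmonic in z where z - X and its
    adjoint are bounded below: integrating a bump function against the Brown
    measure then gives 0, and the bump is positive near a given point.  For a
    bounded below put T = star a * a and U = 1 - T/L, a strict contraction when L is
    large.  The moments of the spectral measure of |a| are traces of powers of |a|
    ([spectral_moment]), whence 2 log Delta(a) = log L - sum_n tr(U^n)/n
    ([fuglede_kadison_series]).  Because of the trace property, the derivative of
    this series along the segment from a to a + z is 2 Re (z tr((a + t z)^-1)), and
    the resolvent is a power series in t z.  So log Delta(a + z) is a uniform limit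
    of real parts of polynomials in z ([log_determinant_expansion]).  Inverses only
    enter through truncated Neumann series with geometric error bounds, so that all
    operators are polynomials in a and its adjoint.  Finally the Laplacian of a bump
    integrates to 0 against the real part of a polynomial, by Fubini and Green's
    formula on each line, hence also against such a uniform limit
    ([integral_laplacian_eq0]). *)

(** * The hyperbola in the rectangle and its parametrization *)

Section Geometry.
Context {R : realType}.
Implicit Types x y t : R.

Lemma between_min_max x y t :
  (Num.min x y <= t <= Num.max x y) =
  ((t - (x + y) / 2) ^+ 2 <= (y - x) ^+ 2 / 4).
Proof.
apply/idP/idP.
  by case: (leP x y) => xy /andP[h1 h2]; nra.
move=> h; apply/andP; case: (leP x y) => xy; split; nra.
Qed.

Lemma in_rectangle (al al' be be' : R) (z : R[i]) :
  rectangle al al' be be' z <->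
  (complex.Re z - (al + al') / 2) ^+ 2 <= (al' - al) ^+ 2 / 4 /\
  (complex.Im z - (be + be') / 2) ^+ 2 <= (be' - be) ^+ 2 / 4.
Proof. by rewrite /rectangle /= !between_min_max. Qed.

Lemma sqrtc_Re_ge0 (w : R[i]) : 0 <= complex.Re (sqrtc w).
Proof. by case: w => a b /=; exact: sqrtr_ge0. Qed.

Lemma continuous_complex (f g : R -> R) : continuous f -> continuous g ->
  continuous ((fun t => f t +i* g t) : R -> R[i]^o).
Proof.
move=> cf cg t; apply/(@cvgrPdist_lt _ R[i]^o) => e e0.
have [e' e'0 ->] : exists2 e', 0 < e' & e = e'%:C.
  by case: e e0 => a b; rewrite ltcE /= => /andP[/eqP -> a0]; exists a.
have e20 : 0 < e' / 2 by lra.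
have /cvgrPdist_lt/(_ _ e20) hf := cf t.
have /cvgrPdist_lt/(_ _ e20) hg := cg t.
near=> s.
have : `|f t - f s| < e' / 2 by near: s.
have : `|g t - g s| < e' / 2 by near: s.
rewrite normc_def /= ltcR => h1 h2.
have -> : e' = Num.sqrt (e' ^+ 2) by rewrite sqrtr_sqr ger0_norm // ltW.
rewrite ltr_sqrt ?exprn_gt0 //.
move: h1 h2; rewrite !ltr_norml => /andP[h1 h2] /andP[h3 h4]; nra.
Unshelve. all: by end_near. Qed.


(** The branch cut is only approached at the origin, where the imaginary part of
    the root tends to 0; splitting it into positive and negative parts removes the
    sign that appears in the definition. *)
Lemma continuous_sqrtc_right_half_plane (a : R) (g : R -> R) : 0 <= a ->
  continuous g -> continuous ((fun t => sqrtc (a +i* g t)) : R -> R[i]^o).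
Proof.
move=> a0 cg.
pose w y : R := Num.sqrt ((Num.sqrt (a ^+ 2 + y ^+ 2) - a) / 2).
have w0 : w 0 = 0.
  by rewrite /w expr0n /= addr0 sqrtr_sqr ger0_norm // subrr mul0r sqrtr0.
have wN y : w (- y) = w y by rewrite /w sqrrN.
have cw : continuous w.
  move=> y; apply: (@continuous_comp _ _ _
    (fun y => (Num.sqrt (a ^+ 2 + y ^+ 2) - a) / 2) Num.sqrt); last first.
    exact: sqrt_continuous.
  apply: cvgMr_tmp; apply: cvgB; last exact: cvg_cst.
  apply: (@continuous_comp _ _ _ (fun y => a ^+ 2 + y ^+ 2) Num.sqrt);
    last exact: sqrt_continuous.
  by apply: cvgD; [exact: cvg_cst | exact: exprn_continuous].
have -> : (fun t => sqrtc (a +i* g t)) = (fun t =>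
    Num.sqrt ((Num.sqrt (a ^+ 2 + g t ^+ 2) + a) / 2) +i*
    (w (Num.max (g t) 0) - w (Num.max (- g t) 0))).
  apply/funext => t /=; congr (_ +i* _); rewrite -/(w (g t)).
  case: (ltrgtP (g t) 0) => [gt0|gt0|->].
  - rewrite max_l ?oppr_ge0 ?(ltW gt0) //.
    by rewrite ltr0_sg // w0 wN sub0r mulN1r.
  - rewrite max_r ?oppr_le0 ?(ltW gt0) //.
    by rewrite gtr0_sg // w0 subr0 mul1r.
  - by rewrite oppr0 maxxx w0 mulr0 subrr.
apply: continuous_complex => t.
  apply: (@continuous_comp _ _ _
    (fun t => (Num.sqrt (a ^+ 2 + g t ^+ 2) + a) / 2) Num.sqrt); last first.
    exact: sqrt_continuous.
  apply: cvgMr_tmp; apply: cvgD; last exact: cvg_cst.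
  apply: (@continuous_comp _ _ _ (fun t => a ^+ 2 + g t ^+ 2) Num.sqrt);
    last exact: sqrt_continuous.
  apply: cvgD; [exact: cvg_cst|].
  by apply: (@continuous_comp _ _ _ g (fun y => y ^+ 2)); [exact: cg|exact: exprn_continuous].
have cmax (h : R -> R) : continuous h -> continuous (fun t => w (Num.max (h t) 0)).
  move=> ch s; apply: (@continuous_comp _ _ _ (fun t => Num.max (h t) 0) w);
    last exact: cw.
  by apply: continuous_max; [exact: ch|exact: cvg_cst].
apply: cvgB; first exact: cmax.
by apply: (cmax (fun t => - g t)) => s; apply: cvgN; exact: cg.
Qed.

Section Chord.
Variables al al' be be' : R.
Hypotheses (nal : al != al') (nbe : be != be').
Let A := al' - al.
Let B := be' - be.
Let hc := half_chord al al' be be'.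
Let c := Defs.center al al' be be'.
Let HR := hyperbola al al' be be' `&` rectangle al al' be be'.

Let halfC : (2^-1 : R[i]) = (2^-1 : R)%:C.
Proof. by rewrite fmorphV rmorphD rmorph1. Qed.

Lemma half_chord_sqr t :
  (hc t) ^+ 2 = ((A ^+ 2 - B ^+ 2) / 4) +i* (A * B * cos (2 * t) / 2).
Proof.
rewrite /hc /half_chord -/A -/B halfC; case: ifP => _; rewrite exprMn sqr_sqrtc.
  by rewrite expr2; apply/eqP; rewrite eq_complex /=; apply/andP; split; apply/eqP; field.
by rewrite expr2; apply/eqP; rewrite eq_complex /=; apply/andP; split; apply/eqP; field.
Qed.

Lemma half_chord_half_plane t :
  if `|B| <= `|A| then 0 <= complex.Re (hc t) else 0 <= complex.Im (hc t).
Proof.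
rewrite /hc /half_chord -/A -/B halfC.
case: (_ <= _); set w := sqrtc _.
  have : 0 <= complex.Re w by exact: sqrtc_Re_ge0.
  by case: w => x y /= x0; nra.
have : 0 <= complex.Re w by exact: sqrtc_Re_ge0.
by case: w => x y /= x0; nra.
Qed.

Lemma continuous_half_chord : continuous (hc : R -> R[i]^o).
Proof.
have cc (k : R) : continuous (fun t : R => k * cos (2 * t)).
  move=> t; apply: cvgMl_tmp; apply: (@continuous_comp _ _ _ (fun t => 2 * t) cos).
    exact: mulrl_continuous.
  exact: continuous_cos.
rewrite /hc /half_chord -/A -/B; case: (boolP (`|B| <= `|A|)) => AB t.
  have D0 : 0 <= A ^+ 2 - B ^+ 2.
    rewrite subr_ge0 -[A ^+ 2]real_normK ?num_real //.
    by rewrite -[B ^+ 2]real_normK ?num_real // ler_sqr ?nnegrE.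
  apply: (@cvgMl_tmp R[i]).
  apply: (@continuous_sqrtc_right_half_plane _ (fun t => 2 * A * B * cos (2 * t))) => //.
have D0 : 0 <= B ^+ 2 - A ^+ 2.
  move: AB; rewrite -ltNge => /ltW AB.
  rewrite subr_ge0 -[A ^+ 2]real_normK ?num_real //.
  by rewrite -[B ^+ 2]real_normK ?num_real // ler_sqr ?nnegrE.
apply: (@cvgMl_tmp R[i]).
apply: (@continuous_sqrtc_right_half_plane _ (fun t => - (2 * A * B * cos (2 * t)))) => //.
by move=> s; apply: cvgN; exact: cc.
Qed.

(** On the hyperbola x^2 <= A^2/4 and y^2 <= B^2/4 are equivalent, and both amount
    to 16 x^2 y^2 <= A^2 B^2, that is, to 4xy = AB cos(2 theta) for some theta. *)
Lemma hyperbola_rectangleP z : HR z <->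
  exists2 t, t \in `[0, pi / 2] &
   (z - c) ^+ 2 = ((A ^+ 2 - B ^+ 2) / 4) +i* (A * B * cos (2 * t) / 2).
Proof.
have A0 : 0 < A ^+ 2 by rewrite exprn_even_gt0 //= subr_eq0 eq_sym.
have B0 : 0 < B ^+ 2 by rewrite exprn_even_gt0 //= subr_eq0 eq_sym.
rewrite /HR /= in_rectangle /hyperbola /= -/A -/B.
rewrite /c /Defs.center; case: z => zx zy /=.
rewrite -[_ ^+ 2 in X in _ <-> X]/(_ +i* _).
move: (zx - _) (zy - _) => x y.
split.
  move=> [h [hx hy]].
  have AB0 : A * B != 0 by rewrite -sqrf_eq0 exprMn mulf_neq0 ?gt_eqF.
  pose k := 4 * (x * y) / (A * B).
  have k1 : -1 <= k <= 1.
    rewrite -ler_norml -[1](@normr1 R) -ler_sqr ?nnegrE // -!normrX expr1n normr1.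
    rewrite ger0_norm ?sqr_ge0 // /k expr_div_n ler_pdivrMr ?mul1r; last by rewrite exprMn mulr_gt0.
    rewrite !exprMn. nra.
  exists (acos k / 2).
    rewrite in_itv /= divr_ge0 ?acos_ge0 //= ler_pM2r ?invr_gt0 //. exact: acos_lepi.
  rewrite (mulrC 2) divfK // acosK; last by rewrite in_itv.
  apply/eqP; rewrite eq_complex /=; apply/andP; split; apply/eqP; first by lra.
  by rewrite /k; field; rewrite -(sqrf_eq0 A) -(sqrf_eq0 B) !gt_eqF.
move=> [t tI /eqP]; rewrite eq_complex /= => /andP[/eqP h1 /eqP h2].
have h3 : x ^+ 2 - y ^+ 2 = (A ^+ 2 - B ^+ 2) / 4 by lra.
have h4 : 16 * (x ^+ 2 * y ^+ 2) <= A ^+ 2 * B ^+ 2.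
  have -> : 16 * (x ^+ 2 * y ^+ 2) = A ^+ 2 * B ^+ 2 * cos (2 * t) ^+ 2.
    have : 4 * (x * y) = A * B * cos (2 * t) by rewrite [y * x]mulrC in h2; lra.
    by move/(congr1 (fun u => u ^+ 2)); rewrite !exprMn => <-; ring.
  rewrite ler_piMr //; first by apply: mulr_ge0; exact: sqr_ge0.
split=> //.
have : x ^+ 2 <= A ^+ 2 / 4 by have := sqr_ge0 x; have := sqr_ge0 y; nra.
by move=> hx; split=> //; lra.
Qed.

(** The two square roots of the same number are exchanged by the symmetry about
    c, so a set P that meets its mirror image within the curve only at c selects one
    of them. *)
Lemma lambda_image (P : set R[i]) (l : R -> R[i]) (e : R[i]) :
  e ^+ 2 = 1 -> (forall t, l t = c + e * hc t) -> (forall t, P (l t)) ->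
  (forall z, HR z -> P z -> P (c - (z - c)) -> z = c) ->
  l @` [set` `[0, pi / 2]] = HR `&` P.
Proof.
move=> e1 lE Pl Pc; rewrite eqEsubset; split=> [_ [t tI <-]|z [HRz Pz]].
  split=> //; apply/hyperbola_rectangleP; exists t => //.
  by rewrite lE addrAC subrr add0r exprMn e1 mul1r half_chord_sqr.
have [t tI zt] := (hyperbola_rectangleP z).1 HRz.
exists t => //.
have : (z - c) ^+ 2 = (l t - c) ^+ 2.
  by rewrite zt lE [c + _]addrC addrK exprMn e1 mul1r half_chord_sqr.
move/eqP; rewrite eqf_sqr => /orP[/eqP/addIr -> //|/eqP zl].
have lE' : l t = c - (z - c) by rewrite zl opprK addrC subrK.
have zc : z = c by apply: Pc => //; rewrite -lE'.
by rewrite lE' zc subrr subr0.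
Qed.

Let l1 := lambda1 al al' be be'.
Let l2 := lambda2 al al' be be'.
Let I : set R := [set` `[0, pi / 2]].

Let l1E t : l1 t = c + (- 1) * hc t. Proof. by rewrite mulN1r. Qed.
Let l2E t : l2 t = c + 1 * hc t. Proof. by rewrite mul1r. Qed.

Lemma lambda_left_right : `|B| <= `|A| ->
  l1 @` I = HR `&` [set z | complex.Re z <= (al + al') / 2] /\
  l2 @` I = HR `&` [set z | (al + al') / 2 <= complex.Re z].
Proof.
move=> BA; have hp t : 0 <= complex.Re (hc t).
  by have := half_chord_half_plane t; rewrite BA.
have AB2 : B ^+ 2 <= A ^+ 2.
  rewrite -[A ^+ 2]real_normK ?num_real //.
  by rewrite -[B ^+ 2]real_normK ?num_real // ler_sqr ?nnegrE.
have c0 z : HR z -> complex.Re z = (al + al') / 2 -> z = c.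
  case: z => x y [] /=; rewrite /hyperbola /= -/A -/B => h _ xE.
  rewrite /c /Defs.center -xE; congr (_ +i* _); apply/eqP.
  by rewrite -subr_eq0 -sqrf_eq0 eq_le sqr_ge0 andbT; rewrite xE in h; nra.
split; [apply: (@lambda_image _ _ (-1)) | apply: (@lambda_image _ _ 1)].
- by rewrite sqrrN expr1n.
- exact: l1E.
- by move=> t; have := hp t; rewrite /l1 /lambda1 -/hc /=; case: (hc t) => x y /= ; lra.
- move=> z HRz; rewrite /= => h1 h2; apply: c0 => //.
  by move: h1 h2; rewrite /c; case: z {HRz} => x y /= h1 h2; lra.
- by rewrite expr1n.
- exact: l2E.
- by move=> t; have := hp t; rewrite /l2 /lambda2 -/hc /=; case: (hc t) => x y /= ; lra.
- move=> z HRz; rewrite /= => h1 h2; apply: c0 => //.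
  by move: h1 h2; rewrite /c; case: z {HRz} => x y /= h1 h2; lra.
Qed.

Lemma lambda_bottom_top : `|A| < `|B| ->
  l1 @` I = HR `&` [set z | complex.Im z <= (be + be') / 2] /\
  l2 @` I = HR `&` [set z | (be + be') / 2 <= complex.Im z].
Proof.
move=> BA; have hp t : 0 <= complex.Im (hc t).
  by have := half_chord_half_plane t; rewrite leNgt BA.
have AB2 : A ^+ 2 < B ^+ 2.
  rewrite -[A ^+ 2]real_normK ?num_real //.
  by rewrite -[B ^+ 2]real_normK ?num_real // ltr_sqr ?nnegrE.
have c0 z : HR z -> complex.Im z = (be + be') / 2 -> z = c.
  case: z => x y [] /=; rewrite /hyperbola /= -/A -/B => h _ yE.
  by exfalso; rewrite yE in h; have := sqr_ge0 (x - (al + al') / 2); nra.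
split; [apply: (@lambda_image _ _ (-1)) | apply: (@lambda_image _ _ 1)].
- by rewrite sqrrN expr1n.
- exact: l1E.
- by move=> t; have := hp t; rewrite /l1 /lambda1 -/hc /=; case: (hc t) => x y /= ; lra.
- move=> z HRz; rewrite /= => h1 h2; apply: c0 => //.
  by move: h1 h2; rewrite /c; case: z {HRz} => x y /= h1 h2; lra.
- by rewrite expr1n.
- exact: l2E.
- by move=> t; have := hp t; rewrite /l2 /lambda2 -/hc /=; case: (hc t) => x y /= ; lra.
- move=> z HRz; rewrite /= => h1 h2; apply: c0 => //.
  by move: h1 h2; rewrite /c; case: z {HRz} => x y /= h1 h2; lra.
Qed.

Lemma lambda_union : l1 @` I `|` l2 @` I = HR.
Proof.
have [BA|AB] := leP `|B| `|A|.
  have [-> ->] := lambda_left_right BA.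
  rewrite -setIUr (_ : _ `|` _ = setT) ?setIT //.
  rewrite -subTset => z _ /=; apply/orP; exact: le_total.
have [-> ->] := lambda_bottom_top AB.
rewrite -setIUr (_ : _ `|` _ = setT) ?setIT //.
rewrite -subTset => z _ /=; apply/orP; exact: le_total.
Qed.

Lemma continuous_lambda :
  continuous (l1 : R -> R[i]^o) /\ continuous (l2 : R -> R[i]^o).
Proof.
split=> t.
  apply: (@cvgB R[i] R[i]^o); [exact: cvg_cst | exact: continuous_half_chord].
apply: (@cvgD R[i] R[i]^o); [exact: cvg_cst | exact: continuous_half_chord].
Qed.

End Chord.
End Geometry.

(** * Norms and polarization in Hilbert space *)

Section Hilbert.
Context {R : realType} {H : completeNormedModType R[i]}.
Variable ip : {dot H for Num.conj}.
Hypothesis ipN : inner_product_norm ip.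
Implicit Types (u v w : H) (c : R[i]) (r : R).

(** The norm of H has values in the complex numbers; its real version can be used
    in ordered-field arithmetic. *)
Definition hnorm u : R := complex.Re `|u|.

Lemma hnormE u : `|u| = (hnorm u)%:C.
Proof. by rewrite RRe_real // ger0_real. Qed.

Lemma hnorm_ge0 u : 0 <= hnorm u.
Proof. by rewrite -ler0c -hnormE. Qed.

Lemma hnorm_triangle u v : hnorm (u + v) <= hnorm u + hnorm v.
Proof. by rewrite -lecR rmorphD /= -!hnormE ler_normD. Qed.

Lemma hnorm_opp u : hnorm (- u) = hnorm u.
Proof. by rewrite /hnorm normrN. Qed.

Lemma hnormZ c u : hnorm (c *: u) = complex.Re `|c| * hnorm u.
Proof.
apply: complexI; rewrite [RHS]rmorphM /= -!hnormE normrZ.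
by rewrite normc_def; case: c.
Qed.

Lemma hnorm0 : hnorm 0 = 0.
Proof. by rewrite /hnorm normr0. Qed.

Lemma hnorm0_eq0 u : hnorm u = 0 -> u = 0.
Proof. by move=> h; apply/eqP; rewrite -normr_eq0 hnormE h. Qed.

Lemma ipDl u v w : ip (u + v) w = ip u w + ip v w. Proof. exact: linearDl. Qed.
Lemma ipDr u v w : ip u (v + w) = ip u v + ip u w. Proof. exact: linearDr. Qed.
Lemma ipBl u v w : ip (u - v) w = ip u w - ip v w. Proof. exact: linearBl. Qed.
Lemma ipBr u v w : ip u (v - w) = ip u v - ip u w. Proof. exact: linearBr. Qed.
Lemma ipNl u w : ip (- u) w = - ip u w. Proof. exact: linearNl. Qed.
Lemma ipZl c u w : ip (c *: u) w = c * ip u w. Proof. exact: linearZl_LR. Qed.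
Lemma ipZr c u w : ip u (c *: w) = conjc c * ip u w. Proof. exact: linearZr_LR. Qed.
Lemma ipC u v : ip u v = conjc (ip v u).
Proof. by have := hermC ip u v; rewrite mul1r. Qed.

Lemma ip_hnorm u : ip u u = (hnorm u ^+ 2)%:C.
Proof. by rewrite ipN hnormE rmorphXn. Qed.

Lemma hnorm_sqrD u v :
  hnorm (u + v) ^+ 2 = hnorm u ^+ 2 + 2 * complex.Re (ip u v) + hnorm v ^+ 2.
Proof.
have E w : hnorm w ^+ 2 = complex.Re (ip w w) by rewrite ip_hnorm.
rewrite !E !ipDl !ipDr (ipC v u).
by case: (ip u u) (ip v v) (ip u v) => [? ?] [? ?] [? ?] /=; lra.
Qed.

Lemma Re_ip_le u v : complex.Re (ip u v) <= hnorm u * hnorm v.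
Proof.
have [v0|vN0] := eqVneq (hnorm v) 0.
  by rewrite (hnorm0_eq0 v0) [ip _ _](linear0r ip) hnorm0 mulr0.
have v0 : 0 < hnorm v by rewrite lt_def vN0 hnorm_ge0.
have [u0|uN0] := eqVneq (hnorm u) 0.
  by rewrite (hnorm0_eq0 u0) [ip _ _](linear0l ip) hnorm0 mul0r.
have u0 : 0 < hnorm u by rewrite lt_def uN0 hnorm_ge0.
have key (t : R) : 0 <= hnorm u ^+ 2 - 2 * t * complex.Re (ip u v) + t ^+ 2 * hnorm v ^+ 2.
  have := hnorm_sqrD u ((- t)%:C *: v).
  rewrite ipZr hnormZ conjc_real normc_def /= expr0n /= addr0 sqrtr_sqr normrN exprMn.
  rewrite real_normK ?num_real // => h.
  have := sqr_ge0 (hnorm (u + (- t)%:C *: v)); rewrite h.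
  by case: (ip u v) => x y /=; lra.
have := key (hnorm u / hnorm v).
rewrite expr_div_n divfK ?expf_neq0 // => h.
have : 2 * (hnorm u / hnorm v) * complex.Re (ip u v) <= 2 * hnorm u ^+ 2 by lra.
rewrite -mulrA ler_pM2l // mulrAC ler_pdivrMr // expr2 -mulrA ler_pM2l //.
Qed.

(** Complex polarization bounds the norm by the numerical radius. *)
Lemma bounded_by_numerical_radius (T : H -> H) (r : R) : linear T ->
  (forall u, complex.Re `|ip (T u) u| <= r * hnorm u ^+ 2) ->
  forall u, hnorm (T u) <= 2 * r * hnorm u.
Proof.
move=> linT rT.
have TD u v : T (u + v) = T u + T v by have := linT 1 u v; rewrite !scale1r.
have TZ c u : T (c *: u) = c *: T u.
  have T0 : T 0 = 0 by have := TD 0 0; rewrite addr0 -[X in X = _]addr0 => /addrI.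
  by have := linT c u 0; rewrite T0 !addr0.
have absC (z : R[i]) (a : R) : complex.Re `|z| <= a ->
    [/\ - a <= complex.Re z <= a & - a <= complex.Im z <= a].
  rewrite normc_def; case: z => x y /= h.
  have a0 : 0 <= a by apply: le_trans h; exact: sqrtr_ge0.
  have h2 : x ^+ 2 + y ^+ 2 <= a ^+ 2.
    rewrite -[leLHS]sqr_sqrtr ?addr_ge0 ?sqr_ge0 //.
    by rewrite ler_sqr ?nnegrE ?sqrtr_ge0.
  by split; rewrite -ler_norml -ler_sqr ?nnegrE // real_normK ?num_real //;
    have := sqr_ge0 x; have := sqr_ge0 y; lra.
have Re_le u v : complex.Re (ip (T u) v) <= r * (hnorm u ^+ 2 + hnorm v ^+ 2).
  have [+ _] := absC _ _ (rT (u + v)).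
  have [+ _] := absC _ _ (rT (u - v)).
  have [_ +] := absC _ _ (rT (u + 'i *: v)).
  have [_ +] := absC _ _ (rT (u - 'i *: v)).
  rewrite -(scaleN1r v) -(scaleN1r ('i *: v)) scalerA !hnorm_sqrD !hnormZ !TD !TZ.
  rewrite !ipDl !ipDr !ipZl !ipZr.
  have -> : complex.Re `|-1 : R[i]| = 1 by rewrite normrN1.
  have -> : complex.Re `|'i : R[i]| = 1.
    by rewrite normc_def /= expr0n expr1n add0r sqrtr1.
  have -> : complex.Re `|-1 * 'i : R[i]| = 1.
    by rewrite normrM normrN1 mul1r normc_def /= expr0n expr1n add0r sqrtr1.
  rewrite !mul1r.
  case: (ip (T u) u) (ip (T u) v) (ip (T v) u) (ip (T v) v) (ip u v)
    => [? ?] [? ?] [? ?] [? ?] [? ?] /=; lra.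
move=> u; have [Tu0|TuN0] := eqVneq (hnorm (T u)) 0.
  have := rT u; rewrite Tu0; have r0 : hnorm u != 0 -> 0 <= r.
    move=> u0; have := rT u; have : 0 <= complex.Re `|ip (T u) u|.
      by rewrite normc_def; exact: sqrtr_ge0.
    move=> /le_trans/[apply]; rewrite pmulr_lge0 // exprn_even_gt0 //.
  have [->|/r0 r0' _] := eqVneq (hnorm u) 0; first by rewrite mulr0.
  by rewrite !mulr_ge0 // hnorm_ge0.
have Tu0 : 0 < hnorm (T u) by rewrite lt_def TuN0 hnorm_ge0.
have u0 : 0 < hnorm u.
  rewrite lt_def hnorm_ge0 andbT; apply: contraNneq TuN0 => /hnorm0_eq0 ->.
  by rewrite -(scale0r 0) TZ scale0r hnorm0.
pose s := hnorm u / hnorm (T u).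
have := Re_le u (s%:C *: T u).
rewrite ipZr conjc_real ip_hnorm hnormZ normc_def /= expr0n /= addr0 sqrtr_sqr.
rewrite mul0r subr0 ger0_norm ?divr_ge0 ?hnorm_ge0 // /s.
rewrite divfK // expr2 mulrA divfK // mulrDr -mulr2n => h.
have : hnorm u * hnorm (T u) <= hnorm u * (2 * r * hnorm u) by lra.
by rewrite ler_pM2l.
Qed.

End Hilbert.

(** * The algebra and its trace *)

Section TracialAlgebra.
Context {R : realType} {H : completeNormedModType R[i]}.
Variable ip : {dot H for Num.conj}.
Variables (M : set (H -> H)) (tau : (H -> H) -> R[i]).

Definition tracial_vna : Prop :=
  [/\ inner_product_norm ip, von_neumann_algebra ip M &
      faithful_normal_tracial_state ip M tau].

(** The elements of M as a type, on which composition is a ring multiplication.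
    The hypothesis is a parameter because it provides the closure properties and,
    through the trace of the identity, the fact that 1 differs from 0. *)
Record opalg (hM : tracial_vna) := OpAlg { op :> H -> H; opP : `[< M op >] }.
End TracialAlgebra.

Section AlgebraStructure.
Context {R : realType} {H : completeNormedModType R[i]}.
Context {ip : {dot H for Num.conj}}.
Context {M : set (H -> H)} {tau : (H -> H) -> R[i]}.
Context (hM : tracial_vna ip M tau).
Local Notation A := (opalg hM).
Implicit Types a b : A.

HB.instance Definition _ := [isSub for @op R H ip M tau hM].
HB.instance Definition _ := [Choice of A by <:].

Lemma op_in a : M a. Proof. exact/asboolP/opP. Qed.
Definition inM T (h : M T) : A := OpAlg hM (asboolT h).

Let hv : von_neumann_algebra ip M. Proof. by case: hM. Qed.
Let ht : faithful_normal_tracial_state ip M tau. Proof. by case: hM. Qed.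

Let M1 : M idfun. Proof. by case: hv. Qed.
Let Mlin c S T : M S -> M T -> M (c *: S + T). Proof. by case: hv => _ _ + _ _; apply. Qed.
Let Mcomp S T : M S -> M T -> M (S \o T). Proof. by case: hv => _ _ _ + _; apply. Qed.
Lemma M0 : M 0.
Proof. by have := Mlin (-1) M1 M1; rewrite scaleN1r addNr. Qed.
Let MZ c T : M T -> M (c *: T).
Proof. by move=> h; have := Mlin c h M0; rewrite addr0. Qed.
Let MD S T : M S -> M T -> M (S + T).
Proof. by move=> hS hT; have := Mlin 1 hS hT; rewrite scale1r. Qed.
Let MN T : M T -> M (- T). Proof. by move=> /(MZ (-1)); rewrite scaleN1r. Qed.

Lemma op_linear a : linear a.
Proof. by have [] : bounded_operator a by case: hv => + _ _ _ _; apply; exact: op_in. Qed.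

Lemma opD a u v : a (u + v) = a u + a v.
Proof. by have := op_linear a 1 u v; rewrite !scale1r. Qed.
Lemma op0 a : a 0 = 0.
Proof. by have := opD a 0 0; rewrite addr0 -[X in X = _]addr0 => /addrI. Qed.
Lemma opZ a c u : a (c *: u) = c *: a u.
Proof. by have := op_linear a c u 0; rewrite op0 !addr0. Qed.

Lemma op_inj a b : a =1 b -> a = b.
Proof. by move=> ab; apply/val_inj/funext. Qed.

Definition opalg0 : A := inM M0.
Definition opalg_add a b : A := inM (MD (op_in a) (op_in b)).
Definition opalg_opp a : A := inM (MN (op_in a)).
Definition opalg_scale c a : A := inM (MZ c (op_in a)).
Definition opalg1 : A := inM M1.
Definition opalg_mul a b : A := inM (Mcomp (op_in a) (op_in b)).

Let addA : associative opalg_add. Proof. by move=> a b c; apply: op_inj => u /=; exact: addrA. Qed.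
Let addC : commutative opalg_add. Proof. by move=> a b; apply: op_inj => u /=; exact: addrC. Qed.
Let add0 : left_id opalg0 opalg_add. Proof. by move=> a; apply: op_inj => u /=; exact: add0r. Qed.
Let addN : left_inverse opalg0 opalg_opp opalg_add.
Proof. by move=> a; apply: op_inj => u /=; exact: addNr. Qed.
HB.instance Definition _ := GRing.isZmodule.Build A addA addC add0 addN.

Let mulA : associative opalg_mul. Proof. by move=> a b c; apply: op_inj. Qed.
Let mul1 : left_id opalg1 opalg_mul. Proof. by move=> a; apply: op_inj. Qed.
Let mulr1' : right_id opalg1 opalg_mul. Proof. by move=> a; apply: op_inj. Qed.
Let mulDl : left_distributive opalg_mul +%R. Proof. by move=> a b c; apply: op_inj. Qed.
Let mulDr : right_distributive opalg_mul +%R.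
Proof. by move=> a b c; apply: op_inj => u; exact: opD. Qed.
Let oneN0 : opalg1 != 0.
Proof.
apply/eqP => /(congr1 (fun a : A => tau a)) /=.
case: ht => tl [_ t1] _ _ _; rewrite t1.
have := tl 1 0 0 M0 M0; rewrite scale1r mul1r addr0.
rewrite -[X in X = _]addr0 => /addrI <- /eqP.
by rewrite oner_eq0.
Qed.
HB.instance Definition _ :=
  GRing.Zmodule_isNzRing.Build A mulA mul1 mulr1' mulDl mulDr oneN0.

Let scaleA' c d a : opalg_scale c (opalg_scale d a) = opalg_scale (c * d) a.
Proof. by apply: op_inj => u; exact: scalerA. Qed.
Let scale1 : left_id 1 opalg_scale.
Proof. by move=> a; apply: op_inj => u; exact: scale1r. Qed.
Let scaleDr : right_distributive opalg_scale +%R.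
Proof. by move=> c a b; apply: op_inj => u; exact: scalerDr. Qed.
Let scaleDl a : {morph opalg_scale^~ a : c d / c + d}.
Proof. by move=> c d; apply: op_inj => u; exact: scalerDl. Qed.
HB.instance Definition _ :=
  GRing.Zmodule_isLmodule.Build R[i] A scaleA' scale1 scaleDr scaleDl.

Let scaleAl c a b : c *: (a * b) = (c *: a) * b.
Proof. by apply: op_inj. Qed.
HB.instance Definition _ := GRing.Lmodule_isLalgebra.Build R[i] A scaleAl.
Let scaleAr c a b : c *: (a * b) = a * (c *: b).
Proof. by apply: op_inj => u; rewrite /= -[RHS]/(a (c *: b u)) opZ. Qed.
HB.instance Definition _ := GRing.Lalgebra_isAlgebra.Build R[i] A scaleAr.

Lemma opDE a b u : (a + b) u = a u + b u. Proof. by []. Qed.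
Lemma opNE a u : (- a) u = - a u. Proof. by []. Qed.
Lemma op0E u : (0 : A) u = 0. Proof. by []. Qed.
Lemma op1E u : (1 : A) u = u. Proof. by []. Qed.
Lemma opZE c a u : (c *: a) u = c *: a u. Proof. by []. Qed.
Lemma opME a b u : (a * b) u = a (b u). Proof. by []. Qed.

End AlgebraStructure.

Section Trace.
Context {R : realType} {H : completeNormedModType R[i]}.
Context {ip : {dot H for Num.conj}}.
Context {M : set (H -> H)} {tau : (H -> H) -> R[i]}.
Context {hM : tracial_vna ip M tau}.
Local Notation A := (opalg hM).
Implicit Types (a b : A) (c : R[i]) (r s : R).

Let ipN : inner_product_norm ip. Proof. by case: hM. Qed.

Lemma star_exists a : exists b : A, forall u v, ip (a u) v = ip u (b v).
Proof.
have [_ [_ _ _ _ [h _]] _] := hM.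
by have [S MS aS] := h _ (op_in a); exists (inM hM MS).
Qed.

Definition star a : A := projT1 (cid (star_exists a)).

Lemma starP a u v : ip (a u) v = ip u (star a v).
Proof. exact: (projT2 (cid (star_exists a))). Qed.

Lemma ip_injr u v : (forall w, ip w u = ip w v) -> u = v.
Proof.
move=> h; apply/eqP; rewrite -subr_eq0; apply/eqP/hnorm0_eq0/eqP.
rewrite -sqrf_eq0; apply/eqP/complexI; rewrite -(ip_hnorm ipN).
by rewrite ipBr h subrr.
Qed.

Lemma star_unique a b : (forall u v, ip (a u) v = ip u (b v)) -> star a = b.
Proof.
by move=> h; apply: op_inj => v; apply: ip_injr => u; rewrite -starP.
Qed.

Lemma starPr a u v : ip (star a u) v = ip u (a v).
Proof. by rewrite (ipC ip) -starP -(ipC ip). Qed.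

Lemma starK a : star (star a) = a.
Proof. by apply: star_unique => u v; rewrite starPr. Qed.

Lemma starD a b : star (a + b) = star a + star b.
Proof. by apply: star_unique => u v; rewrite !opDE ipDl ipDr !starP. Qed.

Lemma starZ c a : star (c *: a) = conjc c *: star a.
Proof. by apply: star_unique => u v; rewrite !opZE ipZl ipZr conjcK starP. Qed.

Lemma starN a : star (- a) = - star a.
Proof. by rewrite -scaleN1r starZ rmorphN1 scaleN1r. Qed.

Lemma starB a b : star (a - b) = star a - star b.
Proof. by rewrite starD starN. Qed.

Lemma starM a b : star (a * b) = star b * star a.
Proof. by apply: star_unique => u v; rewrite !opME !starP. Qed.

Lemma star1 : star 1 = 1 :> A.
Proof. by apply: star_unique => u v. Qed.

Definition tr a : R[i] := tau a.

Let tr_is_scalar : scalar tr.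
Proof. by move=> c a b; have [_ _ [h _ _ _ _]] := hM; apply: h; exact: op_in. Qed.

HB.instance Definition _ := GRing.isLinear.Build R[i] A R[i] *%R tr tr_is_scalar.

Lemma trC a b : tr (a * b) = tr (b * a).
Proof. by have [_ _ [_ _ h _ _]] := hM; apply: h; exact: op_in. Qed.

Lemma tr1 : tr 1 = 1.
Proof. by have [_ _ [_ [_ h] _ _ _]] := hM. Qed.

Lemma tr_ge0 a : positive_operator ip a -> 0 <= tr a.
Proof. by have [_ _ [_ [h _] _ _ _]] := hM; apply: h; exact: op_in. Qed.

Lemma tr_faithful a : positive_operator ip a -> tr a = 0 -> a = 0.
Proof.
move=> pa ta; apply/val_inj; have [_ _ [_ _ _ h _]] := hM.
by apply: h => //; exact: op_in.
Qed.

(** An upper bound for the operator norm.  No operator norm is formed: all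
    estimates below only need explicit bounds. *)
Definition bnd a r := forall u, hnorm (a u) <= r * hnorm u.

Lemma bnd_exists a : exists2 r, 0 <= r & bnd a r.
Proof.
have [_ [h _ _ _ _] _] := hM; have [_ [r rP]] := h _ (op_in a).
exists (Num.max r 0); first by rewrite le_max lexx orbT.
move=> u; have := rP u; rewrite !hnormE -rmorphM lecR => /le_trans; apply.
by rewrite ler_wpM2r ?hnorm_ge0 // le_max lexx.
Qed.

Lemma bnd_le a r s : r <= s -> bnd a r -> bnd a s.
Proof. by move=> rs ar u; apply: le_trans (ar u) _; rewrite ler_wpM2r ?hnorm_ge0. Qed.

Lemma bnd1 : bnd 1 1.
Proof. by move=> u; rewrite mul1r. Qed.

Lemma bnd0 : bnd 0 0.
Proof. by move=> u; rewrite op0E hnorm0 mul0r. Qed.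

Lemma bndD a b r s : bnd a r -> bnd b s -> bnd (a + b) (r + s).
Proof.
move=> ha hb u; rewrite opDE mulrDl; apply: le_trans (hnorm_triangle _ _) _.
exact: lerD.
Qed.

Lemma bndM a b r s : 0 <= r -> bnd a r -> bnd b s -> bnd (a * b) (r * s).
Proof.
move=> r0 ha hb u; rewrite opME -mulrA; apply: le_trans (ha _) _.
exact: ler_wpM2l.
Qed.

Lemma bndZ c a r : bnd a r -> bnd (c *: a) (complex.Re `|c| * r).
Proof.
move=> ha u; rewrite opZE hnormZ -mulrA ler_wpM2l //.
by rewrite normc_def sqrtr_ge0.
Qed.

Lemma bndN a r : bnd a r -> bnd (- a) r.
Proof. by move=> ha u; rewrite opNE hnorm_opp. Qed.

Lemma bndB a b r s : bnd a r -> bnd b s -> bnd (a - b) (r + s).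
Proof. by move=> ha hb; apply: bndD => //; exact: bndN. Qed.

Lemma bndX a r n : 0 <= r -> bnd a r -> bnd (a ^+ n) (r ^+ n).
Proof.
move=> r0 ha; elim: n => [|n IH]; first exact: bnd1.
by rewrite !exprS; apply: bndM.
Qed.

Lemma bnd_sum (I : Type) (s : seq I) (F : I -> A) (G : I -> R) :
  (forall i, bnd (F i) (G i)) -> bnd (\sum_(i <- s) F i) (\sum_(i <- s) G i).
Proof.
move=> h; elim: s => [|i s IH]; first by rewrite !big_nil; exact: bnd0.
by rewrite !big_cons; apply: bndD.
Qed.

Lemma bnd_star a r : 0 <= r -> bnd a r -> bnd (star a) r.
Proof.
move=> r0 ha v; have [->|v0] := eqVneq (hnorm (star a v)) 0.
  by rewrite mulr_ge0 ?hnorm_ge0.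
have {}v0 : 0 < hnorm (star a v) by rewrite lt_def v0 hnorm_ge0.
rewrite -(ler_pM2l v0) -expr2.
have -> : hnorm (star a v) ^+ 2 = complex.Re (ip (a (star a v)) v).
  by rewrite starP ip_hnorm.
apply: le_trans (Re_ip_le ipN _ _) _.
by rewrite mulrA ler_wpM2r ?hnorm_ge0 // mulrC.
Qed.

Lemma Re_ip_bnd a r u : bnd a r -> complex.Re (ip (a u) u) <= r * hnorm u ^+ 2.
Proof.
move=> ha; apply: le_trans (Re_ip_le ipN _ _) _.
by rewrite expr2 mulrA ler_wpM2r ?hnorm_ge0.
Qed.

Lemma Re_ipN_bnd a r u : bnd a r -> - (r * hnorm u ^+ 2) <= complex.Re (ip (a u) u).
Proof.
move=> /bndN/(Re_ip_bnd u); rewrite opNE ipNl.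
by case: (ip _ _) => x y /=; rewrite lerNl.
Qed.

Let sa_pos b r : star b = b -> bnd b r -> positive_operator ip (r%:C *: 1 + b).
Proof.
move=> sb bb u; rewrite -[X in ip X]/((r%:C *: 1 + b : A) u) opDE opZE op1E ipDl ipZl.
rewrite (ip_hnorm ipN); have := Re_ipN_bnd u bb.
have : conjc (ip (b u) u) = ip (b u) u by rewrite -(ipC ip) starP sb.
case: (ip _ _) => x y [/eqP]; rewrite -rmorphM /= lecE /= -subr_eq0 -opprD oppr_eq0.
by rewrite -mulr2n mulrn_eq0 /= => /eqP-> h; rewrite addr0 eqxx /=; lra.
Qed.

(** Adding a large multiple of 1 makes a self-adjoint element positive, so its
    trace is real; the general case follows from the Cartesian decomposition. *)
Lemma tr_star a : tr (star a) = conjc (tr a).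
Proof.
have real b : star b = b -> complex.Im (tr b) = 0.
  move=> sb; have [r r0 br] := bnd_exists b.
  have := tr_ge0 (sa_pos sb br); rewrite linearP /= tr1 mulr1.
  by case: (tr b) => x y; rewrite lecE /= => /andP[/eqP]; rewrite add0r.
have h1 : complex.Im (tr (a + star a)) = 0.
  by apply: real; rewrite starD starK addrC.
have h2 : complex.Im (tr ('i *: (a - star a))) = 0.
  apply: real; rewrite starZ starB starK.
  have -> : conjc 'i = - 'i :> R[i] by rewrite /= -[RHS]/(_ +i* _) oppr0.
  by rewrite scaleNr -scalerN opprB.
move: h1 h2; rewrite linearD linearZ linearB /=.
case: (tr a) (tr (star a)) => [x y] [x' y'] /= h1 h2.
by congr (_ +i* _); lra.
Qed.

(** The trace of the positive elements 2r + (a + star a) and 2r - (a + star a)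
    is nonnegative. *)
Lemma Re_tr_le a r : bnd a r -> 0 <= r -> `|complex.Re (tr a)| <= r.
Proof.
have half b : bnd b r -> 0 <= r -> 0 <= r + complex.Re (tr b).
  move=> bb r0.
  have := @sa_pos (b + star b) (r + r); rewrite starD starK (addrC (star b)) => /(_ erefl).
  move=> /(_ (bndD bb (bnd_star r0 bb)))/tr_ge0.
  rewrite linearP linearD /= tr_star tr1 mulr1.
  by case: (tr b) => x y; rewrite lecE /= => /andP[_]; lra.
move=> ba r0; rewrite ler_norml; have := half _ ba r0; have := half _ (bndN ba) r0.
rewrite linearN /=; case: (tr a) => x y /= h1 h2; apply/andP; split; lra.
Qed.

Lemma bnd_radius a r :
  (forall u, complex.Re `|ip (a u) u| <= r * hnorm u ^+ 2) -> bnd a (2 * r).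
Proof. by move=> h u; apply: (bounded_by_numerical_radius ipN) => //; exact: op_linear. Qed.

End Trace.

(** * Moments of spectral measures *)

Section StepIntegral.
Context {R : realType} (m : {measure set R -> \bar R}).
Hypothesis mfin : (m setT < +oo)%E.

Lemma measure_lt_pinfty (B : set R) : measurable B -> (m B < +oo)%E.
Proof. by move=> mB; apply: le_lt_trans mfin; apply: le_measure; rewrite ?inE. Qed.

Lemma measure_fineK (B : set R) : measurable B -> (fine (m B))%:E = m B.
Proof. by move=> mB; rewrite fineK // ge0_fin_numE // measure_lt_pinfty. Qed.

Lemma bounded_Rintegrable (J : set R) (f : R -> R) (C : R) : measurable J ->
  measurable_fun setT f -> (forall t, J t -> `|f t| <= C) -> m.-integrable J (EFin \o f).
Proof.
move=> mJ mf fC; apply: measurable_bounded_integrable => //.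
- exact: measure_lt_pinfty.
- exact: measurable_funS mf.
- exists C; split; first exact: num_real.
  by move=> x /ltW Cx t Jt; apply: le_trans (fC _ Jt) Cx.
Qed.

Lemma Rintegral_cst_approx (J : set R) (f : R -> R) (c e : R) : measurable J ->
  measurable_fun setT f -> (forall t, J t -> `|f t - c| <= e) ->
  `|(\int[m]_(t in J) f t)%R - c * fine (m J)| <= e * fine (m J).
Proof.
move=> mJ mf fc.
have fC t : J t -> `|f t| <= `|c| + e.
  by move=> /fc h; rewrite -[f t](subrK c) addrC; apply: le_trans (ler_normD _ _) _; rewrite lerD2l.
rewrite -Rintegral_cst // -RintegralB //; last 2 first.
- exact: bounded_Rintegrable fC.
- by apply: (@bounded_Rintegrable _ _ `|c|).
apply: le_trans (le_normr_Rintegral _ _) _ => //.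
  apply: (@bounded_Rintegrable _ (fun t => f t - c) e) => //.
  exact: measurable_funB.
rewrite -Rintegral_cst //; apply: le_Rintegral => //.
  apply: (@bounded_Rintegrable _ (fun t => `|f t - c|) e) => //.
    by apply: measurableT_comp => //; exact: measurable_funB.
  by move=> t Jt; rewrite normr_id; exact: fc.
by apply: (@bounded_Rintegrable _ _ `|e|).
Qed.

Variables (a d : R).
Hypothesis d0 : 0 <= d.
(** Half-open, so that consecutive cells tile an interval. *)
Definition cell (k : nat) : set R := [set` `[a + k%:R * d, a + k.+1%:R * d[].

Lemma Rintegral_step n (f : R -> R) (c : nat -> R) (e C : R) : 
  measurable_fun setT f ->
  (forall t, `[a, a + n%:R * d[%classic t -> `|f t| <= C) ->
  (forall k t, (k < n)%N -> cell k t -> `|f t - c k| <= e) ->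
  `|(\int[m]_(t in [set` `[a, a + n%:R * d[]) f t)%R - \sum_(k < n) c k * fine (m (cell k))|
    <= e * fine (m [set` `[a, a + n%:R * d[]).
Proof.
move=> mf fC; elim: n fC => [|n IH] fC fc.
  by rewrite mul0r addr0 set_itvco0 Rintegral_set0 big_ord0 subrr normr0 measure0 /= mulr0.
have dn : n%:R * d <= n.+1%:R * d by rewrite ler_wpM2r // ler_nat.
have JU : [set` `[a, a + n.+1%:R * d[] = [set` `[a, a + n%:R * d[] `|` cell n.
  rewrite /cell -itv_bndbnd_setU //; rewrite bnd_simp ?lerD2l //.
  by rewrite lerDl mulr_ge0.
have disj : [set` `[a, a + n%:R * d[] `&` cell n = set0.
  rewrite -subset0 => t; rewrite /cell /= !in_itv /= => -[/andP[_ h1] /andP[h2 _]].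
  by move: (le_lt_trans h2 h1); rewrite ltxx.
have sub t : `[a, a + n%:R * d[%classic t -> `[a, a + n.+1%:R * d[%classic t.
  by rewrite JU; left.
have {}IH := IH (fun t h => fC t (sub t h)) (fun k t h => fc k t (ltnW h)).
have mJ : measurable (`[a, a + n%:R * d[%classic : set R) by [].
have mc : measurable (cell n) by exact: measurable_itv.
rewrite JU Rintegral_setU //; last 2 first.
- by rewrite -JU; exact: bounded_Rintegrable fC.
- by apply/disj_set2P.
have -> : fine (m ([set` `[a, a + n%:R * d[] `|` cell n)) =
    fine (m [set` `[a, a + n%:R * d[]) + fine (m (cell n)).
  by rewrite measureU // fineD // ge0_fin_numE // measure_lt_pinfty.
rewrite big_ord_recr /= mulrDr opprD addrACA.
apply: le_trans (ler_normD _ _) _; apply: lerD => //.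
by apply: Rintegral_cst_approx => // t; apply: fc.
Qed.

Lemma Rintegral_full (J : set R) (f : R -> R) C : measurable J -> m (~` J) = 0%E ->
  measurable_fun setT f -> (forall t, J t -> `|f t| <= C) ->
  m.-integrable setT (EFin \o f) /\ (\int[m]_t f t)%R = (\int[m]_(t in J) f t)%R.
Proof.
move=> mJ mJ0 mf fC.
have mJc : measurable (~` J) by exact: measurableC.
have JE : setT `\` (~` J) = J by rewrite setTD setCK.
have i : m.-integrable setT (EFin \o f).
  apply/(negligible_integrable mJc measurableT) => //.
    by apply/measurable_EFinP.
  by rewrite JE; exact: bounded_Rintegrable fC.
split=> //; rewrite /Rintegral; congr fine.
by rewrite (@negligible_integral _ _ _ _ setT (~` J)) // JE.
Qed.

End StepIntegral.

Section SpectralMoments.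
Context {R : realType} {H : completeNormedModType R[i]}.
Context {ip : {dot H for Num.conj}}.
Context {M : set (H -> H)} {tau : (H -> H) -> R[i]}.
Context {hM : tracial_vna ip M tau}.
Local Notation A := (opalg hM).
Implicit Types (a b : A).

Let ipN : inner_product_norm ip. Proof. by case: hM. Qed.

Lemma bnd_expB a b (c e : R) n : 1 <= c -> 0 <= e -> bnd a c -> bnd b c ->
  bnd (a - b) e -> bnd (a ^+ n - b ^+ n) (n%:R * c ^+ n * e).
Proof.
move=> c1 e0 ha hb hab; have c0 : 0 <= c by exact: le_trans c1.
elim: n => [|n IH]; first by rewrite subrr !mul0r; exact: bnd0.
have -> : a ^+ n.+1 - b ^+ n.+1 = a * (a ^+ n - b ^+ n) + (a - b) * b ^+ n.
  by rewrite mulrBl mulrBr addrA subrK !exprS.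
apply: bnd_le (bndD (bndM c0 ha IH) (bndM e0 hab (bndX n c0 hb))).
have -> : n.+1%:R * c ^+ n.+1 * e = c * (n%:R * c ^+ n * e) + e * c ^+ n.+1.
  by rewrite -natr1 exprS; ring.
by rewrite lerD2l ler_wpM2l // exprS ler_peMl // exprn_ge0.
Qed.

Lemma real_expB (x y c e : R) n : 1 <= c -> 0 <= e -> `|x| <= c -> `|y| <= c ->
  `|x - y| <= e -> `|x ^+ n - y ^+ n| <= n%:R * c ^+ n * e.
Proof.
move=> c1 e0 ha hb hab; have c0 : 0 <= c by exact: le_trans c1.
elim: n => [|n IH]; first by rewrite subrr normr0 !mul0r.
have -> : x ^+ n.+1 - y ^+ n.+1 = x * (x ^+ n - y ^+ n) + (x - y) * y ^+ n.
  by rewrite mulrBl mulrBr addrA subrK !exprS.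
apply: le_trans (ler_normD _ _) _; rewrite !normrM.
have h1 : `|x| * `|x ^+ n - y ^+ n| <= c * (n%:R * c ^+ n * e).
  by apply: ler_pM.
have h2 : `|x - y| * `|y ^+ n| <= e * c ^+ n.+1.
  apply: ler_pM => //; rewrite normrX; apply: le_trans (lerXn2r n _ _ hb) _;
    rewrite ?nnegrE //.
  by rewrite exprS ler_peMl // exprn_ge0.
apply: le_trans (lerD h1 h2) _.
by rewrite -natr1 exprS le_eqVlt; apply/orP; left; apply/eqP; ring.
Qed.

(** A linear functional that is bounded for the operator norm: the trace and the
    vector states, which the moment theorem treats uniformly. *)
Definition bounded_functional (w : A -> R) : Prop :=
  (forall (s : R) a b, w (s%:C *: a + b) = s * w a + w b) /\
  exists2 C, 0 <= C & forall a r, 0 <= r -> bnd a r -> `|w a| <= C * r.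

Lemma bounded_functional_tr : bounded_functional (fun a => complex.Re (tr a)).
Proof.
split=> [s a b|].
  by rewrite linearP /=; case: (tr a) (tr b) => [? ?] [? ?] /=; rewrite mul0r subr0.
by exists 1 => // a r r0 ar; rewrite mul1r Re_tr_le.
Qed.

Lemma bounded_functional_ip u : bounded_functional (fun a => complex.Re (ip (a u) u)).
Proof.
split=> [s a b|].
  rewrite opDE opZE ipDl ipZl; case: (ip _ _) (ip _ _) => [? ?] [? ?] /=.
  by rewrite mul0r subr0.
exists (hnorm u ^+ 2); rewrite ?sqr_ge0 // => a r r0 ar.
by rewrite mulrC ler_norml Re_ip_bnd ?Re_ipN_bnd.
Qed.

Variables (y : A) (E : set R -> (H -> H)).
Hypothesis spE : spectral_resolution ip y E.
Hypothesis EM : forall B, measurable B -> M (E B).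

(** The spectral projections as elements of the algebra; the value on
    nonmeasurable sets is a default. *)
Definition sproj (B : set R) : A :=
  if pselect (measurable B) is left h then inM hM (EM h) else 0.

Lemma sprojE B u : measurable B -> sproj B u = E B u.
Proof. by rewrite /sproj => h; case: pselect. Qed.

Lemma sprojT : sproj setT = 1.
Proof. by apply: op_inj => u; rewrite sprojE //; have [_ -> _ _ _] := spE. Qed.

Lemma sproj_mul B C : measurable B -> measurable C ->
  sproj B * sproj C = sproj (B `&` C).
Proof.
move=> mB mC; apply: op_inj => u; rewrite opME !sprojE //; last exact: measurableI.
by have [_ _ -> //] := spE.
Qed.

Lemma sproj_idem B : sproj B * sproj B = sproj B.
Proof.
have [mB|mB] := pselect (measurable B); first by rewrite sproj_mul // setIid.
by rewrite /sproj; case: pselect => //; rewrite mul0r.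
Qed.

Lemma star_sproj B : star (sproj B) = sproj B.
Proof.
apply: star_unique => u v; rewrite /sproj; case: pselect => [mB|_].
  by have [/(_ _ mB)[_ + _] _ _ _ _] := spE; apply.
by rewrite !op0E [LHS](linear0l ip) [RHS](linear0r ip).
Qed.

Lemma ip_sproj B u : ip (sproj B u) u = (hnorm (sproj B u) ^+ 2)%:C.
Proof. by rewrite -(ip_hnorm ipN) !starP star_sproj -opME sproj_idem. Qed.

Lemma sproj_pos B : positive_operator ip (sproj B).
Proof. by move=> u; rewrite ip_sproj ler0c sqr_ge0. Qed.

Lemma sproj0 : sproj set0 = 0.
Proof.
apply: op_inj => u; rewrite op0E; apply/hnorm0_eq0/eqP; rewrite -sqrf_eq0.
have [_ _ _ _ /(_ u)[nu [nuE _]]] := spE.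
have := nuE set0 measurable0; rewrite measure0 => -[].
by rewrite -sprojE // ip_sproj /= => ->.
Qed.

(** For w the trace, m is the spectral measure of y; for a vector state, it is the
    scalar measure of the spectral resolution at that vector. *)
Definition represents (w : A -> R) (m : {measure set R -> \bar R}) : Prop :=
  forall B, measurable B -> m B = (w (sproj B))%:E.

(** The projection of any set that contains the bounded support is 1, so that of
    its complement is the projection of the empty set. *)
Lemma spectral_support : exists2 r : R, 0 <= r &
  forall J : set R, measurable J -> [set` `[- r, r]] `<=` J ->
    forall w m, bounded_functional w -> represents w m -> m (~` J) = 0%E.
Proof.
have [_ _ _ [r rE] _] := spE.
exists `|r| => // J mJ rJ w m _ wm.
have J0 : [set` `[- r, r]] `<=` J.
  apply: subset_trans rJ => t /=; rewrite !in_itv /= => /andP[h1 h2].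
  by rewrite -ler_norml; have := ler_norm r; have := ler_norm (- r);
    rewrite normrN ler_norml; move=> *; apply/andP; split; lra.
have p1 : sproj [set` `[- r, r]] = 1 by apply: op_inj => u; rewrite sprojE // rE.
have mJc := measurableC mJ.
rewrite wm // -[sproj _]mulr1 -p1 sproj_mul //.
have -> : ~` J `&` [set` `[- r, r]] = set0.
  by rewrite -subset0 => t [nJ /J0].
by rewrite -wm // measure0.
Qed.

Lemma represents_lty w m : bounded_functional w -> represents w m -> (m setT < +oo)%E.
Proof. by move=> _ wm; rewrite wm // ltry. Qed.

Lemma bounded_functional0 w : bounded_functional w -> w 0 = 0.
Proof.
by case=> wl _; have := wl 1 0 0; rewrite scaler0 addr0 mul1r -[X in X = _]addr0 => /addrI.
Qed.

Lemma bounded_functional_sum w n (c : nat -> R) (F : nat -> A) : bounded_functional w ->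
  w (\sum_(k < n) (c k)%:C *: F k) = \sum_(k < n) c k * w (F k).
Proof.
move=> wb; elim: n => [|n IH]; first by rewrite !big_ord0 bounded_functional0.
by rewrite !big_ord_recr /= addrC wb.1 IH addrC.
Qed.

Lemma sproj_sum_mul n (c e : nat -> R[i]) (F : nat -> set R) :
  (forall k, measurable (F k)) -> (forall i j, i != j -> F i `&` F j = set0) ->
  (\sum_(k < n) c k *: sproj (F k)) * (\sum_(k < n) e k *: sproj (F k)) =
  \sum_(k < n) (c k * e k) *: sproj (F k).
Proof.
move=> mF disj; rewrite mulr_suml; apply: eq_bigr => i _.
rewrite mulr_sumr (bigD1 i) //= big1 ?addr0 => [|j ji].
  by rewrite -scalerAl -scalerAr scalerA sproj_idem.
by rewrite -scalerAl -scalerAr sproj_mul // disj ?sproj0 ?scaler0 // eq_sym.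
Qed.

Lemma sproj_sumX n (c : nat -> R[i]) (F : nat -> set R) j :
  (forall k, measurable (F k)) -> (forall i j, i != j -> F i `&` F j = set0) ->
  (\sum_(k < n) c k *: sproj (F k)) ^+ j.+1 = \sum_(k < n) c k ^+ j.+1 *: sproj (F k).
Proof.
move=> mF disj; elim: j => [|j IH]; first by rewrite expr1.
by rewrite exprS IH (@sproj_sum_mul n c (fun k => c k ^+ j.+1)).
Qed.

Lemma ip_sproj_sum n (c : nat -> R) (F : nat -> set R) u :
  ip ((\sum_(k < n) (c k)%:C *: sproj (F k)) u) u =
  (\sum_(k < n) c k * hnorm (sproj (F k) u) ^+ 2)%:C.
Proof.
elim: n => [|n IH]; first by rewrite !big_ord0 op0E [LHS](linear0l ip).
by rewrite [in LHS]big_ord_recr opDE ipDl opZE ipZl ip_sproj IH [in RHS]big_ord_recr [in RHS]rmorphD [in RHS]rmorphM.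
Qed.

Lemma measurable_cell (a d : R) k : measurable (cell a d k).
Proof. exact: measurable_itv. Qed.

Lemma disjoint_cell (a d : R) i j : 0 <= d -> i != j -> cell a d i `&` cell a d j = set0.
Proof.
move=> d0; wlog ij : i j / (i < j)%N.
  move=> h; case: (ltngtP i j) => // ij _.
    by apply: h => //; rewrite ltn_eqF.
  by rewrite setIC; apply: h => //; rewrite ltn_eqF.
move=> _; rewrite -subset0 => t; rewrite /cell /= !in_itv /=.
move=> -[/andP[_ h1] /andP[h2 _]]; move: (le_lt_trans h2 h1).
by rewrite ltrD2l ltNge ler_wpM2r // ler_nat.
Qed.

Lemma small_eq0 (x K : R) : 0 <= K -> (forall N, `|x| <= K * N.+1%:R^-1) -> x = 0.
Proof.
move=> K0 h; apply/eqP; rewrite -normr_le0 leNgt; apply/negP => x0.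
have [N /ltW hN] : exists N : nat, K / `|x| < N%:R.
  by exists (Num.bound (K / `|x|)); apply: archi_boundP; rewrite divr_ge0.
have := h N.+1; rewrite ler_pdivlMr ?ltr0n // leNgt => /negP; apply.
rewrite ler_pdivrMr // mulrC in hN.
by apply: le_lt_trans hN _; rewrite ltr_pM2l // ltr_nat ltnW.
Qed.

(** Moments of the spectral measures: y is uniformly approximated by combinations
    of spectral projections, on which the identity is the multiplicativity of E. *)
Theorem spectral_moment w m n : bounded_functional w -> represents w m ->
  m.-integrable setT (EFin \o (fun t : R => t ^+ n)) /\
  (\int[m]_t (t ^+ n))%R = w (y ^+ n).
Proof.
move=> wb wm; have mfin := represents_lty wb wm.
case: n => [|n].
  split; first by apply: (@bounded_Rintegrable _ _ mfin _ _ 1) => // t _; rewrite expr0 normr1.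
  under eq_Rintegral do rewrite expr0.
  by rewrite Rintegral_cst // mul1r wm // sprojT expr0.
have [r r0 rJ] := spectral_support.
have [c0 c00 yc0] := bnd_exists y.
(* The excess 1 lets half-open cells cover the closed interval [-r, r]. *)
pose D := 2 * r + 1; have D0 : 0 < D by rewrite /D; lra.
pose c := 1 + c0 + 2 * D + r.
have c1 : 1 <= c by rewrite /c; lra.
have yc : bnd y c by apply: bnd_le yc0; rewrite /c; lra.
pose d (N : nat) := D * N.+1%:R^-1.
have d0 N : 0 <= d N by rewrite mulr_ge0 ?invr_ge0 // ltW.
have dD N : d N <= D by rewrite /d ler_piMr ?(ltW D0) // invf_le1 ?ltr0n // ler1n.
have dN N : N.+1%:R * d N = D by rewrite /d mulrCA divff ?mulr1 // pnatr_eq0.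
pose J : set R := [set` `[- r, - r + D[].
have mJ : measurable J by exact: measurable_itv.
have JE N : [set` `[- r, - r + N.+1%:R * d N[] = J by rewrite dN.
have rsub : [set` `[- r, r]] `<=` J.
  by move=> t; rewrite /J /D /= !in_itv /= => /andP[h1 h2]; apply/andP; split; lra.
have Jc t : J t -> `|t| <= c.
  by rewrite /J /= in_itv /= ler_norml /c /D => /andP[h1 h2]; apply/andP; split; lra.
pose tk N k : R := - r + k%:R * d N.
have tkJ N k : (k < N.+1)%N -> J (tk N k).
  move=> kN; rewrite /J /= in_itv /= lerDl mulr_ge0 //= ltrD2l -(dN N).
  rewrite ltr_pM2r ?ltr_nat // mulr_gt0 // ?invr_gt0 //.
have tkd N k t : cell (- r) (d N) k t -> `|t - tk N k| <= d N.
  rewrite /cell /tk /= in_itv /= -natr1 mulrDl mul1r ler_norml => /andP[h1 h2].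
  by apply/andP; split; have := d0 N; lra.
pose s N : A := \sum_(k < N.+1) (tk N k)%:C *: sproj (cell (- r) (d N) k).
have bnd_ys N : bnd (y - s N) (2 * d N).
  apply: bnd_radius => u.
  have [_ _ _ _ /(_ u)[nu [nuE yE]]] := spE.
  have nuw : represents (fun a => complex.Re (ip (a u) u)) nu.
    by move=> B mB; rewrite -nuE // sprojE.
  have nub := bounded_functional_ip u.
  have nufin := represents_lty nub nuw.
  have nuJ := rJ _ mJ rsub _ _ nub nuw.
  have [_ idJ] := Rintegral_full nufin mJ nuJ (@measurable_id _ _ setT) Jc.
  rewrite [X in X%:C]idJ in yE.
  have -> : ip ((y - s N) u) u =
     ((\int[nu]_(t in J) t)%R - \sum_(k < N.+1) tk N k * fine (nu (cell (- r) (d N) k)))%:C.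
    rewrite opDE opNE ipBl yE ip_sproj_sum rmorphB /=; congr (_ - _%:C).
    apply: eq_bigr => k _; rewrite nuw ?ip_sproj //; exact: measurable_cell.
  have -> : hnorm u ^+ 2 = fine (nu setT) by rewrite nuw // sprojT op1E ip_hnorm.
  rewrite normc_def /= expr0n /= addr0 sqrtr_sqr.
  rewrite -(JE N); apply: le_trans (Rintegral_step nufin (d0 N) (c := tk N) (e := d N) (C := c) _ _ _) _.
  - exact: measurable_id.
  - by rewrite JE.
  - by move=> k t _; exact: tkd.
  rewrite ler_wpM2l // -lee_fin !measure_fineK // le_measure ?inE //.
have sc N : bnd (s N) c.
  have -> : s N = y - (y - s N) by rewrite opprB addrC subrK.
  apply: bnd_le (bndB yc0 (bnd_ys N)).
  by rewrite /c; have := dD N; lra.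
have mX : measurable_fun setT (fun t : R => t ^+ n.+1) by exact: measurable_funX.
have mJ0 := rJ _ mJ rsub _ _ wb wm.
have XC t : J t -> `|t ^+ n.+1| <= c ^+ n.+1.
  move=> /Jc h; rewrite normrX lerXn2r // ?nnegrE //; exact: le_trans h.
have [intX ->] := Rintegral_full mfin mJ mJ0 mX XC.
split=> //; apply/eqP; rewrite -subr_eq0; apply/eqP.
have [wl [C C0 wC]] := wb.
pose K0 := n.+1%:R * c ^+ n.+1.
have K00 : 0 <= K0 by rewrite mulr_ge0 // exprn_ge0 // (le_trans _ c1).
apply: (@small_eq0 _ ((K0 * fine (m setT) + C * (K0 * 2)) * D)).
  have f0 : 0 <= fine (m setT) by exact: fine_ge0.
  apply: mulr_ge0; last exact: ltW.
  by apply: addr_ge0; apply: mulr_ge0 => //; apply: mulr_ge0.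
move=> N; rewrite -mulrA -/(d N).
have h1 : `|(\int[m]_(t in J) (t ^+ n.+1))%R - w (s N ^+ n.+1)| <= K0 * d N * fine (m setT).
  have -> : w (s N ^+ n.+1) =
      \sum_(k < N.+1) tk N k ^+ n.+1 * fine (m (cell (- r) (d N) k)).
    rewrite /s (@sproj_sumX _ (fun k => (tk N k)%:C)).
    - under eq_bigr do rewrite -rmorphXn /=.
      rewrite (@bounded_functional_sum w _ (fun k => tk N k ^+ n.+1) (fun k => sproj (cell (- r) (d N) k))) //.
      by apply: eq_bigr => k _; rewrite wm //; exact: measurable_cell.
    - by move=> k; exact: measurable_cell.
    - by move=> i j; exact: disjoint_cell.
  rewrite -(JE N).
  apply: le_trans (Rintegral_step mfin (d0 N) (c := fun k => tk N k ^+ n.+1)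
     (e := K0 * d N) (C := c ^+ n.+1) mX _ _) _.
  - by rewrite JE.
  - move=> k t kN tk'; apply: real_expB => //.
    + apply: Jc; rewrite -(JE N); move: tk'; rewrite /cell /= !in_itv /= => /andP[h1 h2].
      apply/andP; split; first by apply: le_trans h1; rewrite lerDl mulr_ge0.
      by apply: lt_le_trans h2 _; rewrite lerD2l ler_wpM2r // ler_nat.
    + exact/Jc/tkJ.
    + exact: tkd.
  apply: ler_wpM2l; first exact: mulr_ge0.
  by rewrite -lee_fin !measure_fineK // le_measure ?inE.
have h2 : `|w (y ^+ n.+1) - w (s N ^+ n.+1)| <= C * (K0 * (2 * d N)).
  have -> : w (y ^+ n.+1) - w (s N ^+ n.+1) = w (y ^+ n.+1 - s N ^+ n.+1).
    by have := wl (-1) (s N ^+ n.+1) (y ^+ n.+1); rewrite rmorphN1 scaleN1r mulN1r addrC [RHS]addrC.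
  apply: wC; first by apply: mulr_ge0 => //; apply: mulr_ge0.
  by apply: bnd_expB => //; apply: mulr_ge0.
have -> : (\int[m]_(t in J) (t ^+ n.+1))%R - w (y ^+ n.+1) =
   ((\int[m]_(t in J) (t ^+ n.+1))%R - w (s N ^+ n.+1)) - (w (y ^+ n.+1) - w (s N ^+ n.+1)).
  by rewrite opprB addrA subrK.
apply: le_trans (ler_normB _ _) _.
by apply: le_trans (lerD h1 h2) _; rewrite le_eqVlt; apply/orP; left; apply/eqP; ring.
Qed.

End SpectralMoments.

(** * The determinant as a series of traces *)

Section LogSeries.
Context {R : realType}.

(** Minus the Taylor polynomial of the logarithm at 1. *)
Definition log_poly (N : nat) : {poly R} :=
  \sum_(n < N) n.+1%:R^-1 *: (1 - 'X) ^+ n.+1.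

Lemma deriv_log_poly N : (log_poly N)^`() = - \sum_(n < N) (1 - 'X) ^+ n.
Proof.
rewrite /log_poly raddf_sum -sumrN; apply: eq_bigr => n _ /=.
rewrite derivZ deriv_exp derivB derivC derivX sub0r /= mulN1r.
by rewrite -[X in _ *: X]scaler_nat scalerA mulVf ?scale1r // pnatr_eq0.
Qed.

(** The derivative of ln + log_poly is (1 - x)^N / x, and this sum vanishes at 1. *)
Lemma ln_log_poly (r x : R) N : 0 <= r < 1 -> 1 - r <= x <= 1 ->
  `|ln x + (log_poly N).[x]| <= r ^+ N / (1 - r).
Proof.
move=> /andP[r0 r1] /andP[x1 x2].
have x0 : 0 < x by lra.
pose f (t : R) := ln t + (log_poly N).[t].
have df (t : R) : 0 < t -> is_derive t 1 f ((1 - t) ^+ N / t).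
  move=> t0; have h1 := is_derive1_ln t0.
  suff -> : (1 - t) ^+ N / t = t^-1 + (log_poly N)^`().[t] by exact: is_deriveD.
  rewrite deriv_log_poly hornerN horner_sum.
  under eq_bigr do rewrite horner_exp hornerD hornerN hornerX hornerC.
  apply: (mulIf (lt0r_neq0 t0)); rewrite divfK ?gt_eqF // mulrBl mulVf ?gt_eqF //.
  have := subrX1 (1 - t) N; rewrite addrAC subrr add0r mulNr => h.
  by apply/eqP; rewrite -subr_eq0 -opprB opprB; apply/eqP; rewrite mulrC in h; lra.
have f1 : f 1 = 0.
  rewrite /f ln1 add0r /log_poly horner_sum big1 // => n _.
  by rewrite hornerZ horner_exp hornerD hornerN hornerX hornerC subrr expr0n mulr0.
have cf : {within `[x, 1], continuous f}.
  apply: derivable_within_continuous => t; rewrite in_itv /= => /andP[t1 _].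
  by have [] := df t (lt_le_trans x0 t1).
have dfx t : t \in `]x, 1[ -> is_derive t 1 f ((1 - t) ^+ N / t).
  by rewrite in_itv /= => /andP[t1 _]; exact: df (lt_trans x0 t1).
have [t tI] := MVT_segment x2 dfx cf.
rewrite f1 sub0r => fE; rewrite -normrN -/(f x) fE normrM.
move: tI; rewrite in_itv /= => /andP[t1 t2]; have t0 : 0 < t by lra.
rewrite normrM normfV normrX [`|t|]gtr0_norm // [`|1 - t|]ger0_norm ?subr_ge0 //.
rewrite [`|1 - x|]ger0_norm ?subr_ge0 //.
have h1 : (1 - t) ^+ N <= r ^+ N by rewrite lerXn2r ?nnegrE ?subr_ge0 //; lra.
have h2 : t^-1 <= (1 - r)^-1 by rewrite lef_pV2 ?posrE //; lra.
have h3 : (1 - t) ^+ N / t <= r ^+ N / (1 - r).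
  by apply: ler_pM => //; rewrite ?exprn_ge0 ?subr_ge0 // invr_ge0 ltW.
have h4 : 0 <= (1 - t) ^+ N / t by rewrite divr_ge0 ?exprn_ge0 ?subr_ge0 // ltW.
by apply: le_trans h3; rewrite ler_piMr //; lra.
Qed.

End LogSeries.

Section SpectralPolynomials.
Context {R : realType} {H : completeNormedModType R[i]}.
Context {ip : {dot H for Num.conj}}.
Context {M : set (H -> H)} {tau : (H -> H) -> R[i]}.
Context {hM : tracial_vna ip M tau}.
Local Notation A := (opalg hM).
Implicit Types (a b : A).

Let ipN : inner_product_norm ip. Proof. by case: hM. Qed.

(** Polynomials with real coefficients evaluated at an element of the algebra. *)
Definition real_horner a (p : {poly R}) : A := horner_alg a (map_poly (real_complex R) p).

HB.instance Definition _ a := GRing.RMorphism.copy (real_horner a)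
  (horner_alg a \o map_poly (real_complex R)).

Lemma real_hornerX a : real_horner a 'X = a.
Proof. by rewrite /real_horner map_polyX horner_algX. Qed.

Lemma real_hornerC a (c : R) : real_horner a c%:P = c%:C *: 1.
Proof. by rewrite /real_horner map_polyC horner_algC. Qed.

Lemma real_hornerZ a (c : R) p : real_horner a (c *: p) = c%:C *: real_horner a p.
Proof. by rewrite -mul_polyC rmorphM /= real_hornerC -scalerAl mul1r. Qed.

Lemma real_hornerE a p : real_horner a p = \sum_(i < size p) (p`_i)%:C *: a ^+ i.
Proof.
rewrite -[in LHS](coefK p) poly_def rmorph_sum /=; apply: eq_bigr => i _.
by rewrite real_hornerZ rmorphXn /= real_hornerX.
Qed.

Variables (y : A) (E : set R -> (H -> H)).
Hypothesis spE : spectral_resolution ip y E.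
Hypothesis EM : forall B, measurable B -> M (E B).
Local Notation sproj := (@sproj R H ip M tau hM E EM).
Local Notation represents := (@represents R H ip M tau hM E EM).

Theorem spectral_poly w m p : bounded_functional w -> represents w m ->
  m.-integrable setT (EFin \o (fun t : R => p.[t])) /\
  (\int[m]_t (p.[t]))%R = w (real_horner y p).
Proof.
move=> wb wm.
have -> : (fun t : R => p.[t]) = (fun t => \sum_(i < size p) p`_i * t ^+ i).
  by apply/funext => t; rewrite horner_coef.
rewrite real_hornerE (@bounded_functional_sum _ _ _ _ _ _ w _ (fun i => p`_i) (fun i => y ^+ i)) //.
elim: (size p) => [|n [IHi IHe]].
  split.
    apply: eq_integrable (integrable0 _ _) => //.
    by move=> t _ /=; rewrite big_ord0.
  under eq_Rintegral do rewrite big_ord0.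
  by rewrite Rintegral_cst // mul0r big_ord0.
have [Xi Xe] := spectral_moment spE n wb wm.
have Xi' : m.-integrable setT (EFin \o (fun t : R => p`_n * t ^+ n)).
  by apply: (integrableZl measurableT p`_n Xi).
split.
  apply: eq_integrable (integrableD measurableT IHi Xi') => //.
  by move=> t _ /=; rewrite big_ord_recr.
under eq_Rintegral do rewrite big_ord_recr /=.
by rewrite RintegralD // IHe RintegralZl // Xe big_ord_recr.
Qed.

Lemma ip_represented u : exists nu : {measure set R -> \bar R},
  represents (fun a => complex.Re (ip (a u) u)) nu.
Proof.
have [_ _ _ _ /(_ u)[nu [nuE _]]] := spE; exists nu => B mB.
by rewrite -nuE // sprojE.
Qed.

(** On a vector in the range of the projection the scalar spectral measure is
    carried by B, so the form of p(y) is at most - e times the squared norm. *)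
Lemma sproj_eq0 (p : {poly R}) (e : R) (B : set R) : measurable B -> 0 < e ->
  (forall t, B t -> p.[t] <= - e) ->
  (forall u, 0 <= complex.Re (ip (real_horner y p u) u)) -> sproj B = 0.
Proof.
move=> mB e0 pB py; apply: op_inj => v; rewrite op0E.
set u := sproj B v.
have pu : sproj B u = u by rewrite /u -opME (sproj_idem spE).
have [nu nuw] := ip_represented u.
have wb := @bounded_functional_ip _ _ _ _ _ hM u.
have nufin := represents_lty wb nuw.
have mBc := measurableC mB.
have nuBc : nu (~` B) = 0%E.
  rewrite nuw // -pu -opME (sproj_mul spE) // setICl (sproj0 spE) op0E.
  by rewrite [ip _ _](linear0l ip).
have [pi pE] := spectral_poly p wb nuw.
have nuT : fine (nu setT) = hnorm u ^+ 2 by rewrite nuw // (sprojT spE) op1E ip_hnorm.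
have nuB : nu setT = nu B.
  transitivity (nu B + nu (~` B))%E; last by rewrite nuBc adde0.
  by rewrite -[in LHS](setUv B) measureU // setICr.
have : (\int[nu]_t (p.[t]))%R <= - e * hnorm u ^+ 2.
  have -> : (\int[nu]_t (p.[t]))%R = (\int[nu]_(t in B) (p.[t]))%R.
    rewrite /Rintegral; congr fine.
    by rewrite (@negligible_integral _ _ _ _ setT (~` B)) // setTD setCK.
  rewrite -nuT nuB -Rintegral_cst //; apply: le_Rintegral => //.
    by apply: integrableS pi.
  by apply: (@bounded_Rintegrable _ _ nufin _ _ `|e|) => // t _; rewrite normrN.
rewrite pE => h; have := py u; have := sqr_ge0 (hnorm u) => h1 h2.
apply: hnorm0_eq0; apply/eqP; rewrite -sqrf_eq0 eq_le h1 andbT.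
by rewrite -(ler_pM2l e0) mulr0; lra.
Qed.

End SpectralPolynomials.

Section SpectralConsequences.
Context {R : realType} {H : completeNormedModType R[i]}.
Context {ip : {dot H for Num.conj}}.
Context {M : set (H -> H)} {tau : (H -> H) -> R[i]}.
Context {hM : tracial_vna ip M tau}.
Local Notation A := (opalg hM).
Implicit Types (a b : A).

Let ipN : inner_product_norm ip. Proof. by case: hM. Qed.

Lemma starX a n : star (a ^+ n) = star a ^+ n.
Proof. by elim: n => [|n IH]; rewrite ?star1 // exprS starM IH -exprSr. Qed.

Lemma star_real_horner a p : star a = a -> star (real_horner a p) = real_horner a p.
Proof.
move=> sa; rewrite real_hornerE; apply: (big_ind (fun b => star b = b)).
- by rewrite -(scale0r 1) starZ rmorph0 star1.
- by move=> b c hb hc; rewrite starD hb hc.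
- by move=> i _; rewrite starZ starX sa conjc_real.
Qed.

Lemma selfadjoint_form_eq0 a : star a = a ->
  (forall u, complex.Re (ip (a u) u) = 0) -> a = 0.
Proof.
move=> sa a0; apply: op_inj => u; rewrite op0E; apply/hnorm0_eq0/eqP.
rewrite eq_le hnorm_ge0 andbT.
have /(_ u) : bnd a (2 * 0).
  apply: bnd_radius => v; rewrite mul0r.
  have : conjc (ip (a v) v) = ip (a v) v by rewrite -(ipC ip) starP sa.
  have := a0 v; case: (ip _ _) => x z /= -> -[].
  move=> /eqP; rewrite -subr_eq0 -opprD oppr_eq0 -mulr2n mulrn_eq0 /= => /eqP ->.
  by rewrite expr0n /= addr0 sqrtr0.
by rewrite mulr0 mul0r.
Qed.

(** The projection of the complement of the two points has trace 0 and is positive,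
    hence vanishes by faithfulness. *)
Lemma two_point_spectrum (y : A) (r x x' : R) : star y = y ->
  spectral_measure ip M tau y (two_atoms r x x') ->
  (y - x%:C *: 1) * (y - x'%:C *: 1) = 0.
Proof.
move=> sy [E spE muE].
have EM B : measurable B -> M (E B) by move=> /muE[].
pose B : set R := ~` [set x; x'].
have mS : measurable ([set x; x'] : set R).
  by apply: measurableU; exact: measurable_set1.
have mB : measurable B by exact: measurableC.
have PB : (sproj EM B : A) = 0.
  apply: tr_faithful; first exact: (sproj_pos spE EM B).
  have := tr_ge0 (sproj_pos spE EM B).
  have := (muE B mB).2; rewrite /two_atoms !diracE !memNset //; last 2 first.
  - by apply; right.
  - by apply; left.
  rewrite !mule0 adde0 => -[].
  have -> : tau (E B) = tr ((sproj EM B : A)).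
    by rewrite /tr; congr tau; apply/funext => u; rewrite sprojE.
  by case: (tr _) => t1 t2 /= <-; rewrite lecE /= => /andP[/eqP ->].
pose p : {poly R} := ('X - x%:P) * ('X - x'%:P).
have -> : (y - x%:C *: 1) * (y - x'%:C *: 1) = real_horner y p.
  by rewrite /p rmorphM !rmorphB /= real_hornerX !real_hornerC.
apply: selfadjoint_form_eq0; first exact: star_real_horner.
move=> u; have [nu nuw] := ip_represented spE EM u.
have wb := @bounded_functional_ip _ _ _ _ _ hM u.
have nufin := represents_lty wb nuw.
have nuB : nu B = 0%E.
  by rewrite nuw // PB op0E [ip _ _](linear0l ip).
have [pi <-] := spectral_poly spE p wb nuw.
have -> : (\int[nu]_t (p.[t]))%R = (\int[nu]_(t in [set x; x']) (p.[t]))%R.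
  rewrite /Rintegral; congr fine.
  by rewrite (@negligible_integral _ _ _ _ setT B) // setTD setCK.
rewrite (@eq_Rintegral _ _ _ _ _ (fun=> 0)) ?Rintegral_cst ?mul0r //.
move=> t; rewrite inE /p hornerM !hornerXsubC => -[] ->; by rewrite subrr ?mul0r ?mulr0.
Qed.

Lemma measurable_lne_EFin : measurable_fun setT (fun t : R => lne t%:E).
Proof.
have -> : (fun t : R => lne t%:E) = (fun t => if t <= 0 then -oo%E else (ln t)%:E).
  by [].
apply: measurable_fun_ifT => //; first exact: measurable_fun_ler.
by apply/measurable_EFinP; exact: measurable_ln.
Qed.

Lemma real_horner_comp a (p q : {poly R}) :
  real_horner a (p \Po q) = real_horner (real_horner a q) p.
Proof.
rewrite comp_polyE rmorph_sum /= [RHS]real_hornerE; apply: eq_bigr => i _.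
by rewrite real_hornerZ rmorphXn.
Qed.

Lemma Re_ip_star_mul a u : complex.Re (ip ((star a * a) u) u) = hnorm (a u) ^+ 2.
Proof. by rewrite opME starPr ip_hnorm. Qed.

(** Three applications of the vanishing of spectral projections confine the
    spectrum of |x| to an interval ]s, S[ with s > 0; there 2 log t - log L is the
    logarithm of t^2 / L, whose Taylor series at 1 converges uniformly, and the
    integral of a polynomial is a trace by the moment theorem. *)
Theorem fuglede_kadison_series (x : A) (e L : R) (d : \bar R) : 0 < e -> 0 < L ->
  (forall u, e * hnorm u ^+ 2 <= hnorm (x u) ^+ 2 <= L / 2 * hnorm u ^+ 2) ->
  fuglede_kadison ip M tau x d ->
  exists l : R, lne d = l%:E /\ forall N,
    `|2 * l - (ln L - complex.Re (tr (real_horner ((L^-1)%:C *: (star x * x))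
         (log_poly N))))| <= (1 - e / (2 * L)) ^+ N / (e / (2 * L)).
Proof.
move=> e0 L0 xb [h0 [xs [mu [[Mh hpos] [Mxs adj] hh [E spE muE] ->]]]].
pose h : A := inM hM Mh.
have {}spE : spectral_resolution ip h E by exact: spE.
have xsE : xs = star x.
  by rewrite (@star_unique _ _ _ _ _ hM x (inM hM Mxs)).
have h2 : h * h = star x * x.
  by apply: op_inj => u; have := congr1 (fun f => f u) hh; rewrite xsE.
have hX2 : real_horner h ('X ^+ 2) = star x * x.
  by rewrite expr2 rmorphM /= real_hornerX h2.
have EM B : measurable B -> M (E B) by move=> /muE[].
have wb := @bounded_functional_tr _ _ _ _ _ hM.
have muw : represents EM (fun a : A => complex.Re (tr a)) mu.
  move=> B mB; rewrite (muE _ mB).2; congr (_ (tau _))%:E.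
  by apply/funext => u; rewrite sprojE.
have mufin := represents_lty wb muw.
pose s := Num.sqrt (e / 2); pose S := Num.sqrt L.
have s0 : 0 < s by rewrite sqrtr_gt0 divr_gt0.
have s2 : s ^+ 2 = e / 2 by rewrite sqr_sqrtr // divr_ge0 // ltW.
have S0 : 0 < S by rewrite sqrtr_gt0.
have S2 : S ^+ 2 = L by rewrite sqr_sqrtr // ltW.
have B1 : mu [set` `]-oo, (- s)]] = 0%E.
  rewrite muw; last exact: measurable_itv.
  rewrite (@sproj_eq0 _ _ _ _ _ _ h E spE EM 'X s) ?linear0 //.
  - by move=> t; rewrite /= in_itv /= hornerX.
  - by move=> u; rewrite real_hornerX; have := hpos u; rewrite lecE => /andP[].
have B2 : mu [set` `[- s, s]] = 0%E.
  rewrite muw; last exact: measurable_itv.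
  rewrite (@sproj_eq0 _ _ _ _ _ _ h E spE EM ('X ^+ 2 - e%:P) (e / 2)) ?linear0 //.
  - by rewrite divr_gt0.
  - move=> t; rewrite /= in_itv /= hornerD hornerN hornerXn hornerC => /andP[h1 h3].
    have : t ^+ 2 <= s ^+ 2 by nra.
    lra.
  - have -> : real_horner h ('X ^+ 2 - e%:P) = star x * x - e%:C *: 1.
      by rewrite rmorphB /= hX2 real_hornerC.
    move=> u; rewrite opDE opNE opZE op1E ipBl ipZl (ip_hnorm ipN) -rmorphM.
    have := Re_ip_star_mul x u; case: (ip _ _) => a b /= ->.
    by rewrite subr_ge0; have /andP[] := xb u.
have B3 : mu [set` `[S, +oo[] = 0%E.
  rewrite muw; last exact: measurable_itv.
  rewrite (@sproj_eq0 _ _ _ _ _ _ h E spE EM ((L / 2)%:P - 'X ^+ 2) (L / 2)) ?linear0 //.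
  - by rewrite divr_gt0.
  - move=> t; rewrite /= in_itv /= andbT hornerD hornerN hornerXn hornerC => h1.
    have : S ^+ 2 <= t ^+ 2 by nra.
    lra.
  - have -> : real_horner h ((L / 2)%:P - 'X ^+ 2) = (L / 2)%:C *: 1 - star x * x.
      by rewrite rmorphB /= hX2 real_hornerC.
    move=> u; rewrite opDE opNE opZE op1E ipBl ipZl (ip_hnorm ipN) -rmorphM.
    have := Re_ip_star_mul x u; case: (ip _ _) => a b /= ->.
    by rewrite subr_ge0; have /andP[] := xb u.
pose J : set R := [set` `]s, S[].
have mJ : measurable J by exact: measurable_itv.
have mJc := measurableC mJ.
have muJc : mu (~` J) = 0%E.
  apply/eqP; rewrite eq_le measure_ge0 andbT.
  have sub : ~` J `<=` [set` `]-oo, (- s)]] `|` [set` `[- s, s]] `|` [set` `[S, +oo[].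
    move=> t; rewrite /J /= !in_itv /= andbT => /negP.
    rewrite negb_and -!leNgt => /orP[ts|]; last by right.
    by left; case: (leP t (- s)) => ts'; [left|right; rewrite ts (ltW ts')].
  apply: le_trans (le_measure mu _ _ sub) _; rewrite ?inE //.
    by do 2!(apply: measurableU => //).
  apply: le_trans (measureU2 _ _ _) _ => //; first exact: measurableU.
  rewrite [X in (_ + X)%E]B3 adde0; apply: le_trans (measureU2 _ _ _) _ => //.
  by rewrite [X in (X + _)%E]B1 [X in (_ + X)%E]B2 adde0.
have muT : fine (mu setT) = 1 by rewrite muw // (sprojT spE) tr1.
have muJ : fine (mu J) = 1.
  rewrite -muT; congr fine; transitivity (mu J + mu (~` J))%E.
    by rewrite [X in (_ + X)%E]muJc adde0.
  by rewrite -[in RHS](setUv J) measureU // setICr.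
have lnJ t : J t -> `|ln t| <= `|ln s| + `|ln S|.
  rewrite /J /= in_itv /= => /andP[h1 h3].
  have t0 : 0 < t by exact: lt_trans s0 h1.
  have k1 : ln s <= ln t by rewrite ler_ln ?posrE // ltW.
  have k2 : ln t <= ln S by rewrite ler_ln ?posrE // ltW.
  by rewrite ler_norml; have := ler_norm (ln S); have := ler_norm (- ln s);
    have := normr_ge0 (ln S); have := normr_ge0 (ln s); rewrite normrN;
    move=> *; apply/andP; split; lra.
have iln : mu.-integrable J (EFin \o (@ln R)).
  by apply: (bounded_Rintegrable mufin mJ _ lnJ); exact: measurable_ln.
have lnelnJ : {in J, (fun t : R => lne t%:E) =1 EFin \o (@ln R)}.
  move=> t; rewrite inE => Jt; have t0 : 0 < t; last by rewrite lne_EFin.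
  by move: Jt; rewrite /J /= in_itv /= => /andP[h1 _]; exact: lt_trans s0 h1.
have DJ : [set` `[0%R, +oo[] `\` (~` J) = J.
  rewrite setDE setCK; apply/seteqP; split=> [t []//|t Jt]; split=> //.
  move: Jt; rewrite /J /= !in_itv /= andbT => /andP[h1 _].
  by apply: ltW; exact: lt_trans s0 h1.
have mD : measurable ([set` `[0%R, +oo[] : set R) by exact: measurable_itv.
have ilne : mu.-integrable [set` `[0%R, +oo[] (fun t => lne t%:E).
  apply/(negligible_integrable mJc mD) => //.
    exact: measurable_funS measurable_lne_EFin.
  by rewrite DJ; apply: eq_integrable iln => // t tJ; rewrite lnelnJ.
rewrite expeRK (negligible_integral mJc mD ilne muJc) DJ.
rewrite (eq_integral _ _ lnelnJ).
exists (\int[mu]_(t in J) ln t)%R; split.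
  by rewrite fineK //; exact: integrable_fin_num.
move=> N.
pose P : {poly R} := log_poly N \Po (L^-1 *: 'X ^+ 2).
have -> : real_horner ((L^-1)%:C *: (star x * x)) (log_poly N) = real_horner h P.
  by rewrite /P real_horner_comp real_hornerZ hX2.
have [iP <-] := spectral_poly spE P wb muw.
have -> : (\int[mu]_t (P.[t]))%R = (\int[mu]_(t in J) (P.[t]))%R.
  rewrite /Rintegral; congr fine.
  by rewrite (@negligible_integral _ _ _ _ setT (~` J)) // setTD setCK.
have iPJ : mu.-integrable J (EFin \o (fun t : R => P.[t])) by apply: integrableS iP.
have i2 : mu.-integrable J (EFin \o (fun t : R => 2 * ln t)).
  by apply: (integrableZl mJ 2 iln).
have ic : mu.-integrable J (EFin \o (fun t : R => ln L)).
  by apply: (@bounded_Rintegrable _ _ mufin _ _ `|ln L|).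
have -> : 2 * (\int[mu]_(t in J) ln t)%R - (ln L - (\int[mu]_(t in J) (P.[t]))%R) =
    (\int[mu]_(t in J) ((2 * ln t - ln L) + P.[t]))%R.
  rewrite RintegralD //; last exact: (integrableB mJ i2 ic).
  by rewrite RintegralB // RintegralZl // Rintegral_cst // muJ mulr1 opprB addrA addrAC.
have := @Rintegral_cst_approx _ _ mufin J (fun t => (2 * ln t - ln L) + P.[t]) 0
  ((1 - e / (2 * L)) ^+ N / (e / (2 * L))) mJ.
rewrite mul0r subr0 muJ mulr1; apply.
  apply: measurable_funD; last exact: measurable_poly.
  by apply: measurable_funB => //; apply: measurable_funM => //; exact: measurable_ln.
move=> t; rewrite /J /= in_itv /= => /andP[h1 h3]; rewrite subr0.
have t0 : 0 < t by exact: lt_trans s0 h1.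
have k1 : e / 2 < t ^+ 2 by rewrite -s2; nra.
have k2 : t ^+ 2 < L by rewrite -S2; nra.
have -> : P.[t] = (log_poly N).[t ^+ 2 / L].
  by rewrite /P horner_comp hornerZ hornerXn mulrC.
have -> : 2 * ln t - ln L = ln (t ^+ 2 / L).
  by rewrite ln_div ?posrE ?exprn_gt0 // lnXn // mulr_natl.
have eL : e / (2 * L) = e / 2 / L by field; rewrite gt_eqF.
have eL0 : 0 < e / (2 * L) by rewrite divr_gt0 // mulr_gt0.
have eL1 : e / (2 * L) <= t ^+ 2 / L by rewrite eL ler_pM2r ?invr_gt0 // ltW.
have tL1 : t ^+ 2 / L <= 1 by rewrite ler_pdivrMr // mul1r ltW.
have -> : (1 - e / (2 * L)) ^+ N / (e / (2 * L)) =
  (1 - e / (2 * L)) ^+ N / (1 - (1 - e / (2 * L))) by rewrite subKr.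
by apply: ln_log_poly; apply/andP; split; lra.
Qed.

End SpectralConsequences.

(** * Expansion of the logarithm of the determinant *)

Section TracePolynomials.
Context {R : realType} {H : completeNormedModType R[i]}.
Context {ip : {dot H for Num.conj}}.
Context {M : set (H -> H)} {tau : (H -> H) -> R[i]}.
Context {hM : tracial_vna ip M tau}.
Local Notation A := (opalg hM).
Implicit Types (a b : A) (P Q : {poly A}) (t : R).

Definition Re_tr a : R := complex.Re (tr a).

Let Re_tr_is_additive : additive Re_tr.
Proof.
by move=> a b; rewrite /Re_tr linearB /=; case: (tr a) (tr b) => [? ?] [? ?].
Qed.
HB.instance Definition _ := GRing.isAdditive.Build A R Re_tr Re_tr_is_additive.

Lemma Re_trC a b : Re_tr (a * b) = Re_tr (b * a).
Proof. by rewrite /Re_tr trC. Qed.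

Lemma Re_trZ (c : R) a : Re_tr (c%:C *: a) = c * Re_tr a.
Proof.
by rewrite /Re_tr linearZ /=; case: (tr a) => ? ? /=; rewrite mul0r subr0.
Qed.

(** Scalars are central, so that evaluation of polynomials over the
    noncommutative algebra is multiplicative at them. *)
Definition pt t : A := t%:C *: 1.

Lemma comm_pt P t : comm_poly P (pt t).
Proof. by rewrite /comm_poly /pt -scalerAl -scalerAr mul1r mulr1. Qed.

Lemma horner_ptM P Q t : (P * Q).[pt t] = P.[pt t] * Q.[pt t].
Proof. by rewrite hornerM_comm //; exact: comm_pt. Qed.

Lemma horner_ptX P n t : (P ^+ n).[pt t] = P.[pt t] ^+ n.
Proof. by elim: n => [|n IH]; rewrite ?hornerC // !exprS horner_ptM IH. Qed.

Definition trpoly P : {poly R} := map_poly Re_tr P.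

Lemma horner_trpoly P t : (trpoly P).[t] = Re_tr P.[pt t].
Proof.
rewrite (@horner_coef_wide _ (size P)) ?size_poly // horner_coef raddf_sum /=.
apply: eq_bigr => i _; rewrite coef_map_id0 ?raddf0 //.
have -> : pt t ^+ i = (t ^+ i)%:C *: 1.
  by rewrite /pt exprZn expr1n rmorphXn.
by rewrite -scalerAr mulr1 Re_trZ mulrC.
Qed.

Lemma deriv_trpoly P : (trpoly P)^`() = trpoly P^`().
Proof.
apply/polyP => i; rewrite coef_deriv !coef_map_id0 ?raddf0 // coef_deriv.
by rewrite raddfMn.
Qed.

(** The derivative of a power is the sum of the products with one factor
    differentiated, and cyclicity identifies the traces of all of them. *)
Lemma Re_tr_deriv_exp P n t :
  Re_tr ((P ^+ n)^`().[pt t]) = n%:R * Re_tr (P.[pt t] ^+ n.-1 * P^`().[pt t]).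
Proof.
have key m : Re_tr (P.[pt t] ^+ m * (P ^+ n)^`().[pt t]) =
    n%:R * Re_tr (P.[pt t] ^+ (m + n).-1 * P^`().[pt t]).
  elim: n m => [|n IH] m.
    by rewrite expr0 derivC horner0 mulr0 raddf0 mul0r.
  rewrite exprS derivM hornerD !horner_ptM horner_ptX mulrDr raddfD /=.
  rewrite [X in _ + Re_tr X]mulrA -exprSr IH addSn /= addnS /=.
  rewrite [X in Re_tr X + _]mulrA Re_trC mulrA -exprD [(n + m)%N]addnC -natr1 mulrDl.
  by rewrite mul1r addrC.
by have := key 0%N; rewrite expr0 mul1r add0n.
Qed.

End TracePolynomials.

Section Resolvent.
Context {R : realType} {H : completeNormedModType R[i]}.
Context {ip : {dot H for Num.conj}}.
Context {M : set (H -> H)} {tau : (H -> H) -> R[i]}.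
Context {hM : tracial_vna ip M tau}.
Local Notation A := (opalg hM).
Implicit Types (a b : A) (t : R) (w : R[i]).

Let ipN : inner_product_norm ip. Proof. by case: hM. Qed.

Definition cabs w : R := complex.Re `|w|.

Lemma cabs_ge0 w : 0 <= cabs w.
Proof. by rewrite /cabs normc_def; exact: sqrtr_ge0. Qed.

Lemma cabsE w : `|w| = (cabs w)%:C. Proof. by rewrite RRe_real // ger0_real. Qed.

Lemma cabsM w w' : cabs (w * w') = cabs w * cabs w'.
Proof. by apply: complexI; rewrite [RHS]rmorphM -!cabsE normrM. Qed.

Lemma cabsX w n : cabs (w ^+ n) = cabs w ^+ n.
Proof. by apply: complexI; rewrite [RHS]rmorphXn -!cabsE normrX. Qed.

Lemma cabs_real (x : R) : 0 <= x -> cabs x%:C = x.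
Proof. by move=> x0; rewrite /cabs ger0_norm ?ler0c. Qed.

Lemma Re_sum (I : Type) (r : seq I) (F : I -> R[i]) :
  complex.Re (\sum_(i <- r) F i) = \sum_(i <- r) complex.Re (F i).
Proof. by apply: (big_morph (@complex.Re R)) => // -[? ?] [? ?]. Qed.

Lemma cabsN w : cabs (- w) = cabs w. Proof. by rewrite /cabs normrN. Qed.

Lemma Re_tr_scale_le w a r : 0 <= r -> bnd a r -> `|complex.Re (w * tr a)| <= cabs w * r.
Proof.
move=> r0 ar; have -> : w * tr a = tr (w *: a) by rewrite linearZ.
by apply: Re_tr_le; [exact: bndZ | rewrite mulr_ge0 ?cabs_ge0].
Qed.

Definition bounded_below a (e : R) := forall u, e * hnorm u <= hnorm (a u).

Lemma geometric_suml a N : (1 - a) * (\sum_(n < N) a ^+ n) = 1 - a ^+ N.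
Proof. by rewrite -[RHS]opprB subrX1 -mulNr opprB. Qed.

Lemma geometric_sumr a N : (\sum_(n < N) a ^+ n) * (1 - a) = 1 - a ^+ N.
Proof.
rewrite -geometric_suml mulrBl mulrBr mul1r mulr1 mulr_suml mulr_sumr; congr (_ - _).
by apply: eq_bigr => i _; rewrite -exprS -exprSr.
Qed.

Section Contraction.
Variables (a : A) (e C : R).
Hypotheses (e0 : 0 < e) (eC : e <= C) (ae : bounded_below a e) (aC : bnd a C).

(** Twice the square of the norm bound makes the Landweber step
    1 - star a * a / L a strict contraction. *)
Definition landweber_cst : R := 2 * C ^+ 2.
Local Notation L := landweber_cst.
Definition landweber_rate : R := e ^+ 2 / (2 * L).
Local Notation s := landweber_rate.
Definition landweber : A := 1 - (L^-1)%:C *: (star a * a).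
Local Notation U := landweber.

Let C0 : 0 < C. Proof. exact: lt_le_trans eC. Qed.

Lemma landweber_cst_gt0 : 0 < L.
Proof. by rewrite mulr_gt0 // exprn_gt0. Qed.

Lemma landweber_rate_bounds : 0 < s < 1.
Proof.
rewrite /s divr_gt0 ?mulr_gt0 ?exprn_gt0 ?landweber_cst_gt0 //=.
rewrite ltr_pdivrMr ?mul1r ?mulr_gt0 ?landweber_cst_gt0 // /landweber_cst.
have : e ^+ 2 <= C ^+ 2 by rewrite ler_sqr ?nnegrE ?(ltW e0) ?(ltW C0).
have := exprn_gt0 2 C0; lra.
Qed.

(** Expanding the square of the norm of U u leaves the norm of a u with a negative
    coefficient, because the quadratic term in 1/L is at most half the linear one. *)
Lemma bnd_landweber : bnd U (1 - s).
Proof.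
move=> u; have /andP[s0 s1] := landweber_rate_bounds; have L0 := landweber_cst_gt0.
rewrite -ler_sqr ?nnegrE ?hnorm_ge0 ?mulr_ge0 ?hnorm_ge0 ?subr_ge0 ?(ltW s1) //.
rewrite /U opDE op1E opNE opZE -scaleNr -rmorphN (hnorm_sqrD ipN) ipZr conjc_real hnormZ.
have -> : complex.Re `|(- L^-1)%:C : R[i]| = L^-1.
  by rewrite rmorphN normrN ger0_norm ?ler0c // invr_ge0 ltW.
have -> : ip u ((star a * a) u) = (hnorm (a u) ^+ 2)%:C.
  by rewrite opME -starP ip_hnorm.
have := ae u; set x := hnorm u; set y := hnorm (a u) => h1.
have x0 : 0 <= x by exact: hnorm_ge0.
have y0 : 0 <= y by exact: hnorm_ge0.
have h2 : hnorm ((star a * a) u) <= C * y by rewrite opME; apply: bnd_star => //; exact: ltW.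
have h3 : (L^-1 * hnorm ((star a * a) u)) ^+ 2 <= L^-1 * (y ^+ 2 / 2).
  rewrite exprMn expr2 -mulrA ler_pM2l ?invr_gt0 // ler_pdivrMl //.
  have -> : L * (y ^+ 2 / 2) = (C * y) ^+ 2 by rewrite /landweber_cst; field.
  by rewrite ler_sqr ?nnegrE ?hnorm_ge0 // mulr_ge0 // ltW.
rewrite -rmorphM /=.
have h4 : L^-1 * (e * x) ^+ 2 <= L^-1 * y ^+ 2.
  by rewrite ler_pM2l ?invr_gt0 // ler_sqr ?nnegrE // mulr_ge0 // ltW.
have h5 : L^-1 * (e * x) ^+ 2 = 2 * s * x ^+ 2.
  by rewrite /s exprMn; field; rewrite gt_eqF.
have h6 : ((1 - s) * x) ^+ 2 = x ^+ 2 - 2 * s * x ^+ 2 + s ^+ 2 * x ^+ 2 by ring.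
have h7 : 0 <= s ^+ 2 * x ^+ 2 by rewrite mulr_ge0 ?sqr_ge0.
have h8 : 0 <= L^-1 * y ^+ 2 by rewrite mulr_ge0 ?sqr_ge0 // invr_ge0 ltW.
by lra.
Qed.

(** The truncated Neumann series of (star a * a)^-1. *)
Definition neumann N : A := (L^-1)%:C *: \sum_(n < N) U ^+ n.

(** Approximates the inverse (star a * a)^-1 star a of an invertible a. *)
Definition approx_inverse N : A := neumann N * star a.

Lemma neumann_mulr N : neumann N * (star a * a) = 1 - U ^+ N.
Proof.
have Ea : (L^-1)%:C *: (star a * a) = 1 - U by rewrite opprB addrC subrK.
by rewrite /neumann -scalerAl scalerAr Ea geometric_sumr.
Qed.

Lemma neumann_mull N : (star a * a) * neumann N = 1 - U ^+ N.
Proof.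
have Ea : (L^-1)%:C *: (star a * a) = 1 - U by rewrite opprB addrC subrK.
by rewrite /neumann -scalerAr scalerAl Ea geometric_suml.
Qed.

Lemma approx_inverse_mull N : approx_inverse N * a = 1 - U ^+ N.
Proof. by rewrite -mulrA neumann_mulr. Qed.

Lemma bnd_neumann N : bnd (neumann N) (2 / e ^+ 2).
Proof.
have /andP[s0 s1] := landweber_rate_bounds; have L0 := landweber_cst_gt0.
have k0 : 0 <= 1 - s by rewrite subr_ge0 ltW.
have := bnd_sum (index_enum 'I_N) (fun n : 'I_N => bndX n k0 bnd_landweber).
move=> /(bndZ (L^-1)%:C); rewrite -/(cabs _) cabs_real ?invr_ge0 ?(ltW L0) //.
apply: bnd_le.
have -> : 2 / e ^+ 2 = L^-1 * s^-1.
  by rewrite /s; field; rewrite !gt_eqF.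
rewrite ler_pM2l ?invr_gt0 //.
rewrite -(ler_pM2l s0) divff ?gt_eqF //.
have := subrX1 (1 - s) N; rewrite addrAC subrr add0r => h.
have : 0 <= (1 - s) ^+ N by exact: exprn_ge0.
by rewrite mulNr in h; lra.
Qed.

Lemma bnd_approx_inverse N : bnd (approx_inverse N) (2 * C / e ^+ 2).
Proof.
have -> : 2 * C / e ^+ 2 = 2 / e ^+ 2 * C by ring.
apply: bndM; first by rewrite divr_ge0 // sqr_ge0.
  exact: bnd_neumann.
by apply: bnd_star => //; exact: ltW.
Qed.

Hypothesis ae' : bounded_below (star a) e.

(** Injectivity of the adjoint makes the left inverse also a right inverse. *)
Lemma bnd_approx_inverse_mulr N : bnd (a * approx_inverse N - 1) (C / e * (1 - s) ^+ N).
Proof.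
have /andP[s0 s1] := landweber_rate_bounds.
have k0 : 0 <= 1 - s by rewrite subr_ge0 ltW.
have E : star a * (a * approx_inverse N - 1) = - (U ^+ N * star a).
  rewrite mulrBr mulr1 /approx_inverse !mulrA -(mulrA (star a * a)).
  by rewrite !mulrA neumann_mull mulrBl mul1r addrAC subrr add0r.
have b : bnd (star a * (a * approx_inverse N - 1)) ((1 - s) ^+ N * C).
  rewrite E; apply: bndN; apply: bndM; first exact: exprn_ge0.
    by apply: bndX => //; exact: bnd_landweber.
  by apply: bnd_star => //; exact: ltW.
move=> u; have := b u; rewrite opME => h.
have := ae' ((a * approx_inverse N - 1) u) => h'.
rewrite -(ler_pM2l e0); apply: le_trans h' _; apply: le_trans h _.
by rewrite le_eqVlt; apply/orP; left; apply/eqP; field; rewrite gt_eqF.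
Qed.

End Contraction.
End Resolvent.

Section LogDeterminantExpansion.
Context {R : realType} {H : completeNormedModType R[i]}.
Context {ip : {dot H for Num.conj}}.
Context {M : set (H -> H)} {tau : (H -> H) -> R[i]}.
Context {hM : tracial_vna ip M tau}.
Local Notation A := (opalg hM).
Implicit Types (b : A) (t : R) (w : R[i]).

Variables (a : A) (e C r0 : R).
Hypotheses (e0 : 0 < e) (eC : e <= C) (r00 : 0 <= r0).
Let shift w : A := a + w *: 1.
Hypothesis below : forall w, cabs w <= r0 -> bounded_below (shift w) e.
Hypothesis below' : forall w, cabs w <= r0 -> bounded_below (star (shift w)) e.
Hypothesis above : forall w, cabs w <= r0 -> bnd (shift w) C.

Let C0 : 0 < C. Proof. exact: lt_le_trans eC. Qed.
Let L := landweber_cst C.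
Let k := 1 - landweber_rate e C.
Let cY := 2 * C / e ^+ 2.
Let Y N := approx_inverse a C N.

(** Within it the geometric series of the resolvent has ratio at most 1/2. *)
Definition expansion_radius : R := Num.min r0 (e ^+ 2 / (4 * C)).

Let cY0 : 0 < cY. Proof. by rewrite /cY divr_gt0 ?mulr_gt0 ?exprn_gt0. Qed.
Let k01 : 0 < k < 1.
Proof. by have := landweber_rate_bounds e0 eC; rewrite /k => /andP[? ?]; lra. Qed.

Lemma star_landweber b : star (landweber b C) = landweber b C.
Proof. by rewrite /landweber starB star1 starZ conjc_real starM starK. Qed.

Lemma star_neumann b N : star (neumann b C N) = neumann b C N.
Proof.
rewrite /neumann starZ conjc_real; congr (_ *: _).
apply: (big_ind (fun b => star b = b)).
- by rewrite -(scale0r 1) starZ rmorph0 star1.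
- by move=> x y hx hy; rewrite starD hx hy.
- by move=> i _; rewrite starX star_landweber.
Qed.

Let shift0 : shift 0 = a. Proof. by rewrite /shift scale0r addr0. Qed.

Definition resolvent_series N w : A := \sum_(j < N) (- w) ^+ j *: Y N ^+ j.+1.

Let err N := cY * (2 * k ^+ N + 2^-1 ^+ N + 2 * (C / e) * k ^+ N).

(** Both sides approximate the inverse of the shifted operator. *)
Lemma approx_inverse_resolvent N w : cabs w <= expansion_radius ->
  bnd (approx_inverse (shift w) C N - resolvent_series N w) (err N).
Proof.
rewrite le_min => /andP[wr0 wr].
have a0 := below (w := 0); have a0' := below' (w := 0); have a0C := above (w := 0).
have c0 : cabs (0 : R[i]) = 0 by exact: (cabs_real (lexx 0)).
rewrite c0 shift0 in a0 a0' a0C.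
move: a0 a0' a0C => /(_ r00) a0 /(_ r00) a0' /(_ r00) a0C.
have /andP[k0 k1] := k01.
have YcY : bnd (Y N) cY by apply: bnd_approx_inverse.
set D := a * Y N - 1.
have Db : bnd D (C / e * k ^+ N) by apply: bnd_approx_inverse_mulr.
set V := \sum_(j < N) (- w) ^+ j *: Y N ^+ j.
have RV : resolvent_series N w = Y N * V.
  by rewrite mulr_sumr; apply: eq_bigr => j _; rewrite -scalerAr -exprS.
have VE : V + w *: (Y N * V) = 1 - (- w) ^+ N *: Y N ^+ N.
  have -> : w *: (Y N * V) = - ((- w *: Y N) * V).
    by rewrite -scalerAl scaleNr opprK.
  have -> : V = \sum_(j < N) (- w *: Y N) ^+ j.
    by apply: eq_bigr => j _; rewrite exprZn.
  by rewrite -exprZn -geometric_suml mulrBl mul1r.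
have ZR : shift w * resolvent_series N w = 1 - ((- w) ^+ N *: Y N ^+ N - D * V).
  rewrite RV /shift mulrDl mulrA -scalerAl mul1r.
  have -> : a * Y N = D + 1 by rewrite subrK.
  by rewrite mulrDl mul1r -addrA VE opprB addrCA.
set er := _ - D * V in ZR.
have wY : cabs w * cY <= 2^-1.
  have -> : 2^-1 = e ^+ 2 / (4 * C) * cY.
    by rewrite /cY; field; rewrite !gt_eqF.
  by rewrite ler_pM2r.
have cw := cabs_ge0 w.
have wYj j : bnd ((- w) ^+ j *: Y N ^+ j) (2^-1 ^+ j).
  apply: bnd_le (bndZ _ (bndX j (ltW cY0) YcY)).
  by rewrite -/(cabs _) cabsX cabsN -exprMn lerXn2r ?nnegrE // mulr_ge0 // ltW.
have Vb : bnd V 2.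
  apply: bnd_le (bnd_sum (index_enum 'I_N) (fun j : 'I_N => wYj j)).
  have := subrX1 (2^-1 : R) N.
  have : 0 <= (2^-1 : R) ^+ N by rewrite exprn_ge0 // invr_ge0.
  by lra.
have erb : bnd er (2^-1 ^+ N + C / e * k ^+ N * 2).
  apply: bndB => //; apply: bndM => //.
  by rewrite mulr_ge0 ?divr_ge0 ?exprn_ge0 // ltW.
have Lb : bnd (approx_inverse (shift w) C N) cY.
  by apply: bnd_approx_inverse => //; [apply: below|apply: above].
(* An approximate left inverse l and an approximate right inverse m of b differ
   by l (1 - b m) - (1 - l b) m. *)
have -> : approx_inverse (shift w) C N - resolvent_series N w =
    approx_inverse (shift w) C N * er - landweber (shift w) C ^+ N * resolvent_series N w.
  have -> : er = 1 - shift w * resolvent_series N w by rewrite ZR subKr.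
  rewrite mulrBr mulr1 mulrA approx_inverse_mull.
  by rewrite mulrBl mul1r opprB addrA [RHS]addrAC addrK.
have Ub : bnd (landweber (shift w) C ^+ N) (k ^+ N).
  apply: bndX; first exact: ltW.
  by apply: bnd_landweber => //; [apply: below|apply: above].
have kN0 : 0 <= k ^+ N by rewrite exprn_ge0 // ltW.
rewrite RV; have := bndB (bndM (ltW cY0) Lb erb) (bndM kN0 Ub (bndM (ltW cY0) YcY Vb)).
by apply: bnd_le; rewrite /err le_eqVlt; apply/orP; left; apply/eqP; ring.
Qed.

Section Ray.
Variables (N : nat) (z : R[i]).

Let PZ : {poly A} := a%:P + (z *: 1)%:P * 'X.
Let PZs : {poly A} := (star a)%:P + (conjc z *: 1)%:P * 'X.
Let PU : {poly A} := 1 - ((L^-1)%:C *: 1)%:P * (PZs * PZ).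

Let z_t t : R[i] := t%:C * z.

Let PZE t : PZ.[pt t] = shift (z_t t).
Proof.
rewrite /PZ hornerD horner_ptM !hornerC hornerX /pt /shift /z_t.
by rewrite -scalerAl -scalerAr mul1r scalerA mulrC.
Qed.

Let PZsE t : PZs.[pt t] = star (shift (z_t t)).
Proof.
rewrite /PZs hornerD horner_ptM !hornerC hornerX /pt /shift /z_t starD starZ star1.
have -> : conjc (t%:C * z) = t%:C * conjc z.
  by rewrite [LHS]rmorphM; congr (_ * _); exact: conjc_real.
by rewrite -scalerAl -scalerAr mul1r scalerA mulrC.
Qed.

Let PUE t : PU.[pt t] = landweber (shift (z_t t)) C.
Proof.
rewrite /PU hornerD hornerN !horner_ptM !hornerC PZE PZsE /landweber.
by rewrite -scalerAl mul1r.
Qed.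

Let derivPU t : PU^`().[pt t] =
  - ((L^-1)%:C *: (conjc z *: shift (z_t t) + z *: star (shift (z_t t)))).
Proof.
have dX b : ((b%:P * 'X)^`() : {poly A}) = b%:P.
  by rewrite derivM derivC derivX mul0r mulr1 add0r.
rewrite /PU derivB derivC sub0r hornerN derivM derivC mul0r add0r derivM.
rewrite /PZ /PZs !derivD !derivC !add0r !dX -/PZ -/PZs.
rewrite horner_ptM hornerD !horner_ptM !hornerC PZE PZsE.
by rewrite -!scalerAl -scalerAr !mul1r mulr1.
Qed.

(** The truncated series of - tr log of star (a + t z) (a + t z) / L, as a
    polynomial in the real parameter t of the segment from a to a + z. *)
Definition trace_log_poly : {poly R} :=
  \sum_(n < N) n.+1%:R^-1 *: trpoly (PU ^+ n.+1).

Lemma horner_trace_log_poly t :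
  trace_log_poly.[t] = Re_tr (real_horner
    ((L^-1)%:C *: (star (shift (z_t t)) * shift (z_t t))) (log_poly N)).
Proof.
rewrite /trace_log_poly /log_poly horner_sum rmorph_sum raddf_sum /=.
apply: eq_bigr => n _; rewrite hornerZ real_hornerZ Re_trZ; congr (_ * _).
rewrite horner_trpoly horner_ptX PUE rmorphXn rmorphB rmorph1 /=.
by rewrite real_hornerX.
Qed.

(** The derivative of star (a + t z) (a + t z) has two terms that are adjoint to
    each other up to cyclicity, which gives twice a real part. *)
Lemma deriv_trace_log_poly t : trace_log_poly^`().[t] =
  - (2 * complex.Re (z * tr (approx_inverse (shift (z_t t)) C N))).
Proof.
set Zt := shift (z_t t).
have -> : trace_log_poly^`().[t] = Re_tr ((\sum_(n < N) landweber Zt C ^+ n) * PU^`().[pt t]).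
  rewrite /trace_log_poly raddf_sum horner_sum mulr_suml raddf_sum /=.
  apply: eq_bigr => n _; rewrite derivZ hornerZ deriv_trpoly horner_trpoly.
  by rewrite Re_tr_deriv_exp PUE mulrA mulVf ?mul1r // pnatr_eq0.
rewrite derivPU -/Zt mulrN -scalerAr scalerAl -/(neumann Zt C N).
have -> : neumann Zt C N * (conjc z *: Zt + z *: star Zt) =
   conjc z *: (neumann Zt C N * Zt) + z *: approx_inverse Zt C N.
  by rewrite mulrDr -!scalerAr.
rewrite raddfN raddfD /=; congr (- _); rewrite mulr_natl mulr2n.
rewrite /Re_tr !linearZ /= /approx_inverse; congr (_ + _).
have -> : tr (neumann Zt C N * Zt) = conjc (tr (neumann Zt C N * star Zt)).
  by rewrite -tr_star starM starK star_neumann trC.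
by case: (tr _) z => [? ?] [? ?] /=; ring.
Qed.

Definition expansion_coef (j : nat) : R[i] :=
  (-1) ^+ j * tr (Y N ^+ j.+1) / j.+1%:R.

Let harm_poly : {poly R} :=
  \sum_(j < N) (2 * complex.Re (expansion_coef j * z ^+ j.+1)) *: 'X ^+ j.+1.

Let deriv_harm_poly t : harm_poly^`().[t] =
  2 * complex.Re (z * tr (resolvent_series N (z_t t))).
Proof.
rewrite /harm_poly raddf_sum horner_sum /resolvent_series linear_sum /= mulr_sumr.
rewrite Re_sum mulr_sumr; apply: eq_bigr => j _.
rewrite derivZ hornerZ derivXn hornerMn hornerXn linearZ /= -mulrA; congr (2 * _).
rewrite /expansion_coef /z_t; set y := tr _.
have -> : (-1) ^+ j * y / j.+1%:R * z ^+ j.+1 =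
   (j.+1%:R^-1 : R)%:C * (z * ((-1) ^+ j * z ^+ j * y)).
  by rewrite fmorphV rmorph_nat exprS; ring.
have -> : z * ((- (t%:C * z)) ^+ j * y) =
  (t ^+ j)%:C * (z * ((-1) ^+ j * z ^+ j * y)).
  have -> : (t ^+ j)%:C = t%:C ^+ j by rewrite -[RHS]rmorphXn.
  by rewrite (exprNn (t%:C * z)) (exprMn _ t%:C); ring.
case: (z * _) => x x' /=; rewrite !mul0r !subr0 -mulr_natl.
have : j.+1%:R != 0 :> R by rewrite pnatr_eq0.
by move=> h; field.
Qed.

(** The derivatives along the segment of both polynomials are traces of
    approximate inverses, so the mean value theorem compares their increments. *)
Lemma trace_log_poly_approx : cabs z <= expansion_radius ->
  `|trace_log_poly.[1] - trace_log_poly.[0] +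
    2 * complex.Re (\sum_(j < N) expansion_coef j * z ^+ j.+1)| <=
  2 * expansion_radius * err N.
Proof.
move=> zr.
have [t tI] := poly_mvt (trace_log_poly + harm_poly) (@ltr01 R).
rewrite subr0 mulr1 derivD !hornerD => mvtE.
have h0 : harm_poly.[0] = 0.
  rewrite /harm_poly horner_sum big1 // => j _.
  by rewrite hornerZ hornerXn expr0n mulr0.
have h1 : harm_poly.[1] = 2 * complex.Re (\sum_(j < N) expansion_coef j * z ^+ j.+1).
  rewrite /harm_poly horner_sum.
  rewrite Re_sum mulr_sumr; apply: eq_bigr => j _.
  by rewrite hornerZ hornerXn expr1n mulr1.
have -> : trace_log_poly.[1] - trace_log_poly.[0] +
    2 * complex.Re (\sum_(j < N) expansion_coef j * z ^+ j.+1) =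
  (trace_log_poly^`()).[t] + harm_poly^`().[t].
  by rewrite -mvtE h0 h1; ring.
rewrite deriv_trace_log_poly deriv_harm_poly.
move: tI; rewrite in_itv /= => /andP[t0 t1].
have zt : cabs (z_t t) <= expansion_radius.
  rewrite /z_t cabsM cabs_real ?(ltW t0) //; apply: le_trans zr.
  by rewrite ler_piMl ?cabs_ge0 // ltW.
have eb := approx_inverse_resolvent N zt.
have er0 : 0 <= err N.
  have /andP[k0 _] := k01.
  by rewrite /err mulr_ge0 ?(ltW cY0) // !addr_ge0 // ?mulr_ge0 ?divr_ge0 ?exprn_ge0 ?invr_ge0 // ltW.
have := Re_tr_scale_le z er0 eb; rewrite linearB /= mulrBr.
have -> : complex.Re (z * tr (approx_inverse (shift (z_t t)) C N) -
    z * tr (resolvent_series N (z_t t))) =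
  complex.Re (z * tr (approx_inverse (shift (z_t t)) C N)) -
  complex.Re (z * tr (resolvent_series N (z_t t))).
  by case: (z * _) (z * tr (resolvent_series _ _)) => [? ?] [? ?].
set p := complex.Re _; set q := complex.Re _ => h.
have -> : - (2 * p) + 2 * q = - (2 * (p - q)) by ring.
rewrite normrN normrM ger0_norm // -mulrA ler_pM2l //.
by apply: le_trans h _; rewrite ler_wpM2r.
Qed.

End Ray.

Let full_err N : R :=
  k ^+ N / (landweber_rate e C) / 2 + expansion_radius * err N.

Let cvg_full_err : full_err @ \oo --> 0.
Proof.
have /andP[k0 k1] := k01.
have kX : (fun N => k ^+ N) @ \oo --> (0 : R).
  by apply: cvg_expr; rewrite ger0_norm // ltW.
have hX : (fun N => (2^-1 : R) ^+ N) @ \oo --> (0 : R).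
  by apply: cvg_expr; rewrite ger0_norm ?invr_ge0 // invf_lt1 // ltr1n.
have -> : full_err = (fun N =>
    ((landweber_rate e C)^-1 / 2 + expansion_radius * cY * (2 + 2 * (C / e))) * k ^+ N +
    (expansion_radius * cY) * 2^-1 ^+ N).
  by apply/funext => N; rewrite /full_err /err; ring.
rewrite -[X in _ --> X]addr0; apply: cvgD.
  by rewrite -[X in _ --> X](mulr0 ((landweber_rate e C)^-1 / 2 +
    expansion_radius * cY * (2 + 2 * (C / e)))); apply: cvgMl_tmp.
by rewrite -[X in _ --> X](mulr0 (expansion_radius * cY)); apply: cvgMl_tmp.
Qed.

(** The truncations of the logarithm of the determinant have increments close to
    those of polynomials in z, with an error that tends to 0 uniformly in z. *)
Theorem log_determinant_expansion :
  exists g : nat -> R, exists c : nat -> nat -> R[i], exists2 er : nat -> R,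
    er @ \oo --> 0 &
    forall z d, cabs z <= expansion_radius -> fuglede_kadison ip M tau (shift z) d ->
    exists l : R, lne d = l%:E /\
      forall N, `|l - (g N + complex.Re (\sum_(j < N) c N j * z ^+ j.+1))| <= er N.
Proof.
pose g N := (ln L - Re_tr (real_horner ((L^-1)%:C *: (star a * a)) (log_poly N))) / 2.
exists g, expansion_coef, full_err; first exact: cvg_full_err.
move=> z d zr fk; have zr0 : cabs z <= r0 by move: zr; rewrite le_min => /andP[].
have L0 : 0 < L by exact: landweber_cst_gt0 e0 eC.
have bb u : e ^+ 2 * hnorm u ^+ 2 <= hnorm (shift z u) ^+ 2 <= L / 2 * hnorm u ^+ 2.
  have -> : L / 2 = C ^+ 2 by rewrite /L /landweber_cst; field.
  rewrite -!exprMn !ler_sqr ?nnegrE ?hnorm_ge0 ?mulr_ge0 ?hnorm_ge0 ?(ltW e0) ?(ltW C0) //.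
  by rewrite below // above.
have [l [dl lN]] := fuglede_kadison_series (exprn_gt0 2 e0) L0 bb fk.
exists l; split => // N.
have := lN N; have := trace_log_poly_approx N zr.
rewrite !horner_trace_log_poly mul1r mul0r shift0 -/L.
rewrite -/(landweber_rate e C) -/k.
rewrite /g /full_err -/(Re_tr _).
set A1 := Re_tr _; set A0 := Re_tr _; set S := complex.Re _; set rt := k ^+ N / _.
rewrite !ler_norml => /andP[h1 h2] /andP[h3 h4].
by apply/andP; split; lra.
Qed.

End LogDeterminantExpansion.

(** * The resolvent off the hyperbola *)

Section TwoProjections.
Context {R : realType} {H : completeNormedModType R[i]}.
Context {ip : {dot H for Num.conj}}.
Context {M : set (H -> H)} {tau : (H -> H) -> R[i]}.
Context {hM : tracial_vna ip M tau}.
Local Notation A := (opalg hM).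
Implicit Types (a b : A) (t : R) (w : R[i]).

Let ipN : inner_product_norm ip. Proof. by case: hM. Qed.

Lemma bounded_below_shift a (e r : R) w : bounded_below a e -> cabs w <= r ->
  bounded_below (a + w *: 1) (e - r).
Proof.
move=> ae wr u; have := ae u.
have : hnorm (a u) <= hnorm ((a + w *: 1) u) + hnorm (- (w *: u)).
  apply: le_trans (hnorm_triangle _ _).
  by rewrite opDE opZE op1E addrK.
rewrite hnorm_opp hnormZ -/(cabs w).
have := ler_wpM2r (hnorm_ge0 u) wr; rewrite mulrBl; lra.
Qed.

Lemma bounded_below_factor a b (m K : R) : 0 < K -> bnd b K ->
  bounded_below (b * a) m -> bounded_below a (m / K).
Proof.
move=> K0 bK bam u; rewrite mulrAC ler_pdivrMr // [leRHS]mulrC.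
by apply: le_trans (bam u) _; rewrite opME.
Qed.

Lemma hnorm_sqr_cartesian a t u : star a = a ->
  hnorm ((t%:C *: 1 + 'i *: a) u) ^+ 2 = t ^+ 2 * hnorm u ^+ 2 + hnorm (a u) ^+ 2.
Proof.
move=> sa; rewrite opDE !opZE op1E (hnorm_sqrD ipN) !hnormZ.
have -> : complex.Re `|'i : R[i]| = 1 by rewrite normc_def /= expr0n expr1n add0r sqrtr1.
have -> : complex.Re `|t%:C| = `|t|.
  by rewrite normc_def /= expr0n addr0 sqrtr_sqr.
rewrite mul1r exprMn real_normK ?num_real // ipZl ipZr.
have : conjc (ip u (a u)) = ip u (a u) by rewrite -(ipC ip) -[in RHS]sa -starP.
case: (ip u (a u)) => x y [] /eqP; rewrite -subr_eq0 -opprD oppr_eq0.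
rewrite -mulr2n mulrn_eq0 /= => /eqP ->.
by ring.
Qed.

(** Self-adjointness of b removes the cross terms in the square of the norm. *)
Lemma bounded_below_cartesian b (x y K : R) : star b = b -> bnd b K ->
  bounded_below (x%:C *: 1 + 'i *: (y%:C *: 1 - b)) (Num.max `|x| (`|y| - K)).
Proof.
move=> sb bK u.
have sD : star (y%:C *: 1 - b) = y%:C *: 1 - b by rewrite starB starZ star1 conjc_real sb.
rewrite maxr_pMl ?hnorm_ge0 // ge_max; apply/andP; split.
  rewrite -ler_sqr ?nnegrE ?mulr_ge0 ?hnorm_ge0 // hnorm_sqr_cartesian // exprMn.
  by rewrite real_normK ?num_real // lerDl sqr_ge0.
apply: (@le_trans _ _ (hnorm ((y%:C *: 1 - b) u))).
  have : hnorm (y%:C *: u) <= hnorm ((y%:C *: 1 - b) u) + hnorm (b u).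
    apply: le_trans (hnorm_triangle _ _).
    by rewrite opDE opZE op1E opNE subrK.
  rewrite hnormZ; have -> : complex.Re `|y%:C| = `|y|.
    by rewrite normc_def /= expr0n addr0 sqrtr_sqr.
  by have := bK u; rewrite mulrBl; lra.
rewrite -ler_sqr ?nnegrE ?hnorm_ge0 // hnorm_sqr_cartesian //.
by rewrite lerDr mulr_ge0 ?sqr_ge0.
Qed.

Lemma sqr_cartesian a b : (a + 'i *: b) ^+ 2 = a ^+ 2 - b ^+ 2 + 'i *: (a * b + b * a).
Proof.
rewrite expr2 mulrDl !mulrDr -!scalerAl -!scalerAr scalerA.
have -> : 'i * 'i = -1 :> R[i] by rewrite -expr2 sqr_i.
by rewrite scaleN1r -!expr2 scalerDr -!addrA; congr (_ + _); rewrite addrA addrC.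
Qed.

Lemma scalar_sqr_diff a w : (w *: 1 + a) * (w *: 1 - a) = w ^+ 2 *: 1 - a ^+ 2.
Proof.
have comm : (w *: 1) * a = a * (w *: 1) by rewrite -scalerAl -scalerAr mul1r mulr1.
by rewrite mulrDl !mulrBr comm addrA subrK -!expr2 exprZn expr1n.
Qed.

Lemma scalar_sqr_diffC a w : (w *: 1 - a) * (w *: 1 + a) = (w *: 1 + a) * (w *: 1 - a).
Proof. by have := scalar_sqr_diff (- a) w; rewrite opprK sqrrN scalar_sqr_diff. Qed.

Variables (p q : A) (al al' be be' : R).
Hypotheses (sp : star p = p) (sq : star q = q).
Hypotheses (nal : al != al') (nbe : be != be').
Hypothesis p2 : (p - al%:C *: 1) * (p - al'%:C *: 1) = 0.
Hypothesis q2 : (q - be%:C *: 1) * (q - be'%:C *: 1) = 0.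

Lemma centered_sqr b (x x' : R) : (b - x%:C *: 1) * (b - x'%:C *: 1) = 0 ->
  (b - ((x + x') / 2)%:C *: 1) ^+ 2 = ((x' - x) ^+ 2 / 4)%:C *: 1.
Proof.
set b0 := b - ((x + x') / 2)%:C *: 1 => h.
have h1 : b - x%:C *: 1 = b0 + ((x' - x) / 2)%:C *: 1.
  rewrite /b0 -addrA; congr (_ + _); rewrite -!scaleNr -scalerDl -!rmorphN -rmorphD.
  by congr (_%:C *: _); field.
have h2 : b - x'%:C *: 1 = b0 - ((x' - x) / 2)%:C *: 1.
  rewrite /b0 -addrA; congr (_ + _); rewrite -!scaleNr -scalerDl -!rmorphN -rmorphD.
  by congr (_%:C *: _); field.
move: h; rewrite h1 h2; clear h1 h2; clearbody b0; set s := _ *: 1.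
have -> : (b0 + s) * (b0 - s) = b0 ^+ 2 - s ^+ 2.
  have sb : s * b0 = b0 * s by rewrite /s -scalerAl -scalerAr mul1r mulr1.
  by rewrite mulrDl !mulrBr sb addrA subrK.
move/eqP; rewrite subr_eq0 => /eqP ->.
rewrite /s exprZn expr1n -rmorphXn /=; congr (_%:C *: _).
by field.
Qed.

Let A' := al' - al.
Let B' := be' - be.
Let p0 := p - ((al + al') / 2)%:C *: 1.
Let q0 := q - ((be + be') / 2)%:C *: 1.
Let X0 := p0 + 'i *: q0.
Let S := p0 * q0 + q0 * p0.

Let sp0 : star p0 = p0. Proof. by rewrite /p0 starB starZ star1 conjc_real sp. Qed.
Let sq0 : star q0 = q0. Proof. by rewrite /q0 starB starZ star1 conjc_real sq. Qed.
Let sS : star S = S. Proof. by rewrite /S starD !starM sp0 sq0 addrC. Qed.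

Lemma bnd_of_sqr b (x : R) : star b = b -> b ^+ 2 = (x ^+ 2 / 4)%:C *: 1 -> bnd b (`|x| / 2).
Proof.
move=> sb b2 u; rewrite -ler_sqr ?nnegrE ?mulr_ge0 ?hnorm_ge0 ?divr_ge0 //.
rewrite -Re_ip_star_mul sb -expr2 b2 opZE op1E ipZl ip_hnorm // -rmorphM /=.
by rewrite !exprMn real_normK ?num_real // le_eqVlt; apply/orP; left; apply/eqP; field.
Qed.

Let bp : bnd p0 (`|A'| / 2). Proof. by apply: bnd_of_sqr => //; exact: centered_sqr. Qed.
Let bq : bnd q0 (`|B'| / 2). Proof. by apply: bnd_of_sqr => //; exact: centered_sqr. Qed.

Let bS : bnd S (`|A' * B'| / 2).
Proof.
have -> : `|A' * B'| / 2 = `|A'| / 2 * (`|B'| / 2) + `|B'| / 2 * (`|A'| / 2).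
  by rewrite normrM; field.
by apply: bndD; apply: bndM => //; rewrite divr_ge0.
Qed.

(** The square of the centred operator is normal: its anticommutator part S is
    self-adjoint. *)
Lemma centered_factor w :
  (w *: 1 + X0) * (w *: 1 - X0) =
  (w ^+ 2 - ((A' ^+ 2 - B' ^+ 2) / 4)%:C) *: 1 - 'i *: S.
Proof.
rewrite scalar_sqr_diff sqr_cartesian !centered_sqr // opprD addrA; congr (_ - _).
rewrite scalerBl; congr (_ - _); rewrite -scalerBl -rmorphB /=.
by rewrite mulrBl.
Qed.

Lemma Re_Im_cartesian w b :
  w *: 1 - 'i *: b = (complex.Re w)%:C *: 1 + 'i *: ((complex.Im w)%:C *: 1 - b).
Proof.
by rewrite scalerBr addrA scalerA -scalerDl -complexE.
Qed.

Let HR := hyperbola al al' be be' `&` rectangle al al' be be'.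

(** The product of z - X0 with its companion z + X0 is the normal operator
    W - i S, and W is on the segment i [-|AB|/2, |AB|/2] only if z is in H and R. *)
Lemma resolvent_bounded_below (z : R[i]) : ~ HR z ->
  exists e : R, [/\ 0 < e, bounded_below (z *: 1 - (p + 'i *: q)) e &
                    bounded_below (star (z *: 1 - (p + 'i *: q))) e].
Proof.
move=> zHR; pose w := z - Defs.center al al' be be'.
have -> : z *: 1 - (p + 'i *: q) = w *: 1 - X0.
  rewrite /w /X0 /p0 /q0 /Defs.center.
  have -> : ((al + al') / 2 +i* ((be + be') / 2)) =
    ((al + al') / 2)%:C + 'i * ((be + be') / 2)%:C :> R[i] by rewrite [LHS]complexE.
  rewrite scalerBl scalerDl scalerBr scalerA (addrACA p) -opprD opprB.
  by rewrite addrA subrK.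
pose W := w ^+ 2 - ((A' ^+ 2 - B' ^+ 2) / 4)%:C.
pose m := Num.max `|complex.Re W| (`|complex.Im W| - `|A' * B'| / 2).
have m0 : 0 < m.
  rewrite ltNge; apply/negP; rewrite ge_max normr_le0 subr_le0 => /andP[/eqP W1 W2].
  apply: zHR; move: W1 W2; rewrite /HR /W /w /Defs.center /A' /B'.
  case: z {w W m} => zx zy; rewrite expr2 /= in_rectangle /hyperbola /=.
  move: (zx - _) (zy - _) => x y; rewrite subr0 => W1 W2.
  have h : x ^+ 2 - y ^+ 2 = ((al' - al) ^+ 2 - (be' - be) ^+ 2) / 4 by lra.
  have h2 : 16 * (x ^+ 2 * y ^+ 2) <= (al' - al) ^+ 2 * (be' - be) ^+ 2.
    have : (2 * `|x * y + y * x|) ^+ 2 <= `|(al' - al) * (be' - be)| ^+ 2.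
      by rewrite ler_sqr ?nnegrE ?mulr_ge0 //; lra.
    rewrite exprMn !real_normK ?num_real // exprMn; apply: le_trans.
    by rewrite le_eqVlt; apply/orP; left; apply/eqP; ring.
  have A0 : 0 < (al' - al) ^+ 2 by rewrite exprn_even_gt0 //= subr_eq0 eq_sym.
  have B0 : 0 < (be' - be) ^+ 2 by rewrite exprn_even_gt0 //= subr_eq0 eq_sym.
  have hx : x ^+ 2 <= (al' - al) ^+ 2 / 4.
    by have := sqr_ge0 x; have := sqr_ge0 y; nra.
  by split=> //; split=> //; lra.
have [K [K0 KX1 KX2]] : exists K : R, [/\ 0 < K, bnd (w *: 1 + X0) K &
    bnd (star (w *: 1 + X0)) K].
  have [K K0 KX] := bnd_exists (w *: 1 + X0).
  exists (K + 1).
  have KX' : bnd (w *: 1 + X0) (K + 1) by apply: bnd_le KX; rewrite lerDl.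
  by split; rewrite ?ltr_wpDl //; apply: bnd_star => //; rewrite addr_ge0.
exists (m / K); split; first exact: divr_gt0.
  apply: (bounded_below_factor K0 KX1); rewrite centered_factor -/W Re_Im_cartesian.
  exact: bounded_below_cartesian.
apply: (bounded_below_factor K0 KX2); rewrite -starM.
rewrite scalar_sqr_diffC centered_factor -/W starB !starZ star1 sS.
have -> : conjc W *: 1 - conjc 'i *: S = conjc W *: 1 - 'i *: (- S) :> A.
  by rewrite scalerN -scaleNr; congr (_ - _ *: _); rewrite /= -[RHS]/(_ +i* _) oppr0.
rewrite Re_Im_cartesian.
have -> : m = Num.max `|complex.Re (conjc W)| (`|complex.Im (conjc W)| - `|A' * B'| / 2).
  by rewrite /m; case: (W) => x y /=; rewrite normrN.
by apply: bounded_below_cartesian; [rewrite starN sS|exact: bndN].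
Qed.

End TwoProjections.

(** * Bump functions and weak harmonicity *)

Section FlatFunctions.
Context {R : realType}.
Implicit Types (p q : {poly R}) (t x : R).

(** The functions p(1/t) exp(-1/t), extended by 0 to t <= 0: a class of flat
    functions stable under differentiation. *)
Definition flat p t : R := if 0 < t then p.[t^-1] * expR (- t^-1) else 0.

Definition dflat p : {poly R} := (p - p^`()) * 'X^2.

Lemma horner_bound p : exists2 K, 0 <= K & forall s, 1 <= s -> `|p.[s]| <= K * s ^+ size p.
Proof.
exists (\sum_(i < size p) `|p`_i|); first exact: sumr_ge0.
move=> s s1; rewrite horner_coef mulr_suml; apply: le_trans (ler_norm_sum _ _ _) _.
apply: ler_sum => i _; rewrite normrM ler_wpM2l // ger0_norm ?exprn_ge0 ?(le_trans _ s1) //.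
by rewrite ler_weXn2l // ltnW.
Qed.

(** The exponential beats the power of 1/t of the next higher degree. *)
Lemma flat_bound p : exists2 K, 0 <= K & forall t, t <= 1 -> `|flat p t| <= K * t ^+ 2.
Proof.
have [K K0 pK] := horner_bound p.
pose n := (size p).+1.
exists (K * (n.+1)`!%:R); first by rewrite mulr_ge0.
move=> t t1; rewrite /flat; case: ltP => t0; last first.
  by rewrite normr0; apply: mulr_ge0; [exact: mulr_ge0|exact: sqr_ge0].
have s1 : 1 <= t^-1 by rewrite -invr1 lef_pV2 ?posrE.
have s0 : 0 < t^-1 by rewrite invr_gt0.
rewrite normrM (ger0_norm (expR_ge0 _)) expRN.
have h1 := pK _ s1.
have h2 : (t^-1) ^+ n.+1 / (n.+1)`!%:R <= expR t^-1.
  by apply: le_trans (expR_ge1Dxn n (ltW s0)); rewrite lerDr.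
have f0 : 0 < (n.+1)`!%:R :> R by rewrite ltr0n fact_gt0.
have h3 : (expR t^-1)^-1 <= (n.+1)`!%:R / (t^-1) ^+ n.+1.
  by rewrite -[leRHS]invrK invf_div lef_pV2 ?posrE ?expR_gt0 // divr_gt0 // exprn_gt0.
apply: le_trans (ler_pM _ _ h1 h3) _; rewrite ?invr_ge0 ?expR_ge0 //.
rewrite le_eqVlt; apply/orP; left; apply/eqP.
rewrite /n !exprS !exprVn !invfM !invrK.
have : t != 0 by rewrite gt_eqF.
have : t ^+ size p != 0 by rewrite expf_neq0 // gt_eqF.
by move=> h4 h5; field; rewrite ?h4 ?h5.
Qed.

Lemma is_derive_quadratic (f : R -> R) x K : 0 <= K ->
  (forall h, `|h| <= 1 -> `|f (x + h) - f x| <= K * h ^+ 2) -> is_derive x 1 f 0.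
Proof.
move=> K0 fK.
have cv : (fun h => h^-1 *: ((f \o shift x) (h *: (1 : R)) - f x)) @ 0^' --> (0 : R).
  apply/cvgrPdist_le => e e0; near=> h.
  have h0 : h != 0 by near: h; exact: nbhs_dnbhs_neq.
  have hb : `|h| <= Num.min 1 (e / (K + 1)).
    near: h; apply: dnbhs0_le; rewrite lt_min ltr01 divr_gt0 // ltr_wpDl //.
  move: hb; rewrite le_min => /andP[h1 h2].
  rewrite sub0r normrN normrM normfV ler_pdivrMl ?normr_gt0 //.
  have -> : (f \o shift x) (h *: (1 : R)) = f (x + h) by rewrite /= [h *: 1]mulr1 addrC.
  apply: le_trans (fK _ h1) _.
  rewrite -[h ^+ 2]real_normK ?num_real // expr2 mulrCA ler_wpM2l //.
  rewrite ler_pdivlMr in h2; last by rewrite ltr_wpDl.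
  by apply: le_trans h2; rewrite mulrC ler_wpM2l // lerDl.
by split; [apply: cvgP cv | apply/cvg_lim: cv].
Unshelve. all: by end_near. Qed.

(** At 0 the quadratic bound gives the derivative; elsewhere the function is
    locally a composition of smooth functions. *)
Lemma is_derive_flat p t : is_derive t 1 (flat p) (flat (dflat p) t).
Proof.
have [t0|t0|->] := ltgtP t 0.
- have -> : flat (dflat p) t = 0 by rewrite /flat ltNge (ltW t0).
  apply: (@near_eq_is_derive _ _ _ (cst (0 : R))).
  near=> s; rewrite /flat ltNge; suff -> : s <= 0 by [].
  by apply: ltW; near: s; exact: lt_nbhsl.
- have tN0 : t != 0 by rewrite gt_eqF.
  have d1 := is_deriveV tN0 (is_derive_id t 1).
  apply: (@near_eq_is_derive _ _ _ (fun s => (horner p \o GRing.inv) s * (expR \o (fun s => - s^-1)) s)).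
    by near=> s; rewrite /flat; have -> : 0 < s by near: s; exact: lt_nbhsr.
  have d2 := is_derive1_comp (is_derive_poly p t^-1) d1.
  have d1' : is_derive t 1 (fun s : R => - s^-1) _ := is_deriveN d1.
  have d3 := @is_derive1_comp R expR (fun s => - s^-1) t _ _ (is_derive_expR _) d1'.
  apply: (is_derive_eq (is_deriveM d2 d3)).
  rewrite /flat t0 /dflat hornerM hornerXn hornerD hornerN /=.
  by rewrite /GRing.scale /= -exprVn; ring.
- have [K K0 fK] := flat_bound p.
  have -> : flat (dflat p) 0 = 0 by rewrite /flat ltxx.
  apply: (is_derive_quadratic K0) => h h1.
  rewrite add0r [flat p 0]/flat ltxx subr0; apply: fK.
  by apply: le_trans h1; exact: ler_norm.
Unshelve. all: by end_near. Qed.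

End FlatFunctions.

Section Bump.
Context {R : realType}.
Variables (c r : R).
Implicit Types (s : seq ({poly R} * {poly R})) (t : R).

Definition bump_eval s t : R :=
  \sum_(pq <- s) flat pq.1 (r + (t - c)) * flat pq.2 (r - (t - c)).

(** Leibniz rule on formal sums of products of two flat functions. *)
Definition dbump s : seq ({poly R} * {poly R}) :=
  flatten [seq [:: (dflat pq.1, pq.2); (- pq.1, dflat pq.2)] | pq <- s].

(** The successive derivatives of a smooth bump supported by [c - r, c + r]. *)
Definition bump n : R -> R := bump_eval (iter n dbump [:: (1, 1)]).

Lemma flatN (p : {poly R}) t : flat (- p) t = - flat p t.
Proof. by rewrite /flat; case: ifP => _; rewrite ?oppr0 // hornerN mulNr. Qed.

Lemma is_derive_bump_eval s t : is_derive t 1 (bump_eval s) (bump_eval (dbump s) t).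
Proof.
elim: s => [|[p q] s IH].
  have -> : bump_eval [::] = cst 0 by apply/funext => u; rewrite /bump_eval big_nil.
  exact: is_derive_cst.
have -> : bump_eval ((p, q) :: s) = (fun u =>
    (flat p \o (fun u => r + (u - c))) u * (flat q \o (fun u => r - (u - c))) u
    + bump_eval s u).
  by apply/funext => u; rewrite /bump_eval big_cons.
have dl : is_derive t 1 (fun u : R => r + (u - c)) 1.
  have -> : (fun u : R => r + (u - c)) = (fun u => u + (r - c)) by apply/funext => u; ring.
  by apply: (is_derive_eq (is_deriveD (is_derive_id t 1) (is_derive_cst (r - c) t 1))); rewrite addr0.
have dr : is_derive t 1 (fun u : R => r - (u - c)) (- 1).
  have -> : (fun u : R => r - (u - c)) = (fun u => - u + (r + c)) by apply/funext => u; ring.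
  by apply: (is_derive_eq (is_deriveD (is_deriveN (is_derive_id t 1)) (is_derive_cst (r + c) t 1))); rewrite addr0.
have d1 := @is_derive1_comp R (flat p) (fun u => r + (u - c)) t _ _ (is_derive_flat p _) dl.
have d2 := @is_derive1_comp R (flat q) (fun u => r - (u - c)) t _ _ (is_derive_flat q _) dr.
apply: (is_derive_eq (is_deriveD (is_deriveM d1 d2) IH)).
rewrite /bump_eval /dbump /= !big_cons /= flatN /GRing.scale /=.
by rewrite /bump_eval /dbump; ring.
Qed.

Lemma is_derive_bump n t : is_derive t 1 (bump n) (bump n.+1 t).
Proof. exact: is_derive_bump_eval. Qed.

Lemma continuous_bump n : continuous (bump n).
Proof.
move=> t; apply/differentiable_continuous/derivable1_diffP.
by have [] := is_derive_bump n t.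
Qed.

Lemma bump_out n t : r <= `|t - c| -> bump n t = 0.
Proof.
move=> h; rewrite /bump /bump_eval big1 // => pq _.
move: h; rewrite ler_normr /flat => /orP[h|h].
  by rewrite [X in _ * X]ifF ?mulr0 //; apply/negbTE; rewrite -leNgt; lra.
by rewrite [X in X * _]ifF ?mul0r //; apply/negbTE; rewrite -leNgt; lra.
Qed.

Lemma bump0E t : bump 0 t = flat 1 (r + (t - c)) * flat 1 (r - (t - c)).
Proof. by rewrite /bump /bump_eval big_seq1. Qed.

Lemma bump_ge0 t : 0 <= bump 0 t.
Proof.
have f0 u : 0 <= flat (1 : {poly R}) u.
  by rewrite /flat; case: ifP => // _; rewrite hornerC mul1r expR_ge0.
by rewrite bump0E mulr_ge0.
Qed.

Lemma bump_gt0 t : `|t - c| < r -> 0 < bump 0 t.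
Proof.
rewrite ltr_norml => /andP[h1 h2].
have h3 : 0 < r + (t - c) by lra.
have h4 : 0 < r - (t - c) by lra.
by rewrite bump0E /flat h3 h4 !hornerC !mul1r mulr_gt0 // expR_gt0.
Qed.

Lemma bump_bounded n : r <= 2^-1 -> exists2 K, 0 <= K & forall t, `|bump n t| <= K.
Proof.
move=> r2.
have h s : exists2 K, 0 <= K & forall t, `|t - c| < r -> `|bump_eval s t| <= K.
  elim: s => [|[p q] s [K K0 sK]].
    by exists 0 => // t _; rewrite /bump_eval big_nil normr0.
  have [Kp Kp0 pK] := flat_bound p.
  have [Kq Kq0 qK] := flat_bound q.
  exists (Kp * Kq + K); first by rewrite addr_ge0 ?mulr_ge0.
  move=> t tr; rewrite /bump_eval big_cons; apply: le_trans (ler_normD _ _) _.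
  apply: lerD; last exact: sK.
  move: (tr); rewrite ltr_norml => /andP[h1 h2]; rewrite normrM.
  have b (K' a : R) : 0 <= K' -> 0 < a -> a <= 1 -> K' * a ^+ 2 <= K'.
    by move=> k0 a0 a1; rewrite ler_piMr // exprn_ile1 // ltW.
  apply: ler_pM => //=.
    by apply: le_trans (pK _ _) _; [lra|apply: b => //; lra].
  by apply: le_trans (qK _ _) _; [lra|apply: b => //; lra].
have [K K0 sK] := h (iter n dbump [:: (1, 1)]).
exists K => // t; case: (ltP `|t - c| r) => [/sK //|/(bump_out n) ->].
by rewrite normr0.
Qed.

End Bump.

Section TensorBump.
Context {R : realType}.
Variables (c1 c2 r : R).
Implicit Types (z : R * R) (m n : nat).

Definition bump2 m n z : R := bump c1 r m z.1 * bump c2 r n z.2.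

Lemma is_derive_bump2 (b : bool) m n z :
  is_derive z (axis b) (bump2 m n) (bump2 (~~ b + m) (b + n) z).
Proof.
case: b; rewrite /axis /bump2 /= ?add0n ?add1n.
- have [dv dE] : is_derive z.2 1 (fun u => bump c1 r m z.1 * bump c2 r n u)
      (bump c1 r m z.1 * bump c2 r n.+1 z.2).
    apply: (is_derive_eq (is_deriveZ (bump c1 r m z.1) (is_derive_bump c2 r n z.2))).
    by [].
  have E : (fun h : R => h^-1 *: ((bump2 m n \o shift z) (h *: ((0, 1) : R * R)) - bump2 m n z)) =
    (fun h => h^-1 *: (((fun u => bump c1 r m z.1 * bump c2 r n u) \o shift z.2) (h *: (1 : R)) - bump c1 r m z.1 * bump c2 r n z.2)).
    by apply/funext => h; rewrite /bump2 /= [h *: 0]mulr0 add0r.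
  by split; rewrite /derivable /derive E.
- have [dv dE] : is_derive z.1 1 (fun u => bump c2 r n z.2 * bump c1 r m u)
      (bump c2 r n z.2 * bump c1 r m.+1 z.1).
    apply: (is_derive_eq (is_deriveZ (bump c2 r n z.2) (is_derive_bump c1 r m z.1))).
    by [].
  have E : (fun h : R => h^-1 *: ((bump2 m n \o shift z) (h *: ((1, 0) : R * R)) - bump2 m n z)) =
    (fun h => h^-1 *: (((fun u => bump c2 r n z.2 * bump c1 r m u) \o shift z.1) (h *: (1 : R)) - bump c2 r n z.2 * bump c1 r m z.1)).
    by apply/funext => h; rewrite /bump2 /= [h *: 0]mulr0 add0r ![_ * bump c1 _ _ _]mulrC.
  by split; rewrite /derivable /derive E // [RHS]mulrC.
Qed.

Lemma partial_bump2 b m n : partial b (bump2 m n) = bump2 (~~ b + m) (b + n).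
Proof. by apply/funext => z; rewrite /partial; have [_ ->] := is_derive_bump2 b m n z. Qed.

Lemma partials_bump2 s : exists m n, partials s (bump2 0 0) = bump2 m n.
Proof.
elim: s => [|b s [m [n IH]]]; first by exists 0%N, 0%N.
by rewrite /= IH partial_bump2; eexists; eexists.
Qed.

Lemma continuous_bump2 m n : continuous (bump2 m n).
Proof.
move=> z; apply: cvgM.
  apply: (@continuous_comp _ _ _ fst (bump c1 r m)); first exact: cvg_fst.
  exact: continuous_bump.
apply: (@continuous_comp _ _ _ snd (bump c2 r n)); first exact: cvg_snd.
exact: continuous_bump.
Qed.

Definition square : set (R * R) := `[c1 - r, c1 + r] `*` `[c2 - r, c2 + r].

Lemma bump2_out m n z : ~ square z -> bump2 m n z = 0.
Proof.
move=> h; rewrite /bump2; have [h1|h1] := leP r `|z.1 - c1|.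
  by rewrite bump_out // mul0r.
have [h2|h2] := leP r `|z.2 - c2|; first by rewrite (bump_out _ h2) mulr0.
case: h; move: h1 h2; rewrite !ltr_norml => /andP[? ?] /andP[? ?].
by split; rewrite /= in_itv /=; apply/andP; split; lra.
Qed.

Lemma test_function_bump2 : test_function (bump2 0 0).
Proof.
split=> [s|].
  have [m [n ->]] := partials_bump2 s; split; first exact: continuous_bump2.
  by move=> b z; have [] := is_derive_bump2 b m n z.
have csq : compact square by apply: compact_setX; exact: segment_compact.
apply: (subclosed_compact _ csq); first exact: closed_closure.
rewrite [X in _ `<=` X](closure_id square).1; last first.
  by apply: compact_closed => //; exact: norm_hausdorff.
by apply: closure_subset => z /= /eqP h; apply: contrapT => /(bump2_out 0 0).
Qed.

Lemma laplacian_bump2 z : laplacian (bump2 0 0) z = bump2 2 0 z + bump2 0 2 z.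
Proof. by rewrite /laplacian /partials /= !partial_bump2. Qed.

End TensorBump.

Section HarmonicPolynomials.
Context {R : realType}.
Implicit Types (Q : {poly R[i]}) (x y : R) (z : R * R).

(** The Cauchy-Riemann equations. *)
Lemma is_derive_complex_horner Q x y :
  [/\ is_derive x 1 (fun u => complex.Re Q.[u +i* y]) (complex.Re Q^`().[x +i* y]),
      is_derive x 1 (fun u => complex.Im Q.[u +i* y]) (complex.Im Q^`().[x +i* y]),
      is_derive y 1 (fun u => complex.Re Q.[x +i* u]) (- complex.Im Q^`().[x +i* y]) &
      is_derive y 1 (fun u => complex.Im Q.[x +i* u]) (complex.Re Q^`().[x +i* y])].
Proof.
elim/poly_ind: Q => [|Q c [d1 d2 d3 d4]].
  rewrite deriv0.
  split; rewrite horner0 ?oppr0;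
    rewrite (_ : (fun _ => _) = cst 0); try (by apply/funext => u; rewrite horner0);
    exact: is_derive_cst.
have ReE u v : complex.Re (Q * 'X + c%:P).[u +i* v] =
    complex.Re Q.[u +i* v] * u - complex.Im Q.[u +i* v] * v + complex.Re c.
  by rewrite hornerMXaddC; case: (Q.[_]) (c) => [? ?] [? ?] /=.
have ImE u v : complex.Im (Q * 'X + c%:P).[u +i* v] =
    complex.Re Q.[u +i* v] * v + complex.Im Q.[u +i* v] * u + complex.Im c.
  by rewrite hornerMXaddC; case: (Q.[_]) (c) => [? ?] [? ?] /=.
have dE : (Q * 'X + c%:P)^`().[x +i* y] = Q.[x +i* y] + Q^`().[x +i* y] * (x +i* y).
  by rewrite derivMXaddC hornerD hornerMX.
have idx := is_derive_id x (1 : R); have idy := is_derive_id y (1 : R).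
rewrite dE; move: d1 d2 d3 d4.
set q' := Q^`().[_]; set q := Q.[_] => d1 d2 d3 d4.
split.
- under eq_fun do rewrite ReE.
  have D := is_deriveD (is_deriveB (is_deriveM d1 idx) (is_deriveM d2 (is_derive_cst y x 1)))
    (is_derive_cst (complex.Re c) x 1).
  apply: (is_derive_eq D); rewrite /= -/q /GRing.scale /=.
  by case: (q) (q') => [? ?] [? ?] /=; ring.
- under eq_fun do rewrite ImE.
  have D := is_deriveD (is_deriveD (is_deriveM d1 (is_derive_cst y x 1)) (is_deriveM d2 idx))
    (is_derive_cst (complex.Im c) x 1).
  apply: (is_derive_eq D); rewrite /= -/q /GRing.scale /=.
  by case: (q) (q') => [? ?] [? ?] /=; ring.
- under eq_fun do rewrite ReE.
  have D := is_deriveD (is_deriveB (is_deriveM d3 (is_derive_cst x y 1)) (is_deriveM d4 idy))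
    (is_derive_cst (complex.Re c) y 1).
  apply: (is_derive_eq D); rewrite /= -/q /GRing.scale /=.
  by case: (q) (q') => [? ?] [? ?] /=; ring.
- under eq_fun do rewrite ImE.
  have D := is_deriveD (is_deriveD (is_deriveM d3 idy) (is_deriveM d4 (is_derive_cst x y 1)))
    (is_derive_cst (complex.Im c) y 1).
  apply: (is_derive_eq D); rewrite /= -/q /GRing.scale /=.
  by case: (q) (q') => [? ?] [? ?] /=; ring.
Qed.

Lemma complex_horner_bounded Q (K : R) : exists2 B, 0 <= B & forall z,
  `|z.1| <= K -> `|z.2| <= K ->
  `|complex.Re Q.[toC z]| <= B /\ `|complex.Im Q.[toC z]| <= B.
Proof.
elim/poly_ind: Q => [|Q c [B B0 QB]].
  by exists 0 => // z _ _; rewrite horner0 /= normr0.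
exists (2 * (B * `|K|) + (`|complex.Re c| + `|complex.Im c|)).
  by rewrite !addr_ge0 ?mulr_ge0.
move=> [x y] /= xK yK; have [] := QB (x, y) xK yK.
rewrite hornerMXaddC /toC /=; case: (Q.[_]) (c) => [a b] [c' d] /= aB bB.
have h (u v : R) : `|u| <= B -> `|v| <= K -> `|u * v| <= B * `|K|.
  by move=> uB vK; rewrite normrM ler_pM // (le_trans vK) // ler_norm.
have c0 := normr_ge0 c'; have d0 := normr_ge0 d.
split; apply: le_trans (ler_normD _ _) _.
  have := ler_normB (a * x) (b * y); have := h _ _ aB xK; have := h _ _ bB yK; lra.
have := ler_normD (a * y) (b * x); have := h _ _ aB yK; have := h _ _ bB xK; lra.
Qed.

Lemma measurable_complex_horner Q :
  measurable_fun setT (fun z : R * R => complex.Re Q.[toC z]) /\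
  measurable_fun setT (fun z : R * R => complex.Im Q.[toC z]).
Proof.
elim/poly_ind: Q => [|Q c [mRe mIm]].
  by split; rewrite (_ : (fun _ => _) = cst 0); try exact: measurable_cst;
    apply/funext => z; rewrite horner0.
split.
  rewrite (_ : (fun _ => _) = (fun z => (complex.Re Q.[toC z] * z.1 - complex.Im Q.[toC z] * z.2) + complex.Re c)).
    apply: measurable_funD => //; apply: measurable_funB; apply: measurable_funM => //.
  by apply/funext => z; rewrite hornerMXaddC /toC; case: (Q.[_]) (c) => [? ?] [? ?] /=.
rewrite (_ : (fun _ => _) = (fun z => (complex.Re Q.[toC z] * z.2 + complex.Im Q.[toC z] * z.1) + complex.Im c)).
  apply: measurable_funD => //; apply: measurable_funD; apply: measurable_funM => //.
by apply/funext => z; rewrite hornerMXaddC /toC; case: (Q.[_]) (c) => [? ?] [? ?] /=.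
Qed.

End HarmonicPolynomials.

Section GreenBump.
Context {R : realType}.
Local Notation mu := (@lebesgue_measure R).

(** The integrand is the derivative of f' W - f W', which vanishes at both ends
    of the support of the bump f. *)
Lemma integral_green_bump (c r : R) (W W1 W2 : R -> R) : 0 < r ->
  (forall x : R, is_derive x 1 W (W1 x)) -> (forall x : R, is_derive x 1 W1 (W2 x)) ->
  continuous W2 ->
  (\int[mu]_x (bump c r 2 x * W x - bump c r 0 x * W2 x)%:E = 0)%E.
Proof.
move=> r0 dW dW1 cW2.
have cont (f f' : R -> R) : (forall x : R, is_derive x 1 f (f' x)) -> continuous f.
  move=> df x; apply/differentiable_continuous/derivable1_diffP.
  by have [] := df x.
have cW := cont _ _ dW; have cW1 := cont _ _ dW1.
pose f x := bump c r 2 x * W x - bump c r 0 x * W2 x.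
pose F x := bump c r 1 x * W x - bump c r 0 x * W1 x.
have dF (x : R) : is_derive x 1 F (f x).
  have D := is_deriveB (is_deriveM (is_derive_bump c r 1 x) (dW x))
                       (is_deriveM (is_derive_bump c r 0 x) (dW1 x)).
  by apply: (is_derive_eq D); rewrite /f /GRing.scale /=; ring.
have cf : continuous f.
  by move=> x; apply: cvgB; apply: cvgM; try exact: continuous_bump; [exact: cW|exact: cW2].
have ab : c - r < c + r by lra.
have F0 x : r <= `|x - c| -> F x = 0.
  by move=> h; rewrite /F !bump_out // !mul0r subr0.
have -> : (\int[mu]_x (f x)%:E = \int[mu]_(x in `[(c - r)%R, (c + r)%R]) (f x)%:E)%E.
  rewrite [RHS]integral_mkcond; apply: eq_integral => x _; rewrite patchE.
  case: ifPn => // /negP xN; congr EFin; rewrite /f !bump_out ?mul0r ?subr0 //.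
    rewrite leNgt; apply/negP => h; apply: xN; rewrite inE /= in_itv /=.
    by move: h; rewrite ltr_norml => /andP[? ?]; apply/andP; split; lra.
  rewrite leNgt; apply/negP => h; apply: xN; rewrite inE /= in_itv /=.
  by move: h; rewrite ltr_norml => /andP[? ?]; apply/andP; split; lra.
rewrite (@continuous_FTC2 _ f F) //.
- rewrite (F0 (c + r)) ?(F0 (c - r)) ?subee //.
    by rewrite addrAC subrr sub0r normrN ger0_norm // ltW.
  by rewrite addrAC subrr add0r ger0_norm // ltW.
- exact: continuous_subspaceT.
- split.
  + by move=> x _; have [] := dF x.
  + by apply: cvg_at_right_filter; exact: (cont _ _ dF).
  + by apply: cvg_at_left_filter; exact: (cont _ _ dF).
- by move=> x _; rewrite derive1E; have [_ ->] := dF x.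
Qed.

End GreenBump.

Section WeakHarmonicity.
Context {R : realType}.
Variables (c1 c2 r : R).
Hypotheses (r0 : 0 < r) (r2 : r <= 2^-1).
Local Notation mu := (@lebesgue_measure R).
Local Notation mu2 := (mu \x mu)%E.
Local Notation sq := (square c1 c2 r).
Local Notation B := (bump2 c1 c2 r).

Lemma measurable_square : measurable sq.
Proof. by apply: measurableX; exact: measurable_itv. Qed.

Lemma square_lty : (mu2 sq < +oo)%E.
Proof.
have h (c : R) : (mu [set` `[(c - r)%R, (c + r)%R]] = (2 * r)%:E)%E.
  have hc : c - r < c + r by rewrite ltrD2l (lt_trans _ r0) // oppr_lt0.
  rewrite lebesgue_measure_itv /= lte_fin hc.
  by rewrite -EFinB; congr EFin; ring.
rewrite /square product_measure1E; try exact: measurable_itv.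
by rewrite [X in (X * _)%E]h [X in (_ * X)%E]h -EFinM ltry.
Qed.

Lemma measurable_bump2 m n : measurable_fun setT (B m n).
Proof.
have mb c k : measurable_fun setT (bump c r k).
  by apply: continuous_measurable_fun; exact: continuous_bump.
by apply: measurable_funM; apply: measurableT_comp.
Qed.

Lemma bump2_bounded m n : exists2 K, 0 <= K & forall z, `|B m n z| <= K.
Proof.
have [K1 K10 h1] := bump_bounded c1 m r2.
have [K2 K20 h2] := bump_bounded c2 n r2.
by exists (K1 * K2) => [|z]; rewrite ?mulr_ge0 // /bump2 normrM ler_pM.
Qed.

Lemma integrable_on_square (f : R * R -> R) (K : R) : measurable_fun setT f ->
  (forall z, sq z -> `|f z| <= K) -> mu2.-integrable sq (EFin \o f).
Proof.
move=> mf fK; have msq := measurable_square.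
apply: measurable_bounded_integrable => //.
- exact: square_lty.
- exact: measurable_funS mf.
- exists K; split; first exact: num_real.
  by move=> x /ltW Kx t St; apply: le_trans (fK _ St) Kx.
Qed.

Lemma integral_square (f : R * R -> R) : (forall z, ~ sq z -> f z = 0) ->
  (\int[mu2]_z (f z)%:E = \int[mu2]_(z in sq) (f z)%:E)%E.
Proof.
move=> f0; rewrite [RHS]integral_mkcond; apply: eq_integral => z _; rewrite patchE.
by case: ifPn => // /negP zN; rewrite f0 // => h; apply: zN; rewrite inE.
Qed.

Lemma integrable_square (f : R * R -> R) (K : R) : measurable_fun setT f ->
  (forall z, ~ sq z -> f z = 0) ->
  (forall z, sq z -> `|f z| <= K) -> mu2.-integrable setT (EFin \o f).
Proof.
move=> mf f0 fK.
have := (@integrable_mkcond _ _ _ mu2 _ _ measurable_square).1 (integrable_on_square mf fK).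
apply: eq_integrable => // z _.
rewrite patchE; case: ifPn => // /negP zN /=.
by rewrite f0 // => h; apply: zN; rewrite inE.
Qed.

Lemma Re_horner_bounded (Q : {poly R[i]}) : exists2 K, 0 <= K &
  forall z, sq z -> `|complex.Re Q.[toC z]| <= K.
Proof.
have [K K0 QK] := complex_horner_bounded Q (`|c1| + `|c2| + r).
exists K => // z [] /=; rewrite !in_itv /= => /andP[h1 h2] /andP[h3 h4].
have g1 := ler_norm c1; have g2 := ler_norm (- c1).
have g3 := ler_norm c2; have g4 := ler_norm (- c2).
rewrite normrN in g2; rewrite normrN in g4.
have n1 := normr_ge0 c1; have n2 := normr_ge0 c2.
by have [] := QK z _ _; rewrite ?ler_norml //; apply/andP; split; lra.
Qed.

Lemma integrable_bump2_horner m n (Q : {poly R[i]}) :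
  mu2.-integrable setT (EFin \o (fun z => B m n z * complex.Re Q.[toC z])).
Proof.
have [K1 K10 h1] := bump2_bounded m n.
have [K2 K20 h2] := Re_horner_bounded Q.
apply: (@integrable_square _ (K1 * K2)).
- by apply: measurable_funM; [exact: measurable_bump2|case: (measurable_complex_horner Q)].
- by move=> z zN; rewrite bump2_out // mul0r.
- by move=> z zs; rewrite normrM ler_pM // h2.
Qed.

Lemma integral_green_x (Q : {poly R[i]}) :
  (\int[mu2]_z (B 2 0 z * complex.Re Q.[toC z] - B 0 0 z * complex.Re Q^`()^`().[toC z])%:E = 0)%E.
Proof.
have ii : mu2.-integrable setT (fun z => (B 2 0 z * complex.Re Q.[toC z] -
    B 0 0 z * complex.Re Q^`()^`().[toC z])%:E).
  exact: (integrableB measurableT (integrable_bump2_horner 2 0 Q)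
            (integrable_bump2_horner 0 0 (Q^`()^`()))).
rewrite -(integral21_prod_meas1 ii); apply: integral0_eq => y _.
rewrite /fubini_G.
rewrite -[RHS](@integral_green_bump _ c1 r
  (fun x => bump c2 r 0 y * complex.Re Q.[x +i* y])
  (fun x => bump c2 r 0 y * complex.Re Q^`().[x +i* y])
  (fun x => bump c2 r 0 y * complex.Re Q^`()^`().[x +i* y])) //.
- apply: eq_integral => x _; congr EFin; rewrite /bump2 /toC /=; ring.
- move=> x; have [d _ _ _] := is_derive_complex_horner Q x y.
  exact: (is_deriveZ (bump c2 r 0 y) d).
- move=> x; have [d _ _ _] := is_derive_complex_horner Q^`() x y.
  exact: (is_deriveZ (bump c2 r 0 y) d).
- move=> x; apply: cvgMl_tmp; apply/differentiable_continuous/derivable1_diffP.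
  by have [[d _] _ _ _] := is_derive_complex_horner (Q^`()^`()) x y.
Qed.

(** The sign differs from the other direction because the second derivative in y
    of the real part of a polynomial is minus the one in x. *)
Lemma integral_green_y (Q : {poly R[i]}) :
  (\int[mu2]_z (B 0 2 z * complex.Re Q.[toC z] + B 0 0 z * complex.Re Q^`()^`().[toC z])%:E = 0)%E.
Proof.
have ii : mu2.-integrable setT (fun z => (B 0 2 z * complex.Re Q.[toC z] +
    B 0 0 z * complex.Re Q^`()^`().[toC z])%:E).
  exact: (integrableD measurableT (integrable_bump2_horner 0 2 Q)
            (integrable_bump2_horner 0 0 (Q^`()^`()))).
rewrite -(integral12_prod_meas1 ii); apply: integral0_eq => x _.
rewrite /fubini_F.
rewrite -[RHS](@integral_green_bump _ c2 r
  (fun y => bump c1 r 0 x * complex.Re Q.[x +i* y])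
  (fun y => - bump c1 r 0 x * complex.Im Q^`().[x +i* y])
  (fun y => - bump c1 r 0 x * complex.Re Q^`()^`().[x +i* y])) //.
- apply: eq_integral => y _; congr EFin; rewrite /bump2 /toC /=; ring.
- move=> y; have [_ _ d _] := is_derive_complex_horner Q x y.
  apply: (is_derive_eq (is_deriveZ (bump c1 r 0 x) d)).
  by rewrite /GRing.scale /= mulrN mulNr.
- move=> y; have [_ _ _ d] := is_derive_complex_horner Q^`() x y.
  exact: (is_deriveZ (- bump c1 r 0 x) d).
- move=> y; apply: cvgMl_tmp; apply/differentiable_continuous/derivable1_diffP.
  by have [_ _ [d _] _] := is_derive_complex_horner (Q^`()^`()) x y.
Qed.

(** Real parts of polynomials are harmonic, in the weak sense against the bump. *)
Lemma integral_laplacian_horner (Q : {poly R[i]}) :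
  (\int[mu2]_z (laplacian (B 0 0) z * complex.Re Q.[toC z])%:E = 0)%E.
Proof.
have i1 := integrable_bump2_horner 2 0 Q.
have i2 := integrable_bump2_horner 0 2 Q.
have i3 := integrable_bump2_horner 0 0 (Q^`()^`()).
rewrite -[RHS]adde0 -{1}(integral_green_x Q) -(integral_green_y Q).
rewrite -integralD //; last 2 first.
- exact: (integrableB measurableT i1 i3).
- exact: (integrableD measurableT i2 i3).
apply: eq_integral => z _; rewrite -EFinD; congr EFin.
by rewrite laplacian_bump2; ring.
Qed.

(** A function that is uniformly close to real parts of polynomials on the support
    of the bump is weakly harmonic there; measurability is inherited from the
    approximations. *)
Theorem integral_laplacian_eq0 (F : R * R -> R) (Q : nat -> {poly R[i]}) (er : nat -> R) :
  er @ \oo --> 0 ->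
  (forall N z, sq z -> `|F z - complex.Re (Q N).[toC z]| <= er N) ->
  (\int[mu2]_z (laplacian (B 0 0) z * F z)%:E = 0)%E.
Proof.
move=> er0 FQ; have msq := measurable_square.
have lapE : laplacian (B 0 0) = (fun z => B 2 0 z + B 0 2 z).
  by apply/funext => z; exact: laplacian_bump2.
set lap := laplacian _.
have lap0 z : ~ sq z -> lap z = 0 by move=> h; rewrite /lap lapE !bump2_out // addr0.
have mlap : measurable_fun setT lap.
  by rewrite /lap lapE; apply: measurable_funD; exact: measurable_bump2.
have [K K0 lapK] : exists2 K, 0 <= K & forall z, `|lap z| <= K.
  have [K1 K10 h1] := bump2_bounded 2 0; have [K2 K20 h2] := bump2_bounded 0 2.
  exists (K1 + K2); first exact: addr_ge0.
  by move=> z; rewrite /lap lapE; apply: le_trans (ler_normD _ _) _; exact: lerD.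
have mQ N : measurable_fun setT (fun z => lap z * complex.Re (Q N).[toC z]).
  by apply: measurable_funM => //; have [] := measurable_complex_horner (Q N).
have mF : measurable_fun setT (fun z => lap z * F z).
  apply: (measurable_fun_cvg mQ) => z _.
  have [zs|zN] := pselect (sq z); last first.
    by rewrite lap0 // mul0r; under eq_fun do rewrite mul0r; exact: cvg_cst.
  apply: cvgMl_tmp; apply/cvgrPdist_le => e e0.
  have /cvgrPdist_le/(_ e e0) := er0; apply: filterS => N.
  rewrite sub0r normrN => h; apply: le_trans (FQ N z zs) _.
  by apply: le_trans h; exact: ler_norm.
have er_ge0 N : 0 <= er N.
  have : sq (c1, c2) by split; rewrite /= in_itv /= gerBl lerDl (ltW r0).
  by move=> /(FQ N); apply: le_trans; exact: normr_ge0.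
have iQ N : mu2.-integrable sq (EFin \o (fun z => lap z * complex.Re (Q N).[toC z])).
  have [K2 K20 h2] := Re_horner_bounded (Q N).
  apply: (@integrable_on_square _ (K * K2)) => // z zs.
  by rewrite normrM ler_pM // h2.
have iF : mu2.-integrable sq (EFin \o (fun z => lap z * F z)).
  have [K2 K20 h2] := Re_horner_bounded (Q 0%N).
  apply: (@integrable_on_square _ (K * (K2 + er 0%N))) => // z zs.
  rewrite normrM ler_pM // -[F z](subrK (complex.Re (Q 0%N).[toC z])) addrC.
  by apply: le_trans (ler_normD _ _) _; apply: lerD; [exact: h2|exact: FQ].
have lG0 (G : R * R -> R) z : ~ sq z -> lap z * G z = 0 by move=> h; rewrite lap0 // mul0r.
rewrite (integral_square (lG0 F)).
have -> : (\int[mu2]_(z in sq) (lap z * F z)%:E)%E = (\int[mu2]_(z in sq) (lap z * F z))%R%:E.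
  by rewrite /Rintegral fineK //; exact: integrable_fin_num.
have Q0 N : (\int[mu2]_(z in sq) (lap z * complex.Re (Q N).[toC z]))%R = 0.
  have := integral_laplacian_horner (Q N).
  by rewrite (integral_square (lG0 _)) /Rintegral => ->.
congr EFin; apply/eqP; rewrite -normr_le0.
set V := fine (mu2 sq).
have bound N : `|(\int[mu2]_(z in sq) (lap z * F z))%R| <= K * er N * V.
  have iB : mu2.-integrable sq (EFin \o (fun z => lap z * F z - lap z * complex.Re (Q N).[toC z])).
    apply: (@integrable_on_square _ (K * er N)).
      exact: measurable_funB mF (mQ N).
    by move=> z zs; rewrite -mulrBr normrM ler_pM // FQ.
  rewrite -[X in `|X|]subr0 -(Q0 N) -(@RintegralB _ _ _ mu2) //.
  apply: le_trans (@le_normr_Rintegral _ _ _ mu2 _ _ msq iB) _.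
  rewrite /V -Rintegral_cst //; apply: le_Rintegral => //.
  - exact: integrable_norm iB.
  - by apply: (@integrable_on_square _ `|K * er N|) => // z _.
  - by move=> z zs; rewrite -mulrBr normrM ler_pM // FQ.
have cv : (fun N => K * er N * V) @ \oo --> (0 : R).
  rewrite -[X in _ --> X](mul0r V) -[X in X * V](mulr0 K).
  by apply: cvgMr_tmp; apply: cvgMl_tmp.
rewrite -(cvg_lim _ cv) //; apply: limr_ge; first exact: cvgP cv.
by apply: nearW => N; exact: bound.
Qed.

End WeakHarmonicity.

(** * The support of the Brown measure *)

Section BrownMeasureSupport.
Context {R : realType} {H : completeNormedModType R[i]}.
Context {ip : {dot H for Num.conj}}.
Context {M : set (H -> H)} {tau : (H -> H) -> R[i]}.
Context {hM : tracial_vna ip M tau}.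
Local Notation A := (opalg hM).

Lemma conj_cabs (w : R[i]) : cabs (conjc w) = cabs w.
Proof. by rewrite /cabs !normc_def; case: w => x y /=; rewrite sqrrN. Qed.

Lemma expansion_radius_gt0 (e C r : R) : 0 < e -> 0 < C -> 0 < r -> 0 < expansion_radius e C r.
Proof.
by move=> e0 C0 r0; rewrite lt_min r0 divr_gt0 ?exprn_gt0 // mulr_gt0.
Qed.

Lemma cabs_toC (x y : R) : cabs (x +i* y) <= `|x| + `|y|.
Proof.
rewrite /cabs normc_def /= -ler_sqr ?nnegrE ?sqrtr_ge0 ?addr_ge0 //.
rewrite sqr_sqrtr ?addr_ge0 ?sqr_ge0 // sqrrD !real_normK ?num_real //.
by rewrite -addrA lerD2l lerDr mulrn_wge0 // mulr_ge0.
Qed.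

(** The bump is positive on an open neighbourhood of the point, which has positive
    measure. *)
Lemma integral_bump2_eq0 (mu : probability (R * R)%type R) (z1 : R * R) (r : R) :
  0 < r -> measure_support mu z1 ->
  (\int[mu]_z (bump2 z1.1 z1.2 r 0 0 z)%:E <> 0)%E.
Proof.
move=> r0 z1mu int0.
have mphi := @measurable_bump2 R z1.1 z1.2 r 0 0.
have ephi : measurable_fun setT (EFin \o bump2 z1.1 z1.2 r 0 0) by exact/measurable_EFinP.
pose U : set (R * R) := [set z | `|z.1 - z1.1| < r] `&` [set z | `|z.2 - z1.2| < r].
have oU : open U.
  apply: openI.
    apply: (@open_comp _ _ (fun z : R * R => `|z.1 - z1.1|) [set u | u < r]); last exact: open_lt.
    move=> z _; apply: cvg_norm; apply: cvgB; [exact: cvg_fst|exact: cvg_cst].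
  apply: (@open_comp _ _ (fun z : R * R => `|z.2 - z1.2|) [set u | u < r]); last exact: open_lt.
  by move=> z _; apply: cvg_norm; apply: cvgB; [exact: cvg_snd|exact: cvg_cst].
have Uz : U z1 by split; rewrite /= subrr normr0.
have mU : measurable U.
  have -> : U = [set` `]z1.1 - r, z1.1 + r[] `*` [set` `]z1.2 - r, z1.2 + r[].
    apply/seteqP; split=> z; rewrite /U /setI /= !in_itv /= !ltr_norml.
      by move=> [/andP[? ?] /andP[? ?]]; split; apply/andP; split; lra.
    by move=> [/andP[? ?] /andP[? ?]]; split; apply/andP; split; lra.
  by apply: measurableX; exact: measurable_itv.
have /(ae_eq_integral_abs mu measurableT ephi) [N [mN N0 sub]] :
    (\int[mu]_z `|(EFin \o bump2 z1.1 z1.2 r 0%N 0%N) z| = 0)%E.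
  rewrite -[RHS]int0; apply: eq_integral => z _ /=.
  by rewrite ger0_norm // /bump2 mulr_ge0 // bump_ge0.
have UN : U `<=` N.
  move=> z [z1r z2r]; apply: sub => /= h.
  have := h I => /= -[] /eqP; rewrite /bump2 mulf_eq0.
  by rewrite !gt_eqF // bump_gt0.
have := z1mu U oU Uz; rewrite ltNge => /negP; apply.
by rewrite -N0; apply: le_measure; rewrite ?inE.
Qed.

Variables (p q : A) (al al' be be' : R).
Hypotheses (sp : star p = p) (sq : star q = q).
Hypotheses (nal : al != al') (nbe : be != be').
Hypothesis p2 : (p - al%:C *: 1) * (p - al'%:C *: 1) = 0.
Hypothesis q2 : (q - be%:C *: 1) * (q - be'%:C *: 1) = 0.

(** Off the hyperbola the shifted operators stay bounded below on a disc, so the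
    logarithm of the determinant is weakly harmonic on a square inside it. *)
Theorem brown_support_in_hyperbola (mu : probability (R * R)%type R) :
  brown_measure ip M tau (p + 'i *: q : A) mu ->
  @toC R @` measure_support mu `<=`
    hyperbola al al' be be' `&` rectangle al al' be be'.
Proof.
move=> [Delta DeltaP muP] _ [z1 z1mu <-]; apply: contrapT => zHR.
have [e [e0 be1 be2]] := resolvent_bounded_below sp sq nal nbe p2 q2 zHR.
set a := toC z1 *: 1 - (p + 'i *: q) in be1 be2.
have [K K0 aK] := bnd_exists a.
pose C := K + e.
have eh0 : 0 < e / 2 by rewrite divr_gt0.
have eC : e / 2 <= C by rewrite /C; lra.
have ehE : e - e / 2 = e / 2 by field.
have lower w : cabs w <= e / 2 -> bounded_below (a + w *: 1) (e / 2).
  by move=> /(bounded_below_shift be1); rewrite ehE.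
have lower' w : cabs w <= e / 2 -> bounded_below (star (a + w *: 1)) (e / 2).
  rewrite starD starZ star1 -conj_cabs => /(bounded_below_shift be2).
  by rewrite ehE.
have upper w : cabs w <= e / 2 -> bnd (a + w *: 1) C.
  move=> we; have := bndD aK (bndZ w bnd1 : bnd (w *: (1 : A)) _).
  by apply: bnd_le; rewrite mulr1 -/(cabs w) /C; lra.
have C0 : 0 < C by rewrite /C; lra.
have [g [c [er er0 exP]]] := log_determinant_expansion eh0 eC (ltW eh0) lower lower' upper.
set rho := expansion_radius _ _ _ in exP.
have rho0 : 0 < rho by exact: expansion_radius_gt0.
(* With r <= 1/2 the arguments of the flat functions stay below 1 on the support;
   the half of rho accounts for the two coordinates. *)
pose r := Num.min 2^-1 (rho / 2).
have r0 : 0 < r by rewrite lt_min invr_gt0 ltr0n divr_gt0.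
have r2 : r <= 2^-1 by rewrite ge_min lexx.
have rr : r <= rho / 2 by rewrite ge_min lexx orbT.
pose phi := bump2 z1.1 z1.2 r 0 0.
have zE z : toC z *: 1 - (p + 'i *: q) = a + (toC z - toC z1) *: 1 :> A.
  by rewrite /a addrAC -scalerDl [toC z1 + _]addrC subrK.
have sqP z : square z1.1 z1.2 r z -> cabs (toC z - toC z1) <= rho.
  case: z => x y [] /=; rewrite !in_itv /= => /andP[h1 h2] /andP[h3 h4].
  rewrite /toC -[_ - _]/(_ +i* _); apply: le_trans (cabs_toC _ _) _.
  have : `|x - z1.1| <= r by rewrite ler_norml; apply/andP; split; lra.
  have : `|y - z1.2| <= r by rewrite ler_norml; apply/andP; split; lra.
  by lra.
pose F z := fine (lne (Delta z)).
pose Q N : {poly R[i]} := (g N)%:C%:P + \sum_(j < N) c N j *: ('X - (toC z1)%:P) ^+ j.+1.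
have QE N z : complex.Re (Q N).[toC z] =
    g N + complex.Re (\sum_(j < N) c N j * (toC z - toC z1) ^+ j.+1).
  rewrite /Q hornerD hornerC horner_sum.
  under eq_bigr do rewrite hornerZ horner_exp hornerXsubC.
  by case: (\sum_(_ < _) _).
have FP z : square z1.1 z1.2 r z -> lne (Delta z) = (F z)%:E /\
    forall N, `|F z - complex.Re (Q N).[toC z]| <= er N.
  move=> zs; have fk : fuglede_kadison ip M tau (a + (toC z - toC z1) *: 1 : A) (Delta z).
    by rewrite -zE; exact: DeltaP.
  have [l [lE lN]] := exP _ _ (sqP _ zs) fk.
  by rewrite /F lE /=; split=> // N; rewrite QE.
have lap0 := integral_laplacian_eq0 r0 r2 er0 (fun N z zs => (FP z zs).2 N).
apply: (integral_bump2_eq0 r0 z1mu).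
rewrite (muP _ (test_function_bump2 _ _ _)).
rewrite [X in (_ * X)%E](_ : _ = 0)%E ?mule0 // -[RHS]lap0.
apply: eq_integral => z _; have [zs|zN] := pselect (square z1.1 z1.2 r z).
  by rewrite (FP z zs).1 EFinM.
by rewrite laplacian_bump2 !bump2_out // addr0 !mul0e mul0r.
Qed.

End BrownMeasureSupport.

(** * Conclusion *)

Theorem corollary4p5 (R : realType) (H : completeNormedModType R[i])
    (ip : {dot H for Num.conj}) (M : set (H -> H)) (tau : (H -> H) -> R[i])
    (p q : H -> H) (a b alpha alpha' beta beta' : R) :
  inner_product_norm ip ->
  von_neumann_algebra ip M ->
  faithful_normal_tracial_state ip M tau ->
  M p -> self_adjoint ip p ->
  M q -> self_adjoint ip q ->
  0 < a < 1 -> 0 < b < 1 -> alpha != alpha' -> beta != beta' ->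
  spectral_measure ip M tau p (two_atoms a alpha alpha') ->
  spectral_measure ip M tau q (two_atoms b beta beta') ->
  let A := alpha' - alpha in
  let B := beta' - beta in
  let HR := hyperbola alpha alpha' beta beta'
            `&` rectangle alpha alpha' beta beta' in
  let I : set R := [set` `[0, pi / 2]] in
  let l1 := lambda1 alpha alpha' beta beta' in
  let l2 := lambda2 alpha alpha' beta beta' in
  [/\ {within I, continuous (l1 : R -> R[i]^o)} /\
      {within I, continuous (l2 : R -> R[i]^o)},
      l1 @` I `|` l2 @` I = HR,
      (`|B| <= `|A| ->
         l1 @` I = HR `&` [set z | complex.Re z <= (alpha + alpha') / 2] /\
         l2 @` I = HR `&` [set z | (alpha + alpha') / 2 <= complex.Re z]) /\
      (`|A| < `|B| ->
         l1 @` I = HR `&` [set z | complex.Im z <= (beta + beta') / 2] /\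
         l2 @` I = HR `&` [set z | (beta + beta') / 2 <= complex.Im z]) &
      forall mu : probability (R * R)%type R,
        brown_measure ip M tau (p + 'i *: q) mu ->
        @toC R @` measure_support mu `<=` HR].
Proof.
move=> ipN vnM tauM Mp sp Mq sq _ _ nal nbe spp spq A B HR I l1 l2.
pose hM := And3 ipN vnM tauM : tracial_vna ip M tau.
have [c1 c2] := continuous_lambda alpha alpha' beta beta'.
split.
- by split; apply: continuous_subspaceT; [exact: c1|exact: c2].
- exact: lambda_union.
- by split; [exact: lambda_left_right|exact: lambda_bottom_top].
move=> mu muB.
have sP : star (inM hM Mp) = inM hM Mp by exact: star_unique.
have sQ : star (inM hM Mq) = inM hM Mq by exact: star_unique.
have p2 := two_point_spectrum sP (spp : spectral_measure ip M tau (inM hM Mp) _).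
have q2 := two_point_spectrum sQ (spq : spectral_measure ip M tau (inM hM Mq) _).
exact: (brown_support_in_hyperbola sP sQ nal nbe p2 q2 muB).
Qed.
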